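(* Let $d,k\ge 2$ be integers, let $\mathcal{N}_{d,k}$ be the Neretin group and let $\mathcal{O}_{d,k}=\bigcup_{n\ge 0}\mathcal{O}_{d,k}^{(n)}$ be its distinguished open subgroup. Then the group von Neumann algebra $L(\mathcal{O}_{d,k})$ is of type II. In particular, the locally compact group $\mathcal{O}_{d,k}$ is not of type I.
   Context: **The tree and the Neretin group.** $\mathcal{T}_{d,k}$ is the rooted tree whose root $v_0$ has $k$ adjacent vertices and all of whose other vertices have $d+1$ adjacent vertices. An almost automorphism of $\mathcal{T}_{d,k}$ is a triple $(A,B,\varphi)$ where $A,B\subset\mathcal{T}_{d,k}$ are finite subtrees containing the root with $|\partial A|=|\partial B|$ ($\partial A$ is the set of vertices of $A$ having no children in $A$) and $\varphi:\mathcal{T}_{d,k}\setminus A\to\mathcal{T}_{d,k}\setminus B$ is an isomorphism (of forests). Two almost automorphisms $(A_1,B_1,\varphi_1)$, $(A_2,B_2,\varphi_2)$ are identified if there is a finite subtree $\tilde A\subset\mathcal{T}_{d,k}$ containing the root with $A_1,A_2\subset\tilde A$ and $\varphi_1|_{\mathcal{T}_{d,k}\setminus\tilde A}=\varphi_2|_{\mathcal{T}_{d,k}\setminus\tilde A}$. The Neretin group $\mathcal{N}_{d,k}$ is the set of equivalence classes; it is a group under composition (of representatives restricted to complements of sufficiently large finite subtrees). **The subgroup.** Let $B_n$ be the ball of radius $n$ around $v_0$ for the graph metric. $\mathcal{O}_{d,k}^{(n)}$ is the subgroup of $\mathcal{N}_{d,k}$ of classes of triples $(B_n,B_n,\varphi)$,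 $\varphi$ an automorphism of $\mathcal{T}_{d,k}\setminus B_n$. These subgroups increase with $n$, and each contains $K:=\operatorname{Aut}(\mathcal{T}_{d,k})$ (embedded by restricting automorphisms, which preserve every $B_n$). Put $\mathcal{O}_{d,k}:=\bigcup_{n\ge0}\mathcal{O}_{d,k}^{(n)}$. **Topology.** $\mathcal{N}_{d,k}$ carries the totally disconnected locally compact Hausdorff group topology for which the inclusion $K\hookrightarrow\mathcal{N}_{d,k}$ is continuous and open, where $K$ has its usual compact topology of pointwise convergence on vertices. $\mathcal{O}_{d,k}$ is an open subgroup and has the subspace topology. **Group von Neumann algebra.** For a locally compact second countable group $G$ with left Haar measure, $L(G):=\{\lambda_g: g\in G\}''\subset B(L^2(G))$, where $(\lambda_g f)(h)=f(g^{-1}h)$. **Types.** A von Neumann algebra $M$ is of type I if it is isomorphic to $\prod_{j\in J}\mathcal{A}_j\,\bar\otimes\,B(H_j)$ for some set $J$ of cardinals, with $\mathcal{A}_j$ an abelian von Neumann algebra and $H_j$ a Hilbert space of dimension $j$. It is of type II$_1$ if it has no nonzero direct summand of type I and has a separating family of normal tracial states. It is of type II$_\infty$ if it has no nonzero summand of type I or II$_1$ but there is an increasing net of projections $p_i\in M$ converging strongly to $1_M$ with every $p_iMp_i$ of type II$_1$. It is of type II if it is a direct sum of a type II$_1$ and a type II$_\infty$ von Neumann algebra (either summand may be zero). A unitary representation $(\pi,H)$ of a locally compact group $G$ is of type I if $\pi(G)''\subset B(H)$ is of type I; $G$ is of type I if all its unitary representations are of type I. *)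

(* Defs.v *)
From HB Require Import structures.
From mathcomp Require Import all_boot all_order all_algebra.
From mathcomp Require Import all_classical all_reals all_analysis.
From mathcomp Require Import measurable_realfun lebesgue_integral ring lra.
From mathcomp.real_closed Require Import complex.

Set Implicit Arguments.
Unset Strict Implicit.
Unset Printing Implicit Defensive.
Import Order.TTheory GRing.Theory Num.Theory.
Import numFieldNormedType.Exports.

Local Open Scope classical_set_scope.
Local Open Scope ring_scope.

(* Continuity of the group operations is not part of the structure. *)
#[short(type="groupTopType")]
HB.structure Definition GroupTop := {G of Group G & Topological G & isPointed G}.

Section Tree.
Variables d k : nat.

(* None is the root and Some (i, s) the vertex reached from the root by going
   to its i-th neighbour and then following the word s, last letter first. *)
Definition vertex : Type := option ('I_k * seq 'I_d).
HB.instance Definition _ := Countable.on vertex.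

Definition root : vertex := None.
HB.instance Definition _ := isPointed.Build vertex root.

Definition parent (x : vertex) : option vertex :=
  match x with
  | None => None
  | Some (i, s) => Some (if s is _ :: s' then Some (i, s') else None)
  end.

Definition adj : rel vertex :=
  fun x y => (parent x == Some y) || (parent y == Some x).

Definition depth (x : vertex) : nat := if x is Some (_, s) then (size s).+1 else 0.

(* depth is the graph distance to the root, so this is the ball of radius n. *)
Definition vball (n : nat) : set vertex := [set x | (depth x <= n)%N].

(* A nonempty set of vertices closed under taking parents is the vertex set of a
   subtree containing the root. *)
Definition finite_subtree (A : set vertex) : Prop :=
  [/\ finite_set A, A root & forall x y, A x -> parent x = Some y -> A y].

Definition boundary (A : set vertex) : set vertex :=
  [set x | A x /\ forall y, A y -> parent y <> Some x].

Definition forest_iso (A B : set vertex) (f : vertex -> vertex) : Prop :=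
  set_bij (~` A) (~` B) f /\
  forall x y, ~ A x -> ~ A y -> adj (f x) (f y) = adj x y.

(* aa_map is total for convenience; its values on aa_dom are irrelevant, and
   aa_equiv does not see them. *)
Record almost_aut : Type := AlmostAut {
  aa_dom : set vertex;
  aa_cod : set vertex;
  aa_map : vertex -> vertex;
  aa_dom_subtree : finite_subtree aa_dom;
  aa_cod_subtree : finite_subtree aa_cod;
  aa_boundary : (boundary aa_dom #= boundary aa_cod)%card;
  aa_iso : forest_iso aa_dom aa_cod aa_map }.

HB.instance Definition _ := gen_eqMixin almost_aut.
HB.instance Definition _ := gen_choiceMixin almost_aut.

Definition aa_equiv (p q : almost_aut) : Prop :=
  exists A : set vertex, [/\ finite_subtree A, aa_dom p `<=` A, aa_dom q `<=` A
    & forall x, ~ A x -> aa_map p x = aa_map q x].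

Lemma neqSS n : n <> n.+2. Proof. by elim: n => // n IHn []. Qed.

Lemma parent_depth x y : parent x = Some y -> depth x = (depth y).+1.
Proof. by case: x => [[i [|j s]]|//] [<-]. Qed.

Lemma finite_vball n : finite_set (vball n).
Proof.
pose E := [set (Some (i, val b) : vertex) | i in [set: 'I_k] & b in [set: n.-bseq 'I_d]].
apply: (@sub_finite_set _ _ ([set root] `|` E)).
  case=> [[i s]|] /=; last by left.
  move=> h; right; have hs : (size s <= n)%N by exact: ltnW.
  by exists i => //; exists (Bseq hs).
rewrite finite_setU; split; first exact: finite_set1.
by apply: finite_image2; exact: finite_finset.
Qed.

Lemma vball_subtree n : finite_subtree (vball n).
Proof.
split; [exact: finite_vball | by [] | move=> x y /= + /parent_depth e].
by rewrite /vball /= e; exact: ltnW.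
Qed.

Lemma finite_sub_vball (A : set vertex) : finite_set A -> exists n, A `<=` vball n.
Proof.
move=> fA; have [s ->] := (finite_seqP A).1 fA.
exists (\max_(x <- s) depth x)%N => x /= xs.
exact: (@leq_bigmax_seq _ s predT).
Qed.

Lemma vball_mono m n : (m <= n)%N -> vball m `<=` vball n.
Proof. by move=> mn x /= /leq_trans; exact. Qed.

Lemma vball_sep n x y : ~ vball n x -> parent x = Some y -> vball n y -> depth x = n.+1.
Proof.
rewrite /vball /= => /negP; rewrite -ltnNge => + /parent_depth e.
by rewrite e => h1 h2; congr _.+1; apply/eqP; rewrite eqn_leq h2 -ltnS h1.
Qed.

Lemma adj_parent x y : parent x = Some y -> adj x y.
Proof. by move=> e; rewrite /adj e eqxx. Qed.

Lemma adjC x y : adj x y = adj y x. Proof. exact: orbC. Qed.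

Lemma adjP x y : adj x y -> parent x = Some y \/ parent y = Some x.
Proof. by case/orP => /eqP; [left|right]. Qed.

Lemma child_nonroot_unique x y z :
  parent x = Some y -> parent x = Some z -> y = z.
Proof. by move=> -> [->]. Qed.

Definition childn (x : vertex) (j : 'I_d) : vertex :=
  if x is Some (i, s) then Some (i, j :: s) else None.

Lemma childn_parent x j : x <> root -> parent (childn x j) = Some x.
Proof. by case: x => [[i s]|]. Qed.

Lemma childn_inj x : x <> root -> injective (childn x).
Proof. by case: x => [[i s]|//] _ j1 j2 [->]. Qed.

Lemma childnP x y : x <> root -> parent y = Some x -> exists j, y = childn x j.
Proof.
case: x => [[i s]|//] _; case: y => [[i' [|j s']]|] //= [<- <-].
by exists j.
Qed.

Lemma forest_iso_inv A B f : forest_iso A B f -> exists g, [/\ forest_iso B A g,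
  forall x, ~ A x -> g (f x) = x & forall x, ~ B x -> f (g x) = x].
Proof.
move=> [[fAB finj fsurj] fadj].
have /choice[g gP] y : exists x, ~ B y -> ~ A x /\ f x = y.
  have [By|nBy] := pselect (B y); first by exists root.
  by have [x /= nAx <-] := fsurj y nBy; exists x.
have fg x : ~ B x -> f (g x) = x by move=> /gP[].
have gf x : ~ A x -> g (f x) = x.
  move=> nA; have [nAg e] := gP (f x) (fAB _ nA).
  by apply: finj => //; rewrite ?inE.
exists g; split=> //; split.
  split=> [y /gP[]//|y z /set_mem/= By /set_mem/= Bz e|x /= nA].
    by rewrite -(fg y) // e fg.
  by exists (f x); [exact: fAB|exact: gf].
move=> x y Bx By; have [Ax ex] := gP _ Bx; have [Ay ey] := gP _ By.
by rewrite -fadj // ex ey.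
Qed.

Lemma forest_iso_parent_out A B f x y : finite_subtree A -> finite_subtree B ->
  forest_iso A B f -> ~ A x -> parent (f x) = Some y -> ~ B y ->
  exists2 z, parent x = Some z & ~ A z.
Proof.
move=> [_ Ar Ap] [_ Br Bp] fi nAx fxy nBy; apply: contrapT => hz.
have [g [[[gBA ginj _] gadj] gf fg]] := forest_iso_inv fi.
case: fi => [[fAB finj _] fadj].
have nBx : ~ B (f x) := fAB _ nAx.
have fxr : f x <> root by move=> e; apply: nBx; rewrite e.
have xr : x <> root by move=> e; apply: nAx; rewrite e.
have nBc j : ~ B (childn (f x) j).
  by move=> h; apply: nBx; apply: Bp h _; exact: childn_parent.
pose h (o : option 'I_d) := if o is Some j then childn (f x) j else y.
have nBh o : ~ B (h o) by case: o.
have adjh o : adj (h o) (f x).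
  by case: o => [j|] /=; [apply: adj_parent; exact: childn_parent|rewrite adjC; exact: adj_parent].
have hinj : injective h.
  case=> [j|] [j'|] //= e.
  - by rewrite (childn_inj fxr e).
  - exfalso; have := parent_depth (childn_parent j fxr).
    by rewrite e (parent_depth fxy) => /neqSS.
  - exfalso; have := parent_depth (childn_parent j' fxr).
    by rewrite -e (parent_depth fxy) => /neqSS.
have /choice[c cP] o : exists j, g (h o) = childn x j.
  apply: childnP => //; have := adjh o; rewrite -gadj // gf //.
  case/adjP => // xp; exfalso; apply: hz; exists (g (h o)) => //; exact: gBA (nBh o).
have cinj : injective c.
  move=> o o' e; apply: hinj; apply: ginj; rewrite ?inE //; first exact: nBh.
    exact: nBh.
  by rewrite !cP e.
by have := leq_card c cinj; rewrite card_option ltnn.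
Qed.

Lemma forest_iso_parent A B f x y : finite_subtree A -> finite_subtree B ->
  forest_iso A B f -> ~ A x -> ~ A y -> parent x = Some y ->
  parent (f x) = Some (f y).
Proof.
move=> sA sB fi.
have [n] := ubnP (depth y); elim: n x y => // n IHn x y; rewrite ltnS => yn nAx nAy xy.
have := fi.2 _ _ nAx nAy; rewrite (adj_parent xy) => /adjP[//|yx].
have [g [gi gf fg]] := forest_iso_inv fi.
case: (fi) => [[fAB finj _] fadj].
have [z yz nAz] := forest_iso_parent_out sA sB fi nAy yx (fAB _ nAx).
have yz' : parent (f y) = Some (f z).
  by apply: IHn => //; rewrite -(parent_depth yz).
have : x = z.
  by apply: finj; rewrite ?inE //; exact: child_nonroot_unique yx yz'.
by move=> e; move: (parent_depth xy) (parent_depth yz); rewrite e => -> /neqSS.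
Qed.

Lemma forest_iso_root A B f x y : finite_subtree A -> finite_subtree B ->
  forest_iso A B f -> ~ A x -> parent x = Some y -> A y ->
  exists2 z, parent (f x) = Some z & B z.
Proof.
move=> sA sB fi nAx xy Ay.
have nBx : ~ B (f x) by case: fi => [[+ _ _] _]; exact.
case E : (parent (f x)) => [z|]; last first.
  by exfalso; apply: nBx; case: (f x) E => [[]//|] _; case: sB.
exists z => //; apply: contrapT => nBz.
have [z' xz' nAz'] := forest_iso_parent_out sA sB fi nAx E nBz.
by apply: nAz'; rewrite -(child_nonroot_unique xy xz').
Qed.

Lemma forest_iso_comp A B C f g :
  forest_iso A B f -> forest_iso B C g -> forest_iso A C (g \o f).
Proof.
move=> [fb fa] [gb ga]; split; first exact: set_bij_comp gb.
by move=> x y Ax Ay /=; case: fb => fAB _ _; rewrite ga ?fa //; exact: fAB.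
Qed.

Definition cofin_eq (f g : vertex -> vertex) := finite_set [set x | f x <> g x].

Lemma cofin_eq_refl f : cofin_eq f f.
Proof. by rewrite /cofin_eq (_ : [set _ | _] = set0) // -subset0 => x /=. Qed.

Lemma cofin_eq_sym f g : cofin_eq f g -> cofin_eq g f.
Proof. by apply: sub_finite_set => x /= h e; apply: h. Qed.

Lemma cofin_eq_trans g f h : cofin_eq f g -> cofin_eq g h -> cofin_eq f h.
Proof.
move=> fg gh; apply: (@sub_finite_set _ _ ([set x | f x <> g x] `|` [set x | g x <> h x])).
  move=> x /= ne; have [e|] := pselect (f x = g x); last by left.
  by right; rewrite -e.
by rewrite finite_setU.
Qed.

Lemma cofin_eq_compl h f g : cofin_eq f g -> cofin_eq (h \o f) (h \o g).
Proof. by apply: sub_finite_set => x /= ne e; apply: ne; rewrite e. Qed.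

Lemma cofin_eq_compr p f g : cofin_eq f g -> cofin_eq (f \o aa_map p) (g \o aa_map p).
Proof.
case: p => A B h [fA _ _] _ _ hi /= fg.
have [h' [_ h'h _]] := forest_iso_inv hi.
apply: (@sub_finite_set _ _ (A `|` h' @` [set x | f x <> g x])).
  move=> x /= ne; have [|nA] := pselect (A x); [by left|right].
  by exists (h x) => //; exact: h'h.
by rewrite finite_setU; split => //; exact: finite_image.
Qed.

Lemma aa_equivP p q : aa_equiv p q <-> cofin_eq (aa_map p) (aa_map q).
Proof.
split=> [[A [[fA _ _] _ _ pq]]|pq].
  by apply: sub_finite_set fA => x /= ne; apply: contrapT => /pq.
have [] := @finite_sub_vball ([set x | aa_map p x <> aa_map q x] `|` (aa_dom p `|` aa_dom q)).
  rewrite !finite_setU; split=> //; split.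
    by case: (aa_dom_subtree p).
  by case: (aa_dom_subtree q).
move=> n h; exists (vball n); split; first exact: vball_subtree.
- by move=> x ?; apply: h; right; left.
- by move=> x ?; apply: h; right; right.
- by move=> x nx; apply: contrapT => ne; apply: nx; apply: h; left.
Qed.


Lemma set_bijNC (A B : set vertex) (f : vertex -> vertex) x : set_bij (~` A) (~` B) f -> ~ A x -> ~ B (f x).
Proof. by case=> fAB _ _; exact: fAB. Qed.

Definition pullback (A : set vertex) (f : vertex -> vertex) (C : set vertex) :=
  [set x | ~ A x -> C (f x)].

Lemma pullback_subtree A B f n : finite_subtree A -> finite_subtree B ->
  forest_iso A B f -> finite_subtree (pullback A f (vball n)).
Proof.
move=> sA sB fi; have [g [gi gf fg]] := forest_iso_inv fi; split.
- apply: (@sub_finite_set _ _ (A `|` g @` vball n)).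
    move=> x /= h; have [|nA] := pselect (A x); [by left|right].
    by exists (f x); [exact: h|exact: gf].
  by rewrite finite_setU; split; [case: sA|exact/finite_image/finite_vball].
- by move=> nA; exfalso; apply: nA; case: sA.
- move=> x y /= hx xy nAy.
  have nAx : ~ A x by case: sA => _ _ Ap Ax; apply: nAy; exact: Ap Ax xy.
  have [_ _] := vball_subtree n; apply; first exact: hx nAx.
  exact: forest_iso_parent sA sB fi nAx nAy xy.
Qed.

Lemma has_child (x : vertex) : ~ finite_set [set: vertex] -> exists y, parent y = Some x.
Proof.
move=> ninf; have [[x0 j]|nk] := pselect (exists2 _ : 'I_k, True & True /\ inhabited 'I_d).
  move=> [_ [j']]; case: x => [[i s]|].
    by exists (childn (Some (i, s)) j'); exact: childn_parent.
  by exists (Some (x0, [::])).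
exfalso; apply: ninf.
apply: (sub_finite_set _ (finite_vball 1)) => -[[i [|j s]]|] //= _.
by exfalso; apply: nk; exists i.
Qed.

Lemma boundary_pullback A B f n : ~ finite_set [set: vertex] ->
  finite_subtree A -> finite_subtree B ->
  forest_iso A B f -> B `<=` vball n ->
  set_bij (boundary (pullback A f (vball n.+1))) (boundary (vball n.+1)) f.
Proof.
move=> ninf sA sB fi Bn.
have bb : boundary (vball n.+1) = [set z | depth z = n.+1].
  apply/seteqP; split=> z /=.
    move=> [zn hz]; apply/eqP; rewrite eqn_leq zn /= leqNgt; apply/negP => h.
    have [y yz] := has_child z ninf; apply: (hz _ _ yz).
    by rewrite /vball /= (parent_depth yz).
  move=> e; split; first by rewrite /vball /= e.
  by move=> y h yz; move: h; rewrite /vball /= (parent_depth yz) e ltnn.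
have bp : boundary (pullback A f (vball n.+1)) = [set x | ~ A x /\ depth (f x) = n.+1].
  apply/seteqP; split=> x /=.
    move=> [xP hx]; have [y yx] := has_child x ninf.
    have nPy : ~ pullback A f (vball n.+1) y by move=> /hx; apply.
    have [nAy nCy] : ~ A y /\ ~ vball n.+1 (f y) by apply/not_implyP.
    have [Ax|nAx] := pselect (A x).
      have [z fyz Bz] := forest_iso_root sA sB fi nAy yx Ax.
      exfalso; apply: nCy; rewrite /vball /= (parent_depth fyz) ltnS.
      exact: Bn.
    split=> //; have fyx := forest_iso_parent sA sB fi nAy nAx yx.
    apply/eqP; rewrite eqn_leq (xP nAx) /= leqNgt; apply/negP => h; apply: nCy.
    by rewrite /vball /= (parent_depth fyx).
  move=> [nAx e]; split; first by move=> _; rewrite /vball /= e.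
  move=> y Py yx; have nAy : ~ A y.
    by case: sA => _ _ Ap Ay; apply: nAx; exact: Ap Ay yx.
  have := Py nAy; have fyx := forest_iso_parent sA sB fi nAy nAx yx.
  by rewrite /vball /= (parent_depth fyx) e ltnn.
rewrite bb bp; case: (fi) => [[fAB finj fsurj] _]; split.
- by move=> x /= [].
- move=> x y /set_mem/= [nAx _] /set_mem/= [nAy _]; apply: finj; exact: mem_set.
- move=> z /= zn; have nBz : ~ B z by move=> /Bn; rewrite /vball /= zn ltnn.
  have [x /= nAx e] := fsurj z nBz; exists x => //=; by rewrite e.
Qed.

Lemma aa_inv_exists (p : almost_aut) : exists q : almost_aut,
  [/\ aa_dom q = aa_cod p, aa_cod q = aa_dom p,
   cofin_eq (aa_map q \o aa_map p) id & cofin_eq (aa_map p \o aa_map q) id].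
Proof.
case: p => A B f sA sB AB fi; have [g [gi gf fg]] := forest_iso_inv fi.
have BA : (boundary B #= boundary A)%card by rewrite card_eq_sym.
exists (AlmostAut sB sA BA gi) => /=; split => //.
  by case: sA => + _ _; apply: sub_finite_set => x /= ne; apply: contrapT => /gf.
by case: sB => + _ _; apply: sub_finite_set => x /= ne; apply: contrapT => /fg.
Qed.

Lemma aa_comp_exists (p q : almost_aut) : exists r : almost_aut,
  cofin_eq (aa_map r) (aa_map p \o aa_map q).
Proof.
have [fin|ninf] := pselect (finite_set [set: vertex]).
  by exists p; apply: sub_finite_set fin.
case: p q => A2 B2 g sA2 sB2 _ gi [A1 B1 f sA1 sB1 _ fi] /=.
have [g' [gi' g'g gg']] := forest_iso_inv gi.
have [n Bn] : exists n, B1 `|` A2 `<=` vball n.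
  by apply: finite_sub_vball; rewrite finite_setU; split; [case: sB1|case: sA2].
have B1n : B1 `<=` vball n by move=> x ?; apply: Bn; left.
have A2n : A2 `<=` vball n by move=> x ?; apply: Bn; right.
pose D := pullback A1 f (vball n.+1); pose E := pullback B2 g' (vball n.+1).
have sD : finite_subtree D := pullback_subtree n.+1 sA1 sB1 fi.
have sE : finite_subtree E := pullback_subtree n.+1 sB2 sA2 gi'.
have DE : (boundary D #= boundary E)%card.
  apply: (@card_eq_trans _ vertex _ _ (boundary (vball n.+1))).
    by apply/(@card_set_bijP _ vertex); exists f; exact: boundary_pullback B1n.
  rewrite card_eq_sym; apply/(@card_set_bijP _ vertex).
  by exists g'; exact: boundary_pullback A2n.
have nD x : ~ D x -> [/\ ~ A1 x, ~ vball n.+1 (f x) & ~ A2 (f x)].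
  move=> /not_implyP[nA nC]; split => // /A2n h; apply: nC.
  exact: vball_mono h.
have nE z : ~ E z -> [/\ ~ B2 z, ~ vball n.+1 (g' z) & ~ B1 (g' z)].
  move=> /not_implyP[nA nC]; split => // /B1n h; apply: nC.
  exact: vball_mono h.
have DEi : forest_iso D E (g \o f).
  split; first split.
  - move=> x /= /nD[nA1 nC nA2] h; apply: nC.
    by rewrite -(g'g (f x)) //; apply: h; exact: set_bijNC gi.1 nA2.
  - move=> x y /set_mem/nD[x1 x2 x3] /set_mem/nD[y1 y2 y3] /= e.
    case: fi gi => [[_ finj _] _] [[_ ginj _] _].
    by apply: finj; rewrite ?inE //; apply: ginj; rewrite ?inE.
  - move=> z /nE[z1 z2 z3].
    case: (fi) => [[_ _ /(_ _ z3)[x /= nAx fx]] _].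
    exists x; last by rewrite /= fx gg'.
    by move=> /(_ nAx); rewrite fx.
  - move=> x y /nD[x1 x2 x3] /nD[y1 y2 y3] /=.
    by rewrite gi.2 // fi.2.
exists (AlmostAut sD sE DE DEi); exact: cofin_eq_refl.
Qed.

Lemma aa_one_subproof : forest_iso (vball 0) (vball 0) id.
Proof. by split=> //; split=> //= y; exists y. Qed.

Definition aa_one : almost_aut := AlmostAut (vball_subtree 0) (vball_subtree 0)
  (card_eqxx _) aa_one_subproof.

Definition aa_mul (p q : almost_aut) : almost_aut :=
  projT1 (cid (aa_comp_exists p q)).

Lemma aa_mulP p q : cofin_eq (aa_map (aa_mul p q)) (aa_map p \o aa_map q).
Proof. by rewrite /aa_mul; case: cid. Qed.

Definition aa_inv (p : almost_aut) : almost_aut := projT1 (cid (aa_inv_exists p)).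

Lemma aa_invP p : [/\ aa_dom (aa_inv p) = aa_cod p, aa_cod (aa_inv p) = aa_dom p,
   cofin_eq (aa_map (aa_inv p) \o aa_map p) id &
   cofin_eq (aa_map p \o aa_map (aa_inv p)) id].
Proof. by rewrite /aa_inv; case: cid. Qed.

Definition aa_equivb (p q : almost_aut) : bool := `[< aa_equiv p q >].

Lemma aa_equivb_refl : reflexive aa_equivb.
Proof. by move=> p; apply/asboolP/aa_equivP; exact: cofin_eq_refl. Qed.

Lemma aa_equivb_sym : symmetric aa_equivb.
Proof.
by move=> p q; apply/asboolP/asboolP => /aa_equivP h; apply/aa_equivP; exact: cofin_eq_sym.
Qed.

Lemma aa_equivb_trans : transitive aa_equivb.
Proof.
move=> q p r /asboolP/aa_equivP pq /asboolP/aa_equivP qr.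
by apply/asboolP/aa_equivP; exact: cofin_eq_trans qr.
Qed.

Canonical aa_equiv_rel := EquivRel aa_equivb aa_equivb_refl aa_equivb_sym aa_equivb_trans.

Local Open Scope quotient_scope.

Definition neretin : Type := {eq_quot aa_equiv_rel}.
HB.instance Definition _ := Choice.on neretin.
HB.instance Definition _ := EqQuotient.on neretin.

Definition nclass (p : almost_aut) : neretin := \pi_neretin p.

Lemma nclassP p q : nclass p = nclass q <-> cofin_eq (aa_map p) (aa_map q).
Proof.
rewrite /nclass; split=> [/eqmodP/asboolP/aa_equivP//|h].
by apply/eqmodP/asboolP/aa_equivP.
Qed.

Lemma nclass_repr (x : neretin) : nclass (repr x) = x.
Proof. exact: reprK. Qed.

Definition neretin_one : neretin := nclass aa_one.
Definition neretin_mul (x y : neretin) : neretin := nclass (aa_mul (repr x) (repr y)).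
Definition neretin_inv (x : neretin) : neretin := nclass (aa_inv (repr x)).

Lemma neretin_mulE p q : neretin_mul (nclass p) (nclass q) = nclass (aa_mul p q).
Proof.
have /nclassP ep := nclass_repr (nclass p); have /nclassP eq := nclass_repr (nclass q).
apply/nclassP; apply: cofin_eq_trans (aa_mulP _ _) _.
apply: cofin_eq_trans (cofin_eq_sym (aa_mulP _ _)).
exact: cofin_eq_trans (cofin_eq_compr _ ep) (cofin_eq_compl _ eq).
Qed.

Lemma neretin_mulA : associative neretin_mul.
Proof.
move=> x y z; rewrite -(nclass_repr x) -(nclass_repr y) -(nclass_repr z) !neretin_mulE.
move: (repr x) (repr y) (repr z) => p q r; apply/nclassP.
apply: cofin_eq_trans (aa_mulP _ _) _; apply: cofin_eq_sym.
apply: cofin_eq_trans (aa_mulP _ _) _.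
apply: cofin_eq_trans (cofin_eq_compr _ (aa_mulP _ _)) _.
exact: cofin_eq_sym (cofin_eq_compl _ (aa_mulP _ _)).
Qed.

Lemma neretin_mul1g : left_id neretin_one neretin_mul.
Proof.
move=> x; rewrite -(nclass_repr x) neretin_mulE; apply/nclassP; exact: aa_mulP.
Qed.

Lemma neretin_mulg1 : right_id neretin_one neretin_mul.
Proof.
move=> x; rewrite -(nclass_repr x) neretin_mulE; apply/nclassP; exact: aa_mulP.
Qed.

Lemma neretin_mulVg : left_inverse neretin_one neretin_inv neretin_mul.
Proof.
move=> x; rewrite -[in X in neretin_mul _ X](nclass_repr x) neretin_mulE; apply/nclassP.
by apply: cofin_eq_trans (aa_mulP _ _) _; case: (aa_invP (repr x)).
Qed.

Lemma neretin_mulgV : right_inverse neretin_one neretin_inv neretin_mul.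
Proof.
move=> x; rewrite -[in X in neretin_mul X _](nclass_repr x) neretin_mulE; apply/nclassP.
by apply: cofin_eq_trans (aa_mulP _ _) _; case: (aa_invP (repr x)).
Qed.

HB.instance Definition _ := isGroup.Build neretin
  neretin_mulA neretin_mul1g neretin_mulg1 neretin_mulVg neretin_mulgV.


Lemma vball_depth n f x : forest_iso (vball n) (vball n) f -> ~ vball n x ->
  depth (f x) = depth x.
Proof.
move=> fi; have s := vball_subtree n; have [m] := ubnP (depth x).
elim: m x => // m IHm x; rewrite ltnS => xm nx.
have [y xy] : exists y, parent x = Some y.
  by case: x nx {xm} => [[i s']|] nx; [eexists|case: nx].
have [yn|nyn] := pselect (vball n y).
  have [z fxz zn] := forest_iso_root s s fi nx xy yn.
  by rewrite (vball_sep (set_bijNC fi.1 nx) fxz zn) (vball_sep nx xy yn).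
rewrite (parent_depth (forest_iso_parent s s fi nx nyn xy)) (parent_depth xy).
by rewrite IHm // -(parent_depth xy).
Qed.

Lemma forest_iso_vball n m f : (n <= m)%N ->
  forest_iso (vball n) (vball n) f -> forest_iso (vball m) (vball m) f.
Proof.
move=> nm fi; have sub := vball_mono nm.
have nmx x : ~ vball m x -> ~ vball n x by move=> h /sub.
case: (fi) => [[fAB finj fsurj] fadj]; split; last by move=> x y /nmx + /nmx; exact: fadj.
split.
- by move=> x /= mx; rewrite /vball /= (vball_depth fi) //; exact: nmx.
- by move=> x y /set_mem/nmx xn /set_mem/nmx yn; apply: finj; exact: mem_set.
- move=> y my; have [x /= nx xy] := fsurj y (nmx _ my); exists x => //=.
  by rewrite /vball /= -(vball_depth fi nx) xy.
Qed.

Definition neretinOn (n : nat) : set neretin :=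
  [set x | exists p, [/\ aa_dom p = vball n, aa_cod p = vball n & x = nclass p]].

Definition neretinO_set : set neretin := \bigcup_n neretinOn n.

Lemma neretinOn_intro n f (fi : forest_iso (vball n) (vball n) f) (p : almost_aut) :
  cofin_eq (aa_map p) f -> neretinOn n (nclass p).
Proof.
move=> h; pose q := AlmostAut (vball_subtree n) (vball_subtree n) (card_eqxx _) fi.
by exists q; split=> //; apply/nclassP.
Qed.

Definition neretinO_pred : pred neretin := fun x => `[< neretinO_set x >].

Lemma neretinO_closed : group_closed neretinO_pred.
Proof.
split; first by apply/asboolP; exists 0%N => //; exists aa_one.
move=> x y /asboolP[n _ [p [pd pc ->]]] /asboolP[m _ [q [qd qc ->]]].
apply/asboolP; exists (maxn n m) => //.
have pi : forest_iso (vball n) (vball n) (aa_map p) by rewrite -{1}pd -pc; exact: aa_iso.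
have [qid qic qV1 qV2] := aa_invP q.
have qi : forest_iso (vball m) (vball m) (aa_map (aa_inv q)).
  by rewrite -{1}qc -qd -qid -qic; exact: aa_iso.
have -> : (nclass p / nclass q)%g = nclass (aa_mul p (aa_inv q)).
  suff -> : (nclass q)^-1%g = nclass (aa_inv q) by exact: neretin_mulE.
  apply: (@mulgI _ (nclass q)); rewrite mulgV; apply/esym.
  rewrite [LHS]neretin_mulE; apply/nclassP.
  exact: cofin_eq_trans (aa_mulP _ _) qV2.
apply: neretinOn_intro (aa_mulP _ _).
by apply: forest_iso_comp; [apply: forest_iso_vball qi|apply: forest_iso_vball pi];
  rewrite ?leq_maxl ?leq_maxr.
Qed.

(* Automorphisms of a rooted tree fix the root. The type tree_aut carries the
   topology induced by that of {ptws _ -> _}, i.e., pointwise convergence. *)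
Definition tree_aut : set {ptws vertex -> discrete_topology vertex} :=
  [set f : vertex -> vertex | [/\ bijective f, f root = root
    & forall x y, adj (f x) (f y) = adj x y]].

Lemma tree_aut_iso (f : tree_aut) : forest_iso (vball 0) (vball 0) (set_val f).
Proof.
have : tree_aut (set_val f) by case: f => f hf; exact: set_mem hf.
move: (set_val f) => {}f /= [[g gf fg] fr fadj].
have v0 x : vball 0 x <-> x = root.
  by split=> [|->//]; case: x => [[]|].
split; last by move=> x y _ _; exact: fadj.
split.
- by move=> x /= nx /v0 h; apply: nx; apply/v0; rewrite -(gf x) h -[in LHS]fr gf.
- by move=> x y _ _ /(congr1 g); rewrite !gf.
- move=> y ny; exists (g y); rewrite /= ?fg // => /v0 h; apply: ny; apply/v0.
  by rewrite -(fg y) h.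
Qed.

Definition aut_embed (f : tree_aut) : neretin :=
  nclass (AlmostAut (vball_subtree 0) (vball_subtree 0) (card_eqxx _) (tree_aut_iso f)).

(* A group topology for which the embedding of the rooted automorphisms is
   continuous and open must be this one: U is open iff its intersection with each
   left coset g Aut(T) corresponds to an open subset of Aut(T). *)
Definition neretin_open (U : set neretin) : Prop :=
  forall g, open [set f : tree_aut | U (g * aut_embed f)%g].

Lemma neretin_openT : neretin_open setT.
Proof. by move=> g; exact: openT. Qed.

Lemma neretin_openI : setI_closed neretin_open.
Proof. by move=> U V oU oV g; exact: openI (oU g) (oV g). Qed.

Lemma neretin_open_bigU (I : Type) (U : I -> set neretin) :
  (forall i, neretin_open (U i)) -> neretin_open (\bigcup_i U i).
Proof.
move=> oU g; rewrite [X in open X](_ : _ = \bigcup_i [set f | U i (g * aut_embed f)%g]) //.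
by apply: bigcup_open => i _; exact: oU.
Qed.

HB.instance Definition _ := isOpenTopological.Build neretin
  neretin_openT neretin_openI neretin_open_bigU.

Definition neretinO : Type := {x : neretin | neretinO_pred x}.
HB.instance Definition _ := SubChoice.on neretinO.
HB.instance Definition _ := SubChoice_isSubGroup.Build neretin neretinO_pred neretinO neretinO_closed.
HB.instance Definition _ := isPointed.Build neretinO 1%g.
HB.instance Definition _ :=
  Topological.copy neretinO (initial_topology (val : neretinO -> neretin)).

End Tree.

Local Notation Re := (@complex.Re _).
Local Notation Im := (@complex.Im _).
Local Notation conjC := (@Num.conj _).

Section DotNorm.
Variables (R : realType) (V : lmodType R[i]) (dot : V -> V -> R[i]).

Definition dnorm (x : V) : R := Num.sqrt (Re (dot x x)).

Definition dcauchy (u : nat -> V) : Prop :=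
  forall e : R, 0 < e -> exists N, forall m n, (N <= m)%N -> (N <= n)%N ->
  dnorm (u m - u n) < e.

Definition dcvg (u : nat -> V) (l : V) : Prop :=
  forall e : R, 0 < e -> exists N, forall n, (N <= n)%N -> dnorm (u n - l) < e.

End DotNorm.

Record hilbert (R : realType) : Type := Hilbert {
  hilbert_sort :> lmodType R[i];
  hdot : {dot hilbert_sort for @Num.conj R[i]};
  hilbert_complete : forall u, dcauchy hdot u -> exists l, dcvg hdot u l }.

Section L2.
Context d (T : measurableType d) (R : realType).
Variable mu : {measure set T -> \bar R}.
Local Notation C := R[i].

Definition sqmod (z : C) : R := Re z ^+ 2 + Im z ^+ 2.

Definition l2fun (f : T -> C) : Prop :=
  [/\ measurable_fun [set: T] (Re \o f), measurable_fun [set: T] (Im \o f)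
    & mu.-integrable [set: T] (EFin \o sqmod \o f)].

Definition cintegral (f : T -> C) : C :=
  complex.Complex (\int[mu]_t Re (f t))%R (\int[mu]_t Im (f t))%R.

Lemma sqmod_ge0 z : 0 <= sqmod z.
Proof. by rewrite addr_ge0 // sqr_ge0. Qed.

Lemma ReM (z w : C) : Re (z * w) = Re z * Re w - Im z * Im w.
Proof. by case: z w => [a b] [a' b']. Qed.
Lemma ImM (z w : C) : Im (z * w) = Re z * Im w + Im z * Re w.
Proof. by case: z w => [a b] [a' b']. Qed.
Lemma ReD (z w : C) : Re (z + w) = Re z + Re w.
Proof. by case: z w => [a b] [a' b']. Qed.
Lemma ImD (z w : C) : Im (z + w) = Im z + Im w.
Proof. by case: z w => [a b] [a' b']. Qed.
Lemma ReN (z : C) : Re (- z) = - Re z. Proof. by case: z. Qed.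
Lemma ImN (z : C) : Im (- z) = - Im z. Proof. by case: z. Qed.
Lemma ReJ (z : C) : Re (conjC z) = Re z. Proof. by case: z. Qed.
Lemma ImJ (z : C) : Im (conjC z) = - Im z. Proof. by case: z. Qed.
Lemma complex_eq (z w : C) : Re z = Re w -> Im z = Im w -> z = w.
Proof. by case: z w => [a b] [a' b'] /= -> ->. Qed.
Let cE := (ReM, ImM, ReD, ImD, ReN, ImN, ReJ, ImJ).

Lemma sqmod_meas (f : T -> C) :
  measurable_fun [set: T] (Re \o f) -> measurable_fun [set: T] (Im \o f) ->
  measurable_fun [set: T] (sqmod \o f).
Proof.
move=> mr mi; apply: (@measurable_funD _ _ _ _ (fun x => Re (f x) ^+ 2) (fun x => Im (f x) ^+ 2)).
  exact: (measurable_funX 2 mr).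
exact: (measurable_funX 2 mi).
Qed.

Lemma l2fun_lin (a : C) f g : l2fun f -> l2fun g -> l2fun (fun t => a * f t + g t).
Proof.
move=> [fr fi fs] [gr gi gs].
have mr : measurable_fun [set: T] (Re \o (fun t => a * f t + g t)).
  have -> : Re \o (fun t => a * f t + g t) =
    (fun t => Re a * (Re \o f) t - Im a * (Im \o f) t + (Re \o g) t).
    by apply/funext => t /=; rewrite !cE.
  apply: measurable_funD => //; apply: measurable_funB;
    exact: measurable_funM.
have mi : measurable_fun [set: T] (Im \o (fun t => a * f t + g t)).
  have -> : Im \o (fun t => a * f t + g t) =
    (fun t => Re a * (Im \o f) t + Im a * (Re \o f) t + (Im \o g) t).
    by apply/funext => t /=; rewrite !cE.
  apply: measurable_funD => //; apply: measurable_funD;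
    exact: measurable_funM.
split=> //.
have int : mu.-integrable [set: T]
    (fun t => (2 * sqmod a)%:E * (EFin \o sqmod \o f) t + 2%:E * (EFin \o sqmod \o g) t)%E.
  apply: integrableD => //; exact: integrableZl.
apply: le_integrable int => //.
  exact/measurable_EFinP/sqmod_meas.
move=> t _ /=; rewrite lee_fin.
rewrite !ger0_norm ?sqmod_ge0 //; last first.
  by rewrite addr_ge0 // ?mulr_ge0 // ?sqmod_ge0.
rewrite /sqmod !cE.
set a1 := Re a; set a2 := Im a; set f1 := Re (f t); set f2 := Im (f t).
set g1 := Re (g t); set g2 := Im (g t).
rewrite -subr_ge0.
have -> : 2 * (a1 ^+ 2 + a2 ^+ 2) * (f1 ^+ 2 + f2 ^+ 2) + 2 * (g1 ^+ 2 + g2 ^+ 2) -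
  ((a1 * f1 - a2 * f2 + g1) ^+ 2 + (a1 * f2 + a2 * f1 + g2) ^+ 2) =
  (a1 * f1 - a2 * f2 - g1) ^+ 2 + (a1 * f2 + a2 * f1 - g2) ^+ 2 by ring.
by rewrite addr_ge0 // sqr_ge0.
Qed.

Lemma sqmod0 : sqmod 0 = 0. Proof. by rewrite /sqmod /= expr0n addr0. Qed.

Lemma l2fun0 : l2fun (fun=> 0).
Proof.
split; [exact: measurable_cst|exact: measurable_cst|].
rewrite (_ : _ \o _ = cst 0%E); first exact: integrable0.
by apply/funext => t /=; rewrite sqmod0.
Qed.

Lemma l2funD f g : l2fun f -> l2fun g -> l2fun (fun t => f t + g t).
Proof.
move=> hf hg; have := l2fun_lin 1 hf hg.
by under eq_fun do rewrite mul1r.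
Qed.

Lemma l2funZ a f : l2fun f -> l2fun (fun t => a * f t).
Proof.
move=> hf; have := l2fun_lin a hf l2fun0.
by under eq_fun do rewrite addr0.
Qed.

Lemma l2funN f : l2fun f -> l2fun (fun t => - f t).
Proof.
move=> /(l2funZ (-1)).
by under eq_fun do rewrite mulN1r.
Qed.

Lemma l2funB f g : l2fun f -> l2fun g -> l2fun (fun t => f t - g t).
Proof. by move=> hf /l2funN; exact: l2funD. Qed.

Definition aeq (f g : T -> C) : Prop := {ae mu, forall t, f t = g t}.

Record l2rep := L2Rep { l2rep_fun :> T -> C ; l2repP : l2fun l2rep_fun }.
HB.instance Definition _ := gen_eqMixin l2rep.
HB.instance Definition _ := gen_choiceMixin l2rep.

Definition l2eqb (f g : l2rep) : bool := `[< aeq f g >].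

Lemma aeq_refl f : aeq f f. Proof. exact/nearW. Qed.
Lemma aeq_sym f g : aeq f g -> aeq g f.
Proof. by apply: filterS => t /esym. Qed.
Lemma aeq_trans g f h : aeq f g -> aeq g h -> aeq f h.
Proof. by apply: filterS2 => t -> ->. Qed.

Lemma l2eqb_refl : reflexive l2eqb.
Proof. by move=> f; apply/asboolP; exact: aeq_refl. Qed.
Lemma l2eqb_sym : symmetric l2eqb.
Proof. by move=> f g; apply/asboolP/asboolP => /aeq_sym. Qed.
Lemma l2eqb_trans : transitive l2eqb.
Proof. by move=> g f h /asboolP fg /asboolP gh; apply/asboolP; exact: aeq_trans gh. Qed.

Canonical l2eqb_rel := EquivRel l2eqb l2eqb_refl l2eqb_sym l2eqb_trans.

Local Open Scope quotient_scope.

Definition L2type : Type := {eq_quot l2eqb_rel}.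
HB.instance Definition _ := Choice.on L2type.
HB.instance Definition _ := EqQuotient.on L2type.

(* Functions that are not square-integrable are sent to 0. *)
Definition l2class (f : T -> C) : L2type :=
  \pi_L2type (if pselect (l2fun f) is left hf then L2Rep hf else L2Rep l2fun0).

Definition l2val (x : L2type) : T -> C := repr x.

Lemma l2valP x : l2fun (l2val x). Proof. exact: l2repP. Qed.

Lemma l2classP f g : l2fun f -> l2fun g -> l2class f = l2class g <-> aeq f g.
Proof.
rewrite /l2class => hf hg; case: pselect => // hf'; case: pselect => // hg'.
by split=> [/eqmodP/asboolP//|h]; apply/eqmodP/asboolP.
Qed.

Lemma l2valK x : l2class (l2val x) = x.
Proof.
rewrite /l2class; case: pselect => [h|/(_ (l2valP x))//].
have -> : L2Rep h = repr x by rewrite /l2val in h *; case: (repr x) h => f hf h; congr L2Rep.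
exact: reprK.
Qed.

Lemma l2classK f : l2fun f -> aeq (l2val (l2class f)) f.
Proof. by move=> hf; apply/(l2classP (l2valP _) hf); exact: l2valK. Qed.

Definition l2zero : L2type := l2class (fun=> 0).
Definition l2add (x y : L2type) : L2type := l2class (fun t => l2val x t + l2val y t).
Definition l2opp (x : L2type) : L2type := l2class (fun t => - l2val x t).
Definition l2scale (a : C) (x : L2type) : L2type := l2class (fun t => a * l2val x t).

Lemma l2addE f g : l2fun f -> l2fun g ->
  l2add (l2class f) (l2class g) = l2class (fun t => f t + g t).
Proof.
move=> hf hg; apply/l2classP; [by apply: l2funD; exact: l2valP|exact: l2funD|].
by apply: filterS2 (l2classK hf) (l2classK hg) => t -> ->.
Qed.

Lemma l2oppE f : l2fun f -> l2opp (l2class f) = l2class (fun t => - f t).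
Proof.
move=> hf; apply/l2classP; [by apply: l2funN; exact: l2valP|exact: l2funN|].
by apply: filterS (l2classK hf) => t ->.
Qed.

Lemma l2scaleE a f : l2fun f -> l2scale a (l2class f) = l2class (fun t => a * f t).
Proof.
move=> hf; apply/l2classP; [by apply: l2funZ; exact: l2valP|exact: l2funZ|].
by apply: filterS (l2classK hf) => t ->.
Qed.

Lemma l2ind (P : L2type -> Prop) : (forall f, l2fun f -> P (l2class f)) -> forall x, P x.
Proof. by move=> h x; rewrite -(l2valK x); apply: h; exact: l2valP. Qed.

Let eqcls f g : f =1 g -> l2class f = l2class g.
Proof. by move=> /funext ->. Qed.

Lemma l2addA : associative l2add.
Proof.
elim/l2ind => f hf; elim/l2ind => g hg; elim/l2ind => h hh.
rewrite !l2addE //; [|exact: l2funD|exact: l2funD].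
by apply: eqcls => t; rewrite addrA.
Qed.
Lemma l2addC : commutative l2add.
Proof.
elim/l2ind => f hf; elim/l2ind => g hg.
by rewrite !l2addE //; apply: eqcls => t; rewrite addrC.
Qed.
Lemma l2add0 : left_id l2zero l2add.
Proof.
elim/l2ind => f hf; rewrite l2addE //; last exact: l2fun0.
by apply: eqcls => t; rewrite add0r.
Qed.
Lemma l2addN : left_inverse l2zero l2opp l2add.
Proof.
elim/l2ind => f hf; rewrite l2oppE // l2addE //; last exact: l2funN.
by apply: eqcls => t; rewrite addNr.
Qed.

HB.instance Definition _ := GRing.isZmodule.Build L2type l2addA l2addC l2add0 l2addN.

Lemma l2scaleA (a b : C) x : l2scale a (l2scale b x) = l2scale (a * b) x.
Proof.
elim/l2ind: x => f hf; rewrite !l2scaleE //; last exact: l2funZ.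
by apply: eqcls => t; rewrite mulrA.
Qed.
Lemma l2scale1 : left_id 1 l2scale.
Proof.
elim/l2ind => f hf; rewrite l2scaleE //; apply: eqcls => t; exact: mul1r.
Qed.
Lemma l2scaleDr : right_distributive l2scale +%R.
Proof.
move=> a; elim/l2ind => f hf; elim/l2ind => g hg; rewrite /GRing.add /=.
rewrite l2addE // !l2scaleE //; [|exact: l2funD].
rewrite l2addE; [|exact: l2funZ..].
by apply: eqcls => t; rewrite mulrDr.
Qed.
Lemma l2scaleDl v : {morph l2scale^~ v : a b / a + b}.
Proof.
move=> a b; elim/l2ind: v => f hf; rewrite [in RHS]/GRing.add /= !l2scaleE //.
rewrite l2addE; [|exact: l2funZ..].
by apply: eqcls => t; rewrite mulrDl.
Qed.

HB.instance Definition _ := GRing.Zmodule_isLmodule.Build C L2type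
  l2scaleA l2scale1 l2scaleDr l2scaleDl.


Definition l2ip (f g : T -> C) : C := cintegral (fun t => f t * conjC (g t)).

Definition l2dot (x y : L2type) : C := l2ip (l2val x) (l2val y).

Definition cintegrable (f : T -> C) :=
  mu.-integrable [set: T] (EFin \o (Re \o f)) /\ mu.-integrable [set: T] (EFin \o (Im \o f)).

Lemma cintegrable_meas f : cintegrable f ->
  measurable_fun [set: T] (EFin \o (Re \o f)) /\ measurable_fun [set: T] (EFin \o (Im \o f)).
Proof. by move=> [/integrableP[? _] /integrableP[? _]]. Qed.

Lemma cintegralE f g : cintegrable f -> cintegrable g -> aeq f g ->
  cintegral f = cintegral g.
Proof.
move=> /cintegrable_meas[fr fi] /cintegrable_meas[gr gi] fg.
apply: complex_eq => /=; rewrite /Rintegral; congr fine; apply: ae_eq_integral => //.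
  by apply: filterS fg => t /= -> _.
by apply: filterS fg => t /= -> _.
Qed.

Lemma cintegral_lin (a : C) f g : cintegrable f -> cintegrable g ->
  cintegral (fun t => a * f t + g t) = a * cintegral f + cintegral g.
Proof.
move=> [fr fi] [gr gi].
have Z (r : R) (h : T -> R) : mu.-integrable [set: T] (EFin \o h) ->
    mu.-integrable [set: T] (EFin \o (fun t => r * h t)).
  by move=> hh; have := integrableZl measurableT r hh.
have D (h h' : T -> R) : mu.-integrable [set: T] (EFin \o h) ->
    mu.-integrable [set: T] (EFin \o h') ->
    mu.-integrable [set: T] (EFin \o (fun t => h t + h' t)).
  by move=> hh hh'; have := integrableD measurableT hh hh'.
apply: complex_eq; rewrite !cE /=.
  transitivity (\int[mu]_t (Re a * (Re \o f) t + (- Im a) * (Im \o f) t + (Re \o g) t))%R.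
    by apply: eq_Rintegral => t _ /=; rewrite !cE mulNr.
  rewrite RintegralD ?RintegralD ?RintegralZl //; last 3 first.
  - exact: Z.
  - exact: Z.
  - by apply: D; exact: Z.
  by rewrite mulNr.
transitivity (\int[mu]_t (Re a * (Im \o f) t + Im a * (Re \o f) t + (Im \o g) t))%R.
  by apply: eq_Rintegral => t _ /=; rewrite !cE.
rewrite RintegralD ?RintegralD ?RintegralZl //; try exact: Z.
by apply: D; exact: Z.
Qed.

Lemma l2fun_meas f : l2fun f ->
  measurable_fun [set: T] (Re \o f) /\ measurable_fun [set: T] (Im \o f).
Proof. by case. Qed.

Lemma l2mul_integrable f g : l2fun f -> l2fun g ->
  cintegrable (fun t => f t * conjC (g t)).
Proof.
move=> [fr fi fs] [gr gi gs].
have int := integrableD measurableT fs gs.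
have key (h : T -> R) : measurable_fun [set: T] h ->
    (forall t, `|h t| <= sqmod (f t) + sqmod (g t)) ->
    mu.-integrable [set: T] (EFin \o h).
  move=> mh hh; apply: le_integrable int => //; first exact/measurable_EFinP.
  move=> t _ /=; rewrite lee_fin (le_trans (hh t)) //; exact: ler_norm.
have sq (a b : R) : 0 <= (a + b) ^+ 2 by exact: sqr_ge0.
have sq' (a b : R) : 0 <= (a - b) ^+ 2 by exact: sqr_ge0.
split; apply: key.
- have -> : Re \o (fun t => f t * conjC (g t)) =
     (fun t => (Re \o f) t * (Re \o g) t + (Im \o f) t * (Im \o g) t).
    by apply/funext => t /=; rewrite !cE mulrN opprK.
  by apply: measurable_funD; exact: measurable_funM.
- move=> t /=; rewrite !cE /sqmod ler_norml.
  move: (Re (f t)) (Im (f t)) (Re (g t)) (Im (g t)) => a b a' b'.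
  have := sq a a'; have := sq' a a'; have := sq b b'; have := sq' b b'.
  have := sqr_ge0 a; have := sqr_ge0 b; have := sqr_ge0 a'; have := sqr_ge0 b'.
  by rewrite !expr2 => *; apply/andP; split; nra.
- have -> : Im \o (fun t => f t * conjC (g t)) =
     (fun t => (Im \o f) t * (Re \o g) t - (Re \o f) t * (Im \o g) t).
    by apply/funext => t /=; rewrite !cE mulrN addrC.
  by apply: measurable_funB; exact: measurable_funM.
- move=> t /=; rewrite !cE /sqmod ler_norml.
  move: (Re (f t)) (Im (f t)) (Re (g t)) (Im (g t)) => a b a' b'.
  have := sq a b'; have := sq' a b'; have := sq b a'; have := sq' b a'.
  have := sqr_ge0 a; have := sqr_ge0 b; have := sqr_ge0 a'; have := sqr_ge0 b'.
  by rewrite !expr2 => *; apply/andP; split; nra.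
Qed.

Lemma l2dotE f g : l2fun f -> l2fun g -> l2dot (l2class f) (l2class g) = l2ip f g.
Proof.
move=> hf hg; apply: cintegralE; [|exact: l2mul_integrable|].
  by apply: l2mul_integrable; exact: l2valP.
by apply: filterS2 (l2classK hf) (l2classK hg) => t -> ->.
Qed.

Lemma l2classD f g : l2fun f -> l2fun g ->
  l2class f + l2class g = l2class (fun t => f t + g t).
Proof. exact: l2addE. Qed.
Lemma l2classZ a f : l2fun f -> a *: l2class f = l2class (fun t => a * f t).
Proof. exact: l2scaleE. Qed.
Lemma l2classN f : l2fun f -> - l2class f = l2class (fun t => - f t).
Proof. exact: l2oppE. Qed.

Lemma l2dot_linl (y : L2type) : GRing.linear_for *%R (l2dot ^~ y).
Proof.
move=> a; elim/l2ind => f hf; elim/l2ind => g hg; elim/l2ind: y => h hh.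
rewrite l2classZ // l2classD //; last exact: l2funZ.
rewrite !l2dotE //; last exact: l2fun_lin.
rewrite -cintegral_lin //; [|exact: l2mul_integrable..].
by congr cintegral; apply/funext => t; rewrite mulrDl mulrA.
Qed.

Lemma l2dotC (x y : L2type) : l2dot x y = conjC (l2dot y x).
Proof.
elim/l2ind: x => f hf; elim/l2ind: y => g hg; rewrite !l2dotE //.
have [ir ii] := l2mul_integrable hg hf.
apply: complex_eq; rewrite !cE /=.
  by apply: eq_Rintegral => t _; rewrite !cE; ring.
rewrite -mulN1r -RintegralZl //.
by apply: eq_Rintegral => t _; rewrite !cE; ring.
Qed.

Lemma l2dot_linr (x : L2type) : GRing.linear_for (conjC \; *%R) (l2dot x).
Proof.
move=> a y z; rewrite l2dotC (l2dot_linl x a y z) rmorphD rmorphM /=.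
by rewrite -!l2dotC.
Qed.

Lemma l2ipxx f : l2fun f -> l2ip f f = complex.Complex (\int[mu]_t sqmod (f t))%R 0.
Proof.
move=> hf; apply: complex_eq => /=.
  by apply: eq_Rintegral => t _; rewrite /sqmod !cE; ring.
rewrite (_ : (fun t => _) = cst 0); first by rewrite Rintegral_cst // mul0r.
by apply/funext => t /=; rewrite !cE; ring.
Qed.

Lemma l2N2_eq0 f : l2fun f -> (\int[mu]_t sqmod (f t))%R = 0 -> aeq f (fun=> 0).
Proof.
move=> [mr mi int] h.
have fin : (\int[mu]_t (sqmod (f t))%:E)%E \is a fin_num by exact: integrable_fin_num int.
have {}h : (\int[mu]_t (sqmod (f t))%:E)%E = 0%E by rewrite -(fineK fin) -/(Rintegral _ _ _) h.
have /ae_eq_integral_abs : measurable_fun [set: T] (fun t => (sqmod (f t))%:E).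
  by case/integrableP: int.
move=> /(_ mu measurableT)[+ _].
have -> : (\int[mu]_t `|(sqmod (f t))%:E|)%E = (\int[mu]_t (sqmod (f t))%:E)%E.
  by apply: eq_integral => t _; rewrite abse_EFin ger0_norm ?sqmod_ge0.
move=> /(_ h); apply: filterS => t /(_ I)[] /eqP.
rewrite /sqmod paddr_eq0 ?sqr_ge0 // !sqrf_eq0 => /andP[/eqP a /eqP b].
exact: complex_eq.
Qed.

Lemma l2dot_gt0 (x : L2type) : x != 0 -> 0 < l2dot x x.
Proof.
elim/l2ind: x => f hf f0; rewrite l2dotE // l2ipxx // ltcE /= eqxx /=.
rewrite lt_neqAle Rintegral_ge0 ?andbT; last by move=> *; exact: sqmod_ge0.
apply: contra f0 => /eqP/esym/(l2N2_eq0 hf) h.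
by apply/eqP/l2classP => //; exact: l2fun0.
Qed.

Fact l2dot_bilinear : bilinear_for *%R (conjC \; *%R) l2dot.
Proof. split; [exact: l2dot_linl|exact: l2dot_linr]. Qed.

Fact l2dot_hermitian (x y : L2type) : l2dot x y = (-1) ^+ false * conjC (l2dot y x).
Proof. by rewrite expr0 mul1r; exact: l2dotC. Qed.

HB.instance Definition _ := bilinear_isBilinear.Build C L2type L2type C *%R
  (conjC \; *%R) l2dot l2dot_bilinear.
HB.instance Definition _ := isHermitianSesquilinear.Build C L2type false conjC l2dot
  l2dot_hermitian.
HB.instance Definition _ := isDotProduct.Build C L2type l2dot l2dot_gt0.

Definition l2dot_form : {dot L2type for conjC} := l2dot.


Local Notation N2 f := (\int[mu]_t sqmod (f t))%R.

Lemma dnorm_l2 f : l2fun f -> dnorm l2dot (l2class f) = Num.sqrt (N2 f).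
Proof. by move=> hf; rewrite /dnorm l2dotE // l2ipxx. Qed.

Lemma l2fun_EN2 f : l2fun f -> (\int[mu]_t (sqmod (f t))%:E = (N2 f)%:E)%E.
Proof. by case=> _ _ int; rewrite /Rintegral fineK //; exact: integrable_fin_num int. Qed.

Lemma sum_half n : \sum_(0 <= k < n) (2^-1 ^+ k : R) <= 2.
Proof.
suff -> : \sum_(0 <= k < n) (2^-1 ^+ k : R) = 2 - 2 * 2^-1 ^+ n.
  by rewrite lerBlDr lerDl mulr_ge0 // exprn_ge0 // invr_ge0.
elim: n => [|n IHn]; first by rewrite big_nil expr0; ring.
by rewrite big_nat_recr //= IHn exprS; field.
Qed.

Lemma efin_cvg (u : nat -> R) (l : R) :
  u k @[k --> \oo] --> l -> (u k)%:E @[k --> \oo] --> l%:E.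
Proof. by move=> h; apply: cvg_EFin => //; exact: nearW. Qed.

Lemma cvg_of_summable (u : nat -> R) (M : R) :
  (forall n, \sum_(0 <= k < n) `|u k.+1 - u k| <= M) -> cvgn u.
Proof.
move=> hM; have hc : cvgn (fun n => \sum_(0 <= k < n) `|u k.+1 - u k|).
  apply: nondecreasing_is_cvgn.
    by apply/nondecreasing_seqP => n; rewrite big_nat_recr //= lerDl.
  by exists M => _ [n _ <-]; exact: hM.
have := @normed_cvg R R^o (telescope u) hc; rewrite telescopeK => h.
have -> : u = (fun n => (u n - u 0%N) + u 0%N).
  by apply/funext => n; rewrite subrK.
by apply: is_cvgD => //; exact: is_cvg_cst.
Qed.

Lemma l2fun_complete (f : nat -> T -> C) : (forall n, l2fun (f n)) ->
  (forall e : R, 0 < e -> exists N, forall m n, (N <= m)%N -> (N <= n)%N ->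
    N2 (fun t => f m t - f n t) < e) ->
  exists2 g, l2fun g & forall e : R, 0 < e -> exists N, forall n, (N <= n)%N ->
    N2 (fun t => f n t - g t) <= e.
Proof.
move=> hf cauchy.
have /choice[N hN] k : exists N, forall m n, (N <= m)%N -> (N <= n)%N ->
    N2 (fun t => f m t - f n t) < 4^-1 ^+ k.
  by apply: cauchy; rewrite exprn_gt0 // invr_gt0.
pose s k := (k + \max_(j < k.+1) N j)%N.
have sN k : (N k <= s k)%N.
  exact: leq_trans (leq_bigmax (ord_max : 'I_k.+1)) (leq_addl _ _).
have sS k : (s k <= s k.+1)%N.
  by rewrite /s leq_add // [X in (_ <= X)%N]big_ord_recr leq_maxl.
have sk k : (k <= s k)%N by exact: leq_addr.
pose g k := f (s k); have hg k : l2fun (g k) by exact: hf.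
pose D k t := g k.+1 t - g k t.
have hD k : l2fun (D k) by exact: l2funB.
have D4 k : N2 (D k) <= 4^-1 ^+ k.
  by apply/ltW/hN => //; apply: leq_trans (sS k).
pose w k : T -> \bar R := EFin \o (fun t => 2 ^+ k * sqmod (D k t)).
have w0 k t : (0 <= w k t)%E by rewrite lee_fin mulr_ge0 ?sqmod_ge0.
have mw k : measurable_fun [set: T] (w k).
  apply/measurable_EFinP; apply: measurable_funM => //.
  by case: (hD k) => ? ? _; exact: sqmod_meas.
have intw : (\int[mu]_t (\sum_(k <oo) w k t) <= 2%:E)%E.
  rewrite integral_nneseries //; apply: lime_le.
    by apply: is_cvg_nneseries => k _ _; exact: integral_ge0.
  apply: nearW => n; apply: (@le_trans _ _ (\sum_(0 <= k < n) (2^-1 ^+ k)%:E)%E).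
    apply: lee_sum => k _; rewrite /w.
    under eq_integral do rewrite /= EFinM.
    rewrite ge0_integralZl //; last 2 first.
    - by case: (hD k) => _ _ /integrableP[].
    - by move=> t _; rewrite lee_fin sqmod_ge0.
    rewrite l2fun_EN2 // -EFinM lee_fin.
    apply: le_trans (ler_wpM2l _ (D4 k)) _ => //.
    rewrite -exprMn; have -> : 2 * 4^-1 = 2^-1 :> R by field.
    exact: lexx.
  by rewrite sumEFin lee_fin sum_half.
have msum : measurable_fun [set: T] (fun t => \sum_(k <oo) w k t)%E.
  by apply: ge0_emeasurable_sum => k *; [exact: w0|exact: mw].
have finw : {ae mu, forall t, (\sum_(k <oo) w k t)%E \is a fin_num}.
  have : mu.-integrable [set: T] (fun t => \sum_(k <oo) w k t)%E.
    apply/integrableP; split => //; apply: le_lt_trans (ltry 2).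
    apply: le_trans intw; apply: ge0_le_integral => //.
    - exact: measurableT_comp.
    - by move=> t _; rewrite gee0_abs //; apply: nneseries_ge0.
  by move/(integrable_ae measurableT); apply: filterS => t /(_ I).
have cvgp (p : C -> R) : (forall z z', p (z - z') = p z - p z') ->
    (forall z, p z ^+ 2 <= sqmod z) -> forall t,
    (\sum_(k <oo) w k t)%E \is a fin_num -> cvgn (fun k => p (g k t)).
  move=> pB psq t ft; apply: (@cvg_of_summable _ (2 + fine (\sum_(k <oo) w k t)%E)) => n.
  apply: (@le_trans _ _ (\sum_(0 <= k < n) (2^-1 ^+ k + 2 ^+ k * sqmod (D k t)))).
    apply: ler_sum => k _; rewrite -pB -/(D k t).
    have := psq (D k t); move: (p (D k t)) (sqmod (D k t)) => a b ab.
    have -> : 2^-1 ^+ k = (2 ^+ k)^-1 :> R by rewrite exprVn.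
    have c0 : 0 < 2 ^+ k :> R by rewrite exprn_gt0.
    move: (2 ^+ k) c0 => c c0.
    apply: (@le_trans _ _ (c^-1 + c * a ^+ 2)); last by rewrite lerD2l ler_wpM2l // ltW.
    rewrite -(ler_pM2l c0) mulrDr divff ?gt_eqF // mulrA -expr2.
    rewrite -[a ^+ 2]real_normK ?num_real // -exprMn.
    set z := c * `|a|; have := sqr_ge0 (z - 1); have := sqr_ge0 z.
    by rewrite !expr2; nra.
  rewrite big_split /= lerD // ?sum_half // -lee_fin fineK // -sumEFin.
  exact: (@nneseries_lim_ge _ (w ^~ t) xpredT 0%N n (fun k _ _ => w0 k t)).
have cvgR := cvgp Re (fun z z' => etrans (ReD z (- z')) (congr1 _ (ReN z'))) _.
have cvgI := cvgp Im (fun z z' => etrans (ImD z (- z')) (congr1 _ (ImN z'))) _.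
have {}cvgR t : (\sum_(k <oo) w k t)%E \is a fin_num -> cvgn (fun k => Re (g k t)).
  by apply: cvgR => z; rewrite lerDl sqr_ge0.
have {}cvgI t : (\sum_(k <oo) w k t)%E \is a fin_num -> cvgn (fun k => Im (g k t)).
  by apply: cvgI => z; rewrite lerDr sqr_ge0.
pose L (p : C -> R) t := fine (limn_esup (fun k => (p (g k t))%:E)).
pose h t : C := complex.Complex (L Re t) (L Im t).
have mL (p : C -> R) : (forall k, measurable_fun [set: T] (fun t => p (g k t))) ->
    measurable_fun [set: T] (L p).
  move=> mp; apply: (@measurableT_comp _ _ _ _ _ _ (@fine R)) => //.
  by apply: measurable_fun_limn_esup => k; apply/measurable_EFinP.
have mhr : measurable_fun [set: T] (Re \o h).
  by apply: mL => k; case: (hg k).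
have mhi : measurable_fun [set: T] (Im \o h).
  by apply: mL => k; case: (hg k).
have Lcvg (p : C -> R) t : cvgn (fun k => p (g k t)) -> p (g k t) @[k --> \oo] --> L p t.
  move=> ct; have : (p (g k t))%:E @[k --> \oo] --> (limn (fun k => p (g k t)))%:E.
    exact: efin_cvg.
  move=> /cvg_lim E.
  rewrite /L is_cvg_limn_esupE; last first.
    by apply/cvg_ex; eexists; exact: efin_cvg ct.
  by rewrite E.
have hcvg : {ae mu, forall t, forall z : C, sqmod (z - g k t) @[k --> \oo] --> sqmod (z - h t)}.
  apply: filterS finw => t ft z.
  have cr := Lcvg _ _ (cvgR t ft); have ci := Lcvg _ _ (cvgI t ft).
  rewrite /sqmod !cE !expr2 /=; under eq_fun do rewrite !cE !expr2.
  by apply: cvgD; apply: cvgM; apply: cvgB => //; exact: cvg_cst.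
have fat e m K : (forall k, (K <= k)%N -> N2 (fun t => f m t - g k t) <= e) ->
    (\int[mu]_t (sqmod (f m t - h t))%:E <= e%:E)%E.
  move=> hK; pose u k t := (sqmod (f m t - g k t))%:E.
  have mu_ k : measurable_fun [set: T] (u k).
    apply/measurable_EFinP; have [? ? _] := l2funB (hf m) (hg k).
    exact: sqmod_meas.
  have u0 k t : (0 <= u k t)%E by rewrite lee_fin sqmod_ge0.
  have mB (p : C -> R) : (forall z z', p (z - z') = p z - p z') ->
      measurable_fun [set: T] (p \o f m) -> measurable_fun [set: T] (p \o h) ->
      measurable_fun [set: T] (p \o (fun t => f m t - h t)).
    move=> pB m1 m2; rewrite (_ : _ \o _ = (fun t => (p \o f m) t - (p \o h) t)).
      exact: measurable_funB.
    by apply/funext => t /=; rewrite pB.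
  have [m1 m2] := l2fun_meas (hf m).
  have -> : (\int[mu]_t (sqmod (f m t - h t))%:E = \int[mu]_t limn_einf (u ^~ t))%E.
    apply: ae_eq_integral => //.
    - apply/measurable_EFinP/sqmod_meas.
        by apply: mB => // z z'; rewrite !cE.
      by apply: mB => // z z'; rewrite !cE.
    - rewrite (_ : (fun t => _) = \- (fun t => limn_esup (fun k => - u k t)))%E.
        by apply: measurableT_comp => //; apply: measurable_fun_limn_esup => k;
           exact: measurableT_comp.
      by [].
    - apply: filterS hcvg => t /(_ (f m t)) ct _.
      have cu : u k t @[k --> \oo] --> (sqmod (f m t - h t))%:E by exact: efin_cvg.
      have := is_cvg_limn_einfE (cvgP _ cu) => ->.
      by rewrite (cvg_lim _ cu).
  apply: le_trans (fatou mu measurableT mu_ (fun n t _ => u0 n t)) _.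
  rewrite limn_einf_lim; apply: lime_le; first exact: is_cvg_einfs.
  exists K => // k /= Kk; apply: (@le_trans _ _ (\int[mu]_t u k t)%E).
    by apply: ereal_inf_lbound; exists k => //=.
  by rewrite l2fun_EN2 ?lee_fin ?hK //; exact: l2funB.
have bound (e : R) : 0 < e -> exists N, forall n, (N <= n)%N ->
    (\int[mu]_t (sqmod (f n t - h t))%:E <= e%:E)%E.
  move=> /cauchy[M hM]; exists M => n Mn.
  apply: (fat _ _ M) => k Mk; apply/ltW/hM => //; exact: leq_trans (sk k).
have hl2 : l2fun h.
  have [M hM] := bound 1 ltr01.
  have hb : l2fun (fun t => f M t - h t).
    have [m1 m2 _] := hf M.
    have mr : measurable_fun [set: T] (Re \o (fun t => f M t - h t)).
      rewrite (_ : _ \o _ = (fun t => (Re \o f M) t - (Re \o h) t)).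
        exact: measurable_funB.
      by apply/funext => t /=; rewrite !cE.
    have mi : measurable_fun [set: T] (Im \o (fun t => f M t - h t)).
      rewrite (_ : _ \o _ = (fun t => (Im \o f M) t - (Im \o h) t)).
        exact: measurable_funB.
      by apply/funext => t /=; rewrite !cE.
    split=> //; apply/integrableP; split.
      by apply/measurable_EFinP; exact: sqmod_meas.
    under eq_integral do rewrite abse_EFin ger0_norm ?sqmod_ge0 //.
    exact: le_lt_trans (hM M (leqnn _)) (ltry _).
  have := l2funB (hf M) hb; congr l2fun; apply/funext => t.
  by rewrite opprB addrC subrK.
exists h => // e /bound[M hM]; exists M => n Mn.
by rewrite -lee_fin -l2fun_EN2 ?hM //; exact: l2funB.
Qed.

Lemma L2_complete (u : nat -> L2type) : dcauchy l2dot u -> exists l, dcvg l2dot u l.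
Proof.
move=> cu; pose f n := l2val (u n); have hf n : l2fun (f n) by exact: l2valP.
have uf n : u n = l2class (f n) by rewrite l2valK.
have dE (g g' : T -> C) : l2fun g -> l2fun g' ->
    dnorm l2dot (l2class g - l2class g') = Num.sqrt (N2 (fun t => g t - g' t)).
  move=> hg hg'; rewrite l2classN // l2classD //; last exact: l2funN.
  by rewrite dnorm_l2 //; exact: l2funB.
have N20 (g : T -> C) : 0 <= N2 g by apply: Rintegral_ge0 => *; exact: sqmod_ge0.
have [e e0|g hg cg] := l2fun_complete hf.
  have [|N hN] := cu (Num.sqrt e); first by rewrite sqrtr_gt0.
  exists N => m n Nm Nn; have := hN m n Nm Nn.
  by rewrite !uf dE // ltr_sqrt.
exists (l2class g) => e e0; have [|N hN] := cg ((e / 2) ^+ 2).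
  by rewrite exprn_gt0 // divr_gt0.
exists N => n /hN h; rewrite uf dE //.
have e2 : 0 <= e / 2 by rewrite divr_ge0 // ltW.
apply: (@le_lt_trans _ _ (Num.sqrt ((e / 2) ^+ 2))); first by rewrite ler_sqrt // sqr_ge0.
by rewrite sqrtr_sqr ger0_norm // ltr_pdivrMr // ltr_pMr // ltrDl.
Qed.

Definition L2 : hilbert R := @Hilbert R L2type l2dot_form L2_complete.

End L2.

Section OperatorAlgebra.
Variable R : realType.
Implicit Types H K : hilbert R.

Definition hnorm H (x : H) : R := dnorm (hdot H) x.

Definition bounded_op H : set (H -> H) :=
  [set a | linear a /\ exists m : R, forall x, hnorm (a x) <= m * hnorm x].

Definition adjoint_pair H (a b : H -> H) : Prop :=
  forall x y, hdot H (a x) y = hdot H x (b y).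

(* In R[i], 0 <= z means that z is real and nonnegative. *)
Definition op_le H (a b : H -> H) : Prop := forall x, 0 <= hdot H (b x - a x) x.

Definition op_zero H : H -> H := fun=> 0.

Definition commutant H (S : set (H -> H)) : set (H -> H) :=
  [set b | bounded_op b /\ forall a, S a -> a \o b = b \o a].

Definition bicommutant H (S : set (H -> H)) : set (H -> H) := commutant (commutant S).

Definition von_neumann H (M : set (H -> H)) : Prop :=
  [/\ M `<=` @bounded_op H,
      forall a, M a -> exists2 b, M b & adjoint_pair a b
    & bicommutant M = M].

Definition abelian_alg H (M : set (H -> H)) : Prop :=
  forall a b, M a -> M b -> a \o b = b \o a.

Definition dense_span H (S : set H) : Prop :=
  forall (x : H) (e : R), 0 < e -> exists n (c : 'I_n -> R[i]) (s : 'I_n -> H),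
  (forall i, S (s i)) /\ hnorm (x - \sum_i c i *: s i) < e.

Definition orthonormal_basis H (I : Type) (e : I -> H) : Prop :=
  [/\ forall i, hdot H (e i) (e i) = 1,
      forall i j, i <> j -> hdot H (e i) (e j) = 0
    & dense_span (range e)].

(* The completed tensor product is determined up to unitary equivalence by these
   properties of the map t x y = x (x) y. *)
Definition hilbert_tensor K H (T : hilbert R) (t : K -> H -> T) : Prop :=
  [/\ forall y, linear (t ^~ y), forall x, linear (t x),
      forall x x' y y', hdot T (t x y) (t x' y') = hdot K x x' * hdot H y y'
    & dense_span [set t x y | x in setT & y in setT]].

(* The operator c in this set is a (x) b. *)
Definition vn_tensor K H (T : hilbert R) (t : K -> H -> T)
    (A : set (K -> K)) (B : set (H -> H)) : set (T -> T) :=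
  bicommutant [set c | bounded_op c /\
    exists a b, [/\ A a, B b & forall x y, c (t x y) = t (a x) (b y)]].

Definition vn_prod (J : Type) (T : J -> hilbert R) (N : forall j, set (T j -> T j)) :
    set (forall j, T j -> T j) :=
  [set y | (forall j, N j (y j)) /\
           exists m : R, forall j x, hnorm (y j x) <= m * hnorm x].

Definition star_iso_prod H (M : set (H -> H)) (J : Type) (T : J -> hilbert R)
    (N : forall j, set (T j -> T j)) (phi : (H -> H) -> forall j, T j -> T j) : Prop :=
  [/\ set_bij M (vn_prod N) phi,
      forall (c : R[i]) a b j, M a -> M b ->
        phi (fun x => c *: a x + b x) j = fun y => c *: phi a j y + phi b j y,
      forall a b j, M a -> M b -> phi (a \o b) j = phi a j \o phi b j
    & forall a b j, M a -> M b -> adjoint_pair a b -> adjoint_pair (phi a j) (phi b j)].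

(* The cardinals j are represented by pairwise non-equipotent types I j. *)
Definition typeI H (M : set (H -> H)) : Prop :=
  exists (J : Type) (I : J -> Type) (K L T : J -> hilbert R)
    (A : forall j, set (K j -> K j)) (e : forall j, I j -> L j)
    (t : forall j, K j -> L j -> T j) (phi : (H -> H) -> forall j, T j -> T j),
  [/\ forall j j', (exists f : I j -> I j', bijective f) -> j = j',
      forall j, von_neumann (A j) /\ abelian_alg (A j),
      forall j, orthonormal_basis (e j),
      forall j, hilbert_tensor (t j)
    & star_iso_prod M (fun j => vn_tensor (t j) (A j) (@bounded_op (L j))) phi].

Definition projection H (p : H -> H) : Prop :=
  [/\ bounded_op p, p \o p = p & adjoint_pair p p].

(* For a projection p, the algebra p M p of operators on the range of p, seen as
   operators on H vanishing on the orthogonal complement; its unit is p. *)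
Definition corner H (p : H -> H) (M : set (H -> H)) : set (H -> H) :=
  [set p \o a \o p | a in M].

Definition central_projection H (M : set (H -> H)) (z : H -> H) : Prop :=
  [/\ projection z, M z & forall a, M a -> a \o z = z \o a].

(* The direct summands of M are the corners at central projections of M. *)
Definition no_summand H (P : forall (N : set (H -> H)) (z : H -> H), Prop)
    (M : set (H -> H)) : Prop :=
  forall z, central_projection M z -> z <> @op_zero H -> ~ P (corner z M) z.

Definition is_op_lub H (M D : set (H -> H)) (x : H -> H) : Prop :=
  (forall a, D a -> op_le a x) /\
  forall y, M y -> adjoint_pair y y -> (forall a, D a -> op_le a y) -> op_le x y.

Definition normal_functional H (M : set (H -> H)) (tau : (H -> H) -> R[i]) : Prop :=
  forall (D : set (H -> H)) (x : H -> H), D !=set0 -> D `<=` M ->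
  (forall a, D a -> adjoint_pair a a) ->
  (forall a b, D a -> D b -> exists c, [/\ D c, op_le a c & op_le b c]) ->
  M x -> adjoint_pair x x -> is_op_lub M D x ->
  forall eps : R, 0 < eps -> exists2 a, D a & Re (tau x) < Re (tau a) + eps.

(* u is the unit of M, which need not be the identity operator when M is a corner. *)
Definition normal_tracial_state H (M : set (H -> H)) (u : H -> H)
    (tau : (H -> H) -> R[i]) : Prop :=
  [/\ forall (c : R[i]) a b, M a -> M b ->
        tau (fun x => c *: a x + b x) = c * tau a + tau b,
      forall a b, M a -> M b -> adjoint_pair a b -> 0 <= tau (b \o a),
      tau u = 1,
      forall a b, M a -> M b -> tau (a \o b) = tau (b \o a)
    & normal_functional M tau].

(* For positive elements b \o a = a^* a only: traces do not separate all of M. *)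
Definition separating H (M : set (H -> H)) (F : set ((H -> H) -> R[i])) : Prop :=
  forall a b, M a -> M b -> adjoint_pair a b ->
  (forall tau, F tau -> tau (b \o a) = 0) -> a = @op_zero H.

Definition typeII1 H (M : set (H -> H)) (u : H -> H) : Prop :=
  no_summand (fun N _ => typeI N) M /\
  exists F : set ((H -> H) -> R[i]),
    (forall tau, F tau -> normal_tracial_state M u tau) /\ separating M F.

Definition directed (I : Type) (le : I -> I -> Prop) : Prop :=
  [/\ inhabited I, forall i, le i i, forall j i k, le i j -> le j k -> le i k
    & forall i j, exists k, le i k /\ le j k].

Definition typeIIinf H (M : set (H -> H)) (u : H -> H) : Prop :=
  [/\ no_summand (fun N _ => typeI N) M,
      no_summand (@typeII1 H) M
    & exists (I : Type) (le : I -> I -> Prop) (p : I -> H -> H),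
      [/\ directed le,
          forall i, M (p i) /\ projection (p i),
          forall i j, le i j -> op_le (p i) (p j),
          forall (x : H) (e : R), 0 < e ->
            exists i, forall j, le i j -> hnorm (p j x - u x) < e
        & forall i, typeII1 (corner (p i) M) (p i)]].

Definition typeII H (M : set (H -> H)) (u : H -> H) : Prop :=
  exists z, [/\ central_projection M z, typeII1 (corner z M) z
    & typeIIinf (corner (fun x => u x - z x) M) (fun x => u x - z x)].

End OperatorAlgebra.

Definition borel (G : groupTopType) := g_sigma_algebraType (@open G).

Section GroupVonNeumannAlgebra.
Variables (R : realType) (G : groupTopType).

(* On a second countable locally compact group such a Borel measure is regular. *)
Definition left_haar (mu : {measure set (borel G) -> \bar R}) : Prop :=
  [/\ mu [set: borel G] != 0%E,
      forall A : set G, compact A -> (mu A < +oo)%E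
    & forall (g : G) (A : set (borel G)), measurable A ->
        mu [set (g * x : G)%g | x in A] = mu A].

Definition left_regular (mu : {measure set (borel G) -> \bar R}) (g : G) :
    L2 mu -> L2 mu :=
  fun x => l2class mu (fun h : G => l2val x (g^-1 * h)%g).

Definition group_vna (mu : {measure set (borel G) -> \bar R}) : set (L2 mu -> L2 mu) :=
  bicommutant (range (@left_regular mu)).

Definition unitary_rep (H : hilbert R) (pi : G -> H -> H) : Prop :=
  [/\ forall g, linear (pi g),
      forall g x y, hdot H (pi g x) (pi g y) = hdot H x y,
      pi 1%g = id,
      forall g h, pi (g * h)%g = pi g \o pi h
    & forall (x : H) (g : G) (e : R), 0 < e ->
        \forall h \near g, hnorm (pi h x - pi g x) < e].

Definition typeI_group : Prop :=
  forall (H : hilbert R) (pi : G -> H -> H),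
  unitary_rep pi -> typeI (bicommutant (range pi)).

End GroupVonNeumannAlgebra.

Arguments group_vna {R G} mu.

(* Main.v *)
(* The group O acts on the ends of the tree. Let U_n be its compact open subgroup of the tree
automorphisms fixing every vertex at distance n + 1 from the root (call this level n), and
xi_n in L^2(O) the indicator of U_n.

For a vertex v of level m, take two subgroups of automorphisms of the forest below v and the
reflections 1 - 2p, where p projects onto their fixed vectors. The products x_m, y_m of
these reflections over all vertices of level m are invariant under conjugation by the subgroup
O^(m). They therefore act on the vectors lambda_g xi_m, with g in O^(m), like elements of the
commutant, so that the sequences (x_m) and (y_m) are asymptotically central. The two
subgroups can be chosen such that the commutators x_m y_m - y_m x_m are bounded below on these
vectors, uniformly in m. If e is an idempotent of L(O) with e L(O) e abelian, then the operators
e x_m e and e y_m e commute, and this forces e = 0. Hence L(O) has no type I summand.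

The projection p_n onto the U_n-fixed vectors belongs to L(O), and a |-> <a xi_n, xi_n> is a
faithful trace on p_n L(O) p_n, because U_n is normal in O^(n) and O is the union of these groups.
The p_n increase to 1. The complement of the supremum of the type II_1 central summands is then
of type II_infinity, and L(O) is of type II.

Haar measure exists, as the image of Lebesgue measure under a map from a union of unit intervals
which are subdivided in the same way as the cosets of the U_n. The left regular representation
is therefore a unitary representation which is not of type I. *)
Require Import Defs.
From mathcomp Require Import all_boot all_order all_algebra.
From mathcomp Require Import all_classical all_reals all_analysis.
From mathcomp Require Import measurable_realfun ring lra.
From mathcomp.real_closed Require Import complex.

Set Implicit Arguments.
Unset Strict Implicit.
Unset Printing Implicit Defensive.
Import Order.TTheory GRing.Theory Num.Theory.
Import numFieldNormedType.Exports.

Local Open Scope classical_set_scope.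
Local Open Scope ring_scope.
Local Notation Re := (@complex.Re _).
Local Notation Im := (@complex.Im _).

(** * Hilbert spaces and bounded operators *)

(** Reflections are used rather than projections because they are isometric: a product over all
    vertices of a level keeps norms, where a product of projections could shrink them without bound.
    The whole level is needed for invariance under [On m], but one vertex suffices for the lower
    bound. The inner product of [x_m y_m xi_m] with [y_m x_m xi_m] factorizes into a factor at a
    chosen vertex [v], which is bounded away from the maximal value, and a factor for the remaining
    vertices, to which Cauchy-Schwarz applies. The obstacle for the trace is that elements of the
    bicommutant do not come as limits of combinations of translations, so that the trace identity
    does not extend by continuity. The proof approximates the vector [a xi_n] instead of the
    operator [a]: taking adjoints is isometric at [xi_n], and polarization turns this into the trace
    identity. The passage between left and right translations rests on one fact, used throughout:
    for [g] in [On n] they agree on [xi n] up to inversion. A general [g] is handled by a finer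
    vector [xi m] with [g] in [On m], averaged back to [xi n]. *)

Section Geometry.
Variables (R : realType).
Implicit Types (H K : hilbert R).

Lemma sqmodM (z w : R[i]) : sqmod (z * w) = sqmod z * sqmod w.
Proof. by rewrite /sqmod Defs.ReM Defs.ImM; ring. Qed.
Lemma sqmodN (z : R[i]) : sqmod (- z) = sqmod z.
Proof. by rewrite /sqmod Defs.ReN Defs.ImN !sqrrN. Qed.
Lemma sqmodD_le (z w : R[i]) : sqmod (z + w) <= 2 * sqmod z + 2 * sqmod w.
Proof.
rewrite /sqmod Defs.ReD Defs.ImD; move: (Re z) (Re w) (Im z) (Im w) => a b c d.
by have := sqr_ge0 (a - b); have := sqr_ge0 (c - d); rewrite !expr2; nra.
Qed.
Lemma sqmod_eq0 (z : R[i]) : sqmod z = 0 -> z = 0.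
Proof.
move=> /eqP; rewrite /sqmod paddr_eq0 ?sqr_ge0 // !sqrf_eq0 => /andP[/eqP a /eqP b].
exact: complex_eq.
Qed.

Lemma small_eq0 (z : R[i]) (c : R) :
  (forall e : R, 0 < e -> sqmod z <= c * e) -> z = 0.
Proof.
move=> h; apply: sqmod_eq0; apply/eqP; rewrite eq_le sqmod_ge0 andbT.
have c0 : 0 <= c by have := h 1 ltr01; rewrite mulr1; apply: le_trans; exact: sqmod_ge0.
apply/ler_addgt0Pr => e e0; rewrite add0r.
have c1 : 0 < c + 1 by rewrite ltr_wpDl.
apply: le_trans (h (e / (c + 1)) _) _; first by rewrite divr_gt0.
by rewrite mulrA ler_pdivrMr // mulrC ler_wpM2l ?ltW // ltrDl.
Qed.

Section Dot.
Variable H : hilbert R.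
Implicit Types (x y z : H) (a : R[i]).
Local Notation ip := (hdot H).

Lemma ipDl x y z : ip (x + y) z = ip x z + ip y z. Proof. by rewrite linearDl. Qed.
Lemma ipDr x y z : ip x (y + z) = ip x y + ip x z. Proof. by rewrite linearDr. Qed.
Lemma ipZl a x y : ip (a *: x) y = a * ip x y. Proof. by rewrite linearZl_LR. Qed.
Lemma ipZr a x y : ip x (a *: y) = Num.conj a * ip x y. Proof. by rewrite linearZr_LR. Qed.
Lemma ipNl x y : ip (- x) y = - ip x y. Proof. by rewrite linearNl. Qed.
Lemma ipNr x y : ip x (- y) = - ip x y. Proof. by rewrite linearNr. Qed.
Lemma ipBl x y z : ip (x - y) z = ip x z - ip y z. Proof. by rewrite linearBl. Qed.
Lemma ipBr x y z : ip x (y - z) = ip x y - ip x z. Proof. by rewrite linearBr. Qed.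
Lemma ip0l x : ip 0 x = 0. Proof. by rewrite linear0l. Qed.
Lemma ip0r x : ip x 0 = 0. Proof. by rewrite linear0r. Qed.
Lemma ipJ x y : ip x y = Num.conj (ip y x).
Proof. by rewrite hermC expr0 mul1r. Qed.
Lemma ipReC x y : Re (ip x y) = Re (ip y x). Proof. by rewrite ipJ Defs.ReJ. Qed.

(* The squared norm is the basic quantity below: it avoids square roots. *)
Definition nsq x : R := Re (ip x x).

Lemma ip_ge0 x : 0 <= ip x x.
Proof. exact: dnorm_ge0. Qed.
Lemma ipxx_Im x : Im (ip x x) = 0.
Proof. by have := ip_ge0 x; rewrite lecE => /andP[/eqP]. Qed.
Lemma nsq_ge0 x : 0 <= nsq x.
Proof. by have := ip_ge0 x; rewrite lecE => /andP[_]. Qed.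
Lemma ipxxE x : ip x x = (nsq x)%:C%C.
Proof. by apply: complex_eq => //=; rewrite ipxx_Im. Qed.
Lemma nsq_eq0 x : nsq x = 0 -> x = 0.
Proof. by move=> h; apply/eqP; rewrite -(dnorm_eq0 ip) ipxxE h. Qed.
Lemma nsq0 : nsq 0 = 0. Proof. by rewrite /nsq ip0l. Qed.

Lemma nsqD x y : nsq (x + y) = nsq x + nsq y + 2 * Re (ip x y).
Proof. by rewrite /nsq !ipDl !ipDr !Defs.ReD (ipReC y x); ring. Qed.
Lemma nsqN x : nsq (- x) = nsq x.
Proof. by rewrite /nsq ipNl ipNr opprK. Qed.
Lemma nsqB x y : nsq (x - y) = nsq x + nsq y - 2 * Re (ip x y).
Proof. by rewrite nsqD nsqN ipNr Defs.ReN; ring. Qed.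
Lemma nsqBC x y : nsq (x - y) = nsq (y - x).
Proof. by rewrite -nsqN opprB. Qed.
Lemma nsqZ a x : nsq (a *: x) = sqmod a * nsq x.
Proof. by rewrite /nsq ipZl ipZr !Defs.ReM Defs.ReJ Defs.ImJ !Defs.ImM Defs.ReJ Defs.ImJ ipxx_Im /sqmod; ring. Qed.
Lemma nsq_gt0 x : x <> 0 -> 0 < nsq x.
Proof. by move=> x0; rewrite lt_neqAle nsq_ge0 andbT; apply/eqP => /esym/nsq_eq0. Qed.

Lemma CS x y : sqmod (ip x y) <= nsq x * nsq y.
Proof.
have [->|/eqP y0] := eqVneq y 0; first by rewrite ip0r nsq0 mulr0 sqmod0.
have py := nsq_gt0 y0.
have := nsq_ge0 ((nsq y)%:C%C *: x - ip x y *: y).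
rewrite nsqB !nsqZ ipZl ipZr -(ipJ y x) (ipJ y x) !Defs.ReM Defs.ReJ Defs.ImJ /= /sqmod /=.
set s := nsq y in py *; move: (Re (ip x y)) (Im (ip x y)) => a b.
rewrite mul0r subr0.
have -> : (s ^+ 2 + 0 ^+ 2) * nsq x + (a ^+ 2 + b ^+ 2) * s - 2 * (s * (a * a - - b * b))
  = s * (nsq x * s - (a ^+ 2 + b ^+ 2)) by ring.
by rewrite pmulr_rge0 // subr_ge0.
Qed.

Lemma CSRe x y : Re (ip x y) ^+ 2 <= nsq x * nsq y.
Proof. by apply: le_trans (CS x y); rewrite lerDl sqr_ge0. Qed.

Lemma nsqD_le x y : nsq (x + y) <= 2 * nsq x + 2 * nsq y.
Proof. by have := nsq_ge0 (x - y); rewrite nsqB nsqD; lra. Qed.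
Lemma nsqB_le x y : nsq (x - y) <= 2 * nsq x + 2 * nsq y.
Proof. by have := nsq_ge0 (x + y); rewrite nsqB nsqD; lra. Qed.
Lemma nsq_tri y x z : nsq (x - z) <= 2 * nsq (x - y) + 2 * nsq (y - z).
Proof. by have := nsqD_le (x - y) (y - z); rewrite addrA subrK. Qed.

Lemma hnormE x : hnorm x = Num.sqrt (nsq x). Proof. by []. Qed.
Lemma hnorm_ge0 x : 0 <= hnorm x. Proof. exact: sqrtr_ge0. Qed.
Lemma hnorm_sqr x : hnorm x ^+ 2 = nsq x.
Proof. by rewrite hnormE sqr_sqrtr // nsq_ge0. Qed.
Lemma hnorm_lt x e : 0 < e -> (hnorm x < e) = (nsq x < e ^+ 2).
Proof.
by move=> e0; rewrite -hnorm_sqr ltr_pXn2r // nnegrE ?hnorm_ge0 // ltW.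
Qed.

Lemma ip_eq0 x : (forall y, ip x y = 0) -> x = 0.
Proof. by move=> h; apply: nsq_eq0; rewrite /nsq h. Qed.
Lemma ip_ext x y : (forall z, ip x z = ip y z) -> x = y.
Proof. by move=> h; apply/eqP; rewrite -subr_eq0; apply/eqP/ip_eq0 => z; rewrite ipBl h subrr. Qed.

Lemma nsq_small_eq0 x : (forall e : R, 0 < e -> nsq x < e) -> x = 0.
Proof.
move=> h; apply: nsq_eq0; apply/eqP; rewrite eq_le nsq_ge0 andbT.
by apply/ler_addgt0Pr => e e0; rewrite add0r; apply/ltW/h.
Qed.

Lemma nsq_complete (u : nat -> H) :
  (forall e : R, 0 < e -> exists N, forall m n, (N <= m)%N -> (N <= n)%N -> nsq (u m - u n) < e) ->
  exists l, forall e : R, 0 < e -> exists N, forall n, (N <= n)%N -> nsq (u n - l) < e.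
Proof.
move=> hu; have [e e0|l hl] := @hilbert_complete R H u.
  have [|N hN] := hu (e ^+ 2); first by rewrite exprn_gt0.
  by exists N => m n Nm Nn; have := hN m n Nm Nn; rewrite -hnorm_lt.
exists l => e e0; have [|N hN] := hl (Num.sqrt e); first by rewrite sqrtr_gt0.
exists N => n Nn; have := hN n Nn; rewrite -/(hnorm _) hnorm_lt ?sqrtr_gt0 //.
by rewrite sqr_sqrtr // ltW.
Qed.

Definition adherent (E : set H) x := forall e : R, 0 < e -> exists2 y, E y & nsq (x - y) < e.

Definition closed_sub (E : set H) :=
  [/\ E 0, forall a x y, E x -> E y -> E (a *: x + y) & adherent E `<=` E].

Section ClosedSub.
Variable E : set H.
Hypothesis cE : closed_sub E.
Lemma csub0 : E 0. Proof. by case: cE. Qed.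
Lemma csubP a x y : E x -> E y -> E (a *: x + y). Proof. by case: cE => _ + _; exact. Qed.
Lemma csubZ a x : E x -> E (a *: x).
Proof. by move=> Ex; rewrite -[_ *: _]addr0; apply: csubP => //; exact: csub0. Qed.
Lemma csubD x y : E x -> E y -> E (x + y).
Proof. by move=> Ex Ey; rewrite -[x]scale1r; exact: csubP. Qed.
Lemma csubN x : E x -> E (- x).
Proof. by rewrite -scaleN1r; exact: csubZ. Qed.
Lemma csubB x y : E x -> E y -> E (x - y).
Proof. by move=> Ex Ey; apply: csubD => //; exact: csubN. Qed.
Lemma csub_cl x : (forall e : R, 0 < e -> exists2 y, E y & nsq (x - y) < e) -> E x.
Proof. by case: cE => _ _; exact. Qed.

(** A sequence minimizing the distance to [E] is Cauchy by the parallelogram identity. Orthogonality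
    is first shown for its terms, up to an error, by perturbing [u n] along [z] with the optimal
    coefficient [c], and then passed to the limit. *)
Lemma proj_exists x : exists p, E p /\ forall y, E y -> ip (x - p) y = 0.
Proof.
pose S := [set nsq (x - y) | y in E].
have S0 : S !=set0 by exists (nsq (x - 0)), 0 => //; exact: csub0.
have lbS : lbound S 0 by move=> _ [y _ <-]; exact: nsq_ge0.
have iS : has_inf S by split => //; exists 0.
set d := inf S.
have dle y : E y -> d <= nsq (x - y).
  by move=> Ey; apply: (ge_inf iS.2); exists y.
have /choice[u hu] (n : nat) : exists y, E y /\ nsq (x - y) < d + n.+1%:R^-1.
  have [|_ [y Ey <-]] := @inf_adherent R S n.+1%:R^-1 _ iS; first by rewrite invr_gt0.
  by move=> h; exists y.
have par (a b : H) : E a -> E b -> nsq (a - b) <= 2 * (nsq (x - a) - d) + 2 * (nsq (x - b) - d).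
  move=> Ea Eb; have := dle _ (csubZ (2^-1)%:C%C (csubD Ea Eb)).
  set m := _ *: _ => hm.
  have ea : x - a = (x - m) - (a - m) by rewrite opprB addrA subrK.
  have e2 : (2^-1)%:C%C + (2^-1)%:C%C = 1 :> R[i].
    by apply: complex_eq => /=; rewrite ?addr0 //; field.
  have mm : m + m = a + b by rewrite /m -scalerDl e2 scale1r.
  have eb : x - b = (x - m) + (a - m).
    by rewrite addrACA -opprD mm opprD addrA addrK.
  have ec : a - b = (a - m) + (a - m).
    by rewrite addrACA -opprD mm opprD addrA addrK.
  rewrite ea eb ec (nsqB (x - m)) (nsqD (x - m)) (nsqD (a - m) (a - m)) -/(nsq (a - m)); lra.
have [e e0|l hl] := @nsq_complete u.
  have [N hN] : exists N : nat, 4 * N.+1%:R^-1 < e.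
    have [N hN] : exists N : nat, N.+1%:R^-1 < e / 4.
      near \oo => N; exists N; near: N; apply: near_infty_natSinv_lt (PosNum _).
      by rewrite divr_gt0.
    by exists N; move: hN; rewrite ltr_pdivlMr // mulrC.
  have inv n : (N <= n)%N -> n.+1%:R^-1 <= N.+1%:R^-1 :> R.
    by move=> Nn; rewrite lef_pV2 ?posrE // ler_nat.
  exists N => m n /inv im /inv in_; have [Em lm] := hu m; have [En ln] := hu n.
  apply: le_lt_trans (par _ _ Em En) _; move: lm ln hN im in_.
  by move: (m.+1%:R^-1) (n.+1%:R^-1) (N.+1%:R^-1) => *; lra.
have El : E l.
  apply: csub_cl => e /hl[N /(_ N (leqnn _)) h]; exists (u N); first by case: (hu N).
  by rewrite nsqBC.
exists l; split => // z Ez.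
have [->|/eqP z0] := eqVneq z 0; first by rewrite ip0r.
have pz := nsq_gt0 z0.
have key n : sqmod (ip (x - u n) z) <= nsq z * n.+1%:R^-1.
  have [En ln] := hu n; pose c := ((nsq z)^-1)%:C%C * ip (x - u n) z.
  have := dle _ (csubD En (csubZ c Ez)).
  have -> : nsq (x - (u n + c *: z)) = nsq (x - u n) - sqmod (ip (x - u n) z) / nsq z.
    rewrite opprD addrA (nsqB (x - u n)) nsqZ ipZr /c sqmodM Defs.ReM Defs.ReJ Defs.ImJ Defs.ReM Defs.ImM /sqmod /=.
    move: (Re (ip _ _)) (Im (ip _ _)) => a b.
    by field; rewrite gt_eqF.
  rewrite -ler_pdivrMl // [_ / nsq z]mulrC; move: ln.
  by move: (n.+1%:R^-1) (_ * sqmod _) (nsq _) => *; lra.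
apply: (@small_eq0 _ (4 * nsq z)) => e e0.
have [N1 h1] := hl _ e0; have [N2 h2] : exists N : nat, N.+1%:R^-1 < e.
  near \oo => N; exists N; near: N; exact: near_infty_natSinv_lt (PosNum e0).
pose n := maxn N1 N2.
have := h1 n (leq_maxl _ _); have {h2} : n.+1%:R^-1 < e.
  apply: le_lt_trans h2; by rewrite lef_pV2 ?posrE // ler_nat ltnS leq_maxr.
have -> : x - l = (x - u n) + (u n - l) by rewrite addrA subrK.
move=> h2 h3; rewrite ipDl; apply: le_trans (sqmodD_le _ _) _.
have := key n; have := CS (u n - l) z.
move: (sqmod _) (sqmod _) (nsq (u n - l)) h3 (nsq z) pz h2 => A B r h3 q q0 h2 h4 h5.
have : A <= q * e by apply: le_trans h5 _; rewrite ler_wpM2l // ltW.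
have : B <= q * e by apply: le_trans h4 _; rewrite mulrC ler_wpM2l // ltW.
lra.
Unshelve. all: by end_near. Qed.

Definition oproj x : H := xget 0 [set p | E p /\ forall y, E y -> ip (x - p) y = 0].

Lemma projP x : E (oproj x) /\ forall y, E y -> ip (x - oproj x) y = 0.
Proof.
by rewrite /oproj; case: xgetP => [p -> //|h]; have [p hp] := proj_exists x; case: (h p).
Qed.
Lemma projE x : E (oproj x). Proof. by case: (projP x). Qed.
Lemma proj_orth x y : E y -> ip (x - oproj x) y = 0. Proof. by case: (projP x) => _; exact. Qed.
Lemma proj_uniq x p : E p -> (forall y, E y -> ip (x - p) y = 0) -> oproj x = p.
Proof.
move=> Ep hp; apply/eqP; rewrite -subr_eq0; apply/eqP/nsq_eq0.
have Ed := csubB (projE x) Ep; rewrite /nsq.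
have -> : oproj x - p = (x - p) - (x - oproj x) by rewrite opprB [RHS]addrC addrA subrK.
have e y : E y -> ip (x - p - (x - oproj x)) y = 0.
  by move=> Ey; rewrite ipBl hp // proj_orth // subrr.
rewrite e //; have -> // : x - p - (x - oproj x) = oproj x - p.
by rewrite opprB [LHS]addrC addrA subrK.
Qed.
Lemma proj_id x : E x -> oproj x = x.
Proof. by move=> Ex; apply: proj_uniq => // y _; rewrite subrr ip0l. Qed.
Lemma proj_linear : linear oproj.
Proof.
move=> a x y; apply: proj_uniq; first by apply: csubP; exact: projE.
move=> z Ez; have -> : a *: x + y - (a *: oproj x + oproj y) = a *: (x - oproj x) + (y - oproj y).
  by rewrite opprD addrACA -scalerN -scalerDr.
by rewrite ipDl ipZl !proj_orth // mulr0 addr0.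
Qed.
Lemma proj_ip x y : E y -> ip (oproj x) y = ip x y.
Proof. by move=> Ey; apply/eqP; rewrite eq_sym -subr_eq0 -ipBl proj_orth. Qed.
Lemma proj_sa x y : ip (oproj x) y = ip x (oproj y).
Proof. by rewrite -(proj_ip x (projE y)) ipJ -(proj_ip y (projE x)) -ipJ. Qed.
Lemma proj_idem x : oproj (oproj x) = oproj x. Proof. by apply/proj_id/projE. Qed.
Lemma proj_contr x : nsq (oproj x) <= nsq x.
Proof.
rewrite -[X in _ <= nsq X](subrK (oproj x)) nsqD (proj_orth _ (projE x)) /= mulr0 addr0.
by rewrite lerDr nsq_ge0.
Qed.
End ClosedSub.
End Dot.
End Geometry.

(** * Bounded operators, adjoints and commutants *)

Section Operators.
Variables (R : realType).
Implicit Types (H K : hilbert R).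

Lemma lin0 H K (a : H -> K) : linear a -> a 0 = 0.
Proof. by move=> l; have := l (-1) 0 0; rewrite scaleN1r oppr0 addr0 scaleN1r addNr. Qed.
Lemma linZ H K (a : H -> K) : linear a -> forall c x, a (c *: x) = c *: a x.
Proof. by move=> l c x; have := l c x 0; rewrite !addr0 (lin0 l) addr0. Qed.
Lemma linD H K (a : H -> K) : linear a -> forall x y, a (x + y) = a x + a y.
Proof. by move=> l x y; have := l 1 x y; rewrite !scale1r. Qed.
Lemma linN H K (a : H -> K) : linear a -> forall x, a (- x) = - a x.
Proof. by move=> l x; rewrite -scaleN1r (linZ l) scaleN1r. Qed.
Lemma linB H K (a : H -> K) : linear a -> forall x y, a (x - y) = a x - a y.
Proof. by move=> l x y; rewrite (linD l) (linN l). Qed.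
Lemma lin_sum H K (a : H -> K) : linear a -> forall I (r : seq I) (F : I -> H),
  a (\sum_(i <- r) F i) = \sum_(i <- r) a (F i).
Proof.
move=> l I r F; elim: r => [|i r IHr]; first by rewrite !big_nil (lin0 l).
by rewrite !big_cons (linD l) IHr.
Qed.

Section OneSpace.
Variable H : hilbert R.
Local Notation ip := (hdot H).
Implicit Types (a b : H -> H) (x y : H).

Lemma bounded_nsq a : bounded_op a -> exists2 c, 0 < c & forall x, nsq (a x) <= c * nsq x.
Proof.
move=> [_ [m hm]]; exists (m ^+ 2 + 1); first by rewrite ltr_wpDl // sqr_ge0.
move=> x; rewrite -!hnorm_sqr; apply: (@le_trans _ _ ((m * hnorm x) ^+ 2)).
  rewrite ler_pXn2r ?nnegrE ?hnorm_ge0 //.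
  by apply: le_trans (hm x); exact: hnorm_ge0.
by rewrite exprMn ler_wpM2r ?sqr_ge0 // lerDl.
Qed.

Lemma nsq_bounded a (c : R) : linear a -> (forall x, nsq (a x) <= c * nsq x) -> bounded_op a.
Proof.
move=> l h; split => //; exists (Num.sqrt (`|c|)) => x.
rewrite hnormE [X in _ * X]hnormE -sqrtrM // ler_wsqrtr //.
apply: le_trans (h x) _; rewrite ler_wpM2r ?nsq_ge0 //; exact: ler_norm.
Qed.

Lemma bop_lin a : bounded_op a -> linear a. Proof. by case. Qed.

Lemma bop_id : bounded_op (@id H).
Proof. by apply: (@nsq_bounded _ 1) => // x; rewrite mul1r. Qed.
Lemma bop_zero : bounded_op (@op_zero R H).
Proof.
apply: (@nsq_bounded _ 0) => [c x y|x]; last by rewrite /op_zero nsq0 mul0r.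
by rewrite /op_zero scaler0 addr0.
Qed.
Lemma bop_comp a b : bounded_op a -> bounded_op b -> bounded_op (a \o b).
Proof.
move=> ba bb; have [c c0 hc] := bounded_nsq ba; have [d d0 hd] := bounded_nsq bb.
apply: (@nsq_bounded _ (c * d)) => [k x y|x] /=.
  by rewrite (bop_lin bb) (bop_lin ba).
by apply: le_trans (hc _) _; rewrite -mulrA ler_wpM2l // ltW.
Qed.
Lemma bop_lc k a b : bounded_op a -> bounded_op b -> bounded_op (fun x => k *: a x + b x).
Proof.
move=> ba bb; have [c c0 hc] := bounded_nsq ba; have [d d0 hd] := bounded_nsq bb.
apply: (@nsq_bounded _ (2 * (sqmod k * c) + 2 * d)) => [l x y|x].
  by rewrite (bop_lin bb) (bop_lin ba) !scalerDr !scalerA (mulrC k) addrACA.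
apply: le_trans (nsqD_le _ _) _; rewrite [X in _ <= X]mulrDl lerD // -[X in _ <= X]mulrA ler_wpM2l //.
by rewrite nsqZ -mulrA ler_wpM2l ?sqmod_ge0.
Qed.

Lemma bop_sub a b : bounded_op a -> bounded_op b -> bounded_op (fun x => a x - b x).
Proof.
move=> ba bb; have := bop_lc (-1) bb ba; congr bounded_op.
by apply/funext => x; rewrite scaleN1r addrC.
Qed.

(** A non-zero functional is represented by a multiple of [u], the component orthogonal to its
    kernel [N] of a vector outside [N]. For each [x], the vector [ip (a u) y *: x - ip (a x) y *: u]
    lies in [N], hence is orthogonal to [u]. *)
Lemma riesz a y : bounded_op a -> exists w, forall x, ip (a x) y = ip x w.
Proof.
move=> ba; have la := bop_lin ba; have [c c0 hc] := bounded_nsq ba.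
pose N := [set x | ip (a x) y = 0].
have cN : closed_sub N.
  split; rewrite /N /=.
  - by rewrite (lin0 la) ip0l.
  - by move=> k u v hu hv; rewrite la ipDl ipZl hu hv mulr0 addr0.
  - move=> u hu; apply: (@small_eq0 _ _ (c * nsq y)) => e /hu[v hv uv].
    have -> : ip (a u) y = ip (a (u - v)) y by rewrite (linB la) ipBl hv subr0.
    apply: le_trans (CS _ _) _; rewrite mulrAC ler_wpM2r ?nsq_ge0 //.
    by apply: le_trans (hc _) _; rewrite ler_wpM2l // ltW.
have [hN|/existsNP[x0 nx0]] := pselect (forall x, N x).
  by exists 0 => x; rewrite ip0r; exact: hN.
pose u := x0 - oproj N x0.
have fu : ip (a u) y = ip (a x0) y.
  by rewrite /u (linB la) ipBl (projE cN x0) subr0.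
have u0 : u <> 0 by move=> e; apply: nx0; rewrite /N /= -fu e (lin0 la) ip0l.
have pu := nsq_gt0 u0.
pose k := ip (a u) y * ((nsq u)^-1)%:C%C.
exists (Num.conj k *: u) => x; rewrite ipZr conjCK /k.
have : ip (ip (a u) y *: x - ip (a x) y *: u) u = 0.
  rewrite ipJ (_ : ip u _ = 0) ?rmorph0 // proj_orth //.
  by rewrite /N /= (linB la) !(linZ la) ipBl !ipZl mulrC subrr.
rewrite ipBl !ipZl ipxxE => /eqP; rewrite subr_eq0 => /eqP e.
rewrite mulrAC e -mulrA -rmorphM divff ?gt_eqF //= mulr1 //.
Qed.

Definition hadj a y : H := xget 0 [set w | forall x, ip (a x) y = ip x w].

Lemma adjP a x y : bounded_op a -> ip (a x) y = ip x (hadj a y).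
Proof.
move=> ba; rewrite /hadj; case: xgetP => [w -> //|h].
by have [w hw] := riesz y ba; case: (h w).
Qed.

Lemma adjP' a x y : bounded_op a -> ip (hadj a x) y = ip x (a y).
Proof. by move=> ba; rewrite ipJ -adjP // -ipJ. Qed.

(** Cauchy-Schwarz for [ip (a (hadj a x)) x], which equals [nsq (hadj a x)], bounds the square of
    this number by itself times [c * nsq x]; the common factor cancels. *)
Lemma adj_bounded a : bounded_op a -> bounded_op (hadj a).
Proof.
move=> ba; have [c c0 hc] := bounded_nsq ba; apply: (@nsq_bounded _ c).
  move=> k x y; apply: ip_ext => z.
  by rewrite ipDl ipZl !adjP' // ipDl ipZl.
move=> x; have := CSRe (a (hadj a x)) x; rewrite adjP // -/(nsq _).
have [e|n0] := eqVneq (nsq (hadj a x)) 0.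
  by rewrite e => _; rewrite mulr_ge0 ?nsq_ge0 // ltW.
have p : 0 < nsq (hadj a x) by rewrite lt_neqAle eq_sym n0 nsq_ge0.
move=> h; have {}h := le_trans h (ler_wpM2r (nsq_ge0 x) (hc _)).
by rewrite -(ler_pM2r p) -expr2 (le_trans h) // mulrAC.
Qed.

Lemma adj_pair a : bounded_op a -> adjoint_pair a (hadj a).
Proof. by move=> ba x y; exact: adjP. Qed.

Lemma adjoint_sym a b : adjoint_pair a b -> adjoint_pair b a.
Proof. by move=> h x y; rewrite ipJ -h -ipJ. Qed.

Lemma adjoint_uniq a b b' : adjoint_pair a b -> adjoint_pair a b' -> b = b'.
Proof.
move=> h h'; apply/funext => x; apply: ip_ext => z.
by rewrite (adjoint_sym h) (adjoint_sym h').
Qed.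

Lemma adj_eq a b : bounded_op a -> adjoint_pair a b -> b = hadj a.
Proof. by move=> ba h; apply: adjoint_uniq h (adj_pair ba). Qed.

Lemma adjoint_sub a a' b b' : adjoint_pair a a' -> adjoint_pair b b' ->
  adjoint_pair (fun x => a x - b x) (fun x => a' x - b' x).
Proof. by move=> ha hb x y; rewrite ipBl ipBr ha hb. Qed.

Lemma sa_Im a x : adjoint_pair a a -> Im (ip (a x) x) = 0.
Proof. by move=> h; have := h x x => e; have := congr1 Im (ipJ (a x) x); rewrite -e Defs.ImJ; lra. Qed.

Lemma op_leP a b : adjoint_pair a a -> adjoint_pair b b ->
  (op_le a b <-> forall x, Re (ip (a x) x) <= Re (ip (b x) x)).
Proof.
move=> ha hb; split=> h x.
  by have := h x; rewrite lecE ipBl Defs.ReD Defs.ReN /= => /andP[_]; rewrite subr_ge0.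
rewrite lecE ipBl Defs.ReD Defs.ReN Defs.ImD Defs.ImN !sa_Im // oppr0 addr0 eqxx /=.
by rewrite subr_ge0.
Qed.

Lemma op_le_Re a b x : op_le a b -> Re (ip (a x) x) <= Re (ip (b x) x).
Proof. by move=> /(_ x); rewrite lecE ipBl Defs.ReD Defs.ReN /= => /andP[_]; rewrite subr_ge0. Qed.

Section Commutant.
Variable S : set (H -> H).

Lemma comm_bounded b : commutant S b -> bounded_op b. Proof. by case. Qed.
Lemma commE b a x : commutant S b -> S a -> a (b x) = b (a x).
Proof. by move=> [_ h] /h/(congr1 (@^~ x)). Qed.
Lemma comm_intro b : bounded_op b -> (forall a x, S a -> a (b x) = b (a x)) -> commutant S b.
Proof. by move=> bb h; split=> // a Sa; apply/funext => x /=; exact: h. Qed.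
Lemma comm_id : commutant S id.
Proof. by split; first exact: bop_id. Qed.
Lemma comm_comp a b : commutant S a -> commutant S b -> commutant S (a \o b).
Proof.
move=> ca cb; apply: comm_intro; first by apply: bop_comp; exact: comm_bounded.
by move=> s x Ss /=; rewrite (commE _ ca) // (commE _ cb).
Qed.
Hypothesis Sb : S `<=` @bounded_op R H.
Lemma comm_lc k a b : commutant S a -> commutant S b -> commutant S (fun x => k *: a x + b x).
Proof.
move=> ca cb; apply: comm_intro; first by apply: bop_lc; exact: comm_bounded.
by move=> s x Ss /=; rewrite (bop_lin (Sb Ss)) (commE _ ca) // (commE _ cb).
Qed.
Lemma comm_zero : commutant S (@op_zero R H).
Proof.
apply: comm_intro; first exact: bop_zero.
by move=> s x /Sb/bop_lin/lin0.
Qed.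
Lemma comm_sub a b : commutant S a -> commutant S b -> commutant S (fun x => a x - b x).
Proof.
move=> ca cb; have := comm_lc (-1) cb ca; congr commutant.
by apply/funext => x; rewrite scaleN1r addrC.
Qed.
(** Strong closedness of a commutant. Two vectors are enough: comparing [s (y x)] with [y (s x)]
    requires approximations of [y] at [x] and at [s x]. *)
Lemma comm_sclosed (y : H -> H) : bounded_op y ->
  (forall x1 x2 (e : R), 0 < e -> exists b, [/\ commutant S b,
     nsq (y x1 - b x1) < e & nsq (y x2 - b x2) < e]) -> commutant S y.
Proof.
move=> by_ h; apply: comm_intro => // s x Ss; have bs := Sb Ss.
have [c c0 hc] := bounded_nsq bs.
apply/eqP; rewrite -subr_eq0; apply/eqP/nsq_small_eq0 => e e0.
have [|b [cb h1 h2]] := h x (s x) (e / (4 * (c + 1))).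
  by rewrite divr_gt0 // mulr_gt0 // ltr_wpDr // ltW.
have := nsq_tri (s (b x)) (s (y x)) (y (s x)); rewrite -(linB (bop_lin bs)).
move: h2; rewrite (nsqBC (y (s x))) -(commE _ cb Ss); have := hc (y x - b x); move: h1.
have p : 0 < 4 * (c + 1) by rewrite mulr_gt0 // ltr_wpDr // ltW.
rewrite !ltr_pdivlMr //.
move: (nsq _) (nsq (s _)) (nsq (_ - y (s x))) (nsq (s (y x) - _)) (nsq_ge0 (y x - b x)) => A B D E A0.
nra.
Qed.
End Commutant.

Lemma comm_adj (S : set (H -> H)) b : S `<=` @bounded_op R H ->
  (forall a, S a -> exists2 a', S a' & adjoint_pair a a') ->
  commutant S b -> commutant S (hadj b).
Proof.
move=> Sb Sa cb; have bb := comm_bounded cb; apply: comm_intro; first exact: adj_bounded.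
move=> a x aS; have [a' Sa' aa'] := Sa _ aS; apply: ip_ext => z.
by rewrite aa' !adjP' // aa' (commE _ cb).
Qed.

Lemma comm_anti (S S' : set (H -> H)) : S `<=` S' -> commutant S' `<=` commutant S.
Proof. by move=> SS b [bb h]; split=> // a /SS/h. Qed.

Lemma sub_bicommutant (S : set (H -> H)) : S `<=` @bounded_op R H -> S `<=` bicommutant S.
Proof. by move=> Sb a Sa; split; [exact: Sb|move=> b [_ /(_ a Sa)]]. Qed.

Lemma proj_bounded (E : set H) : closed_sub E -> bounded_op (oproj E).
Proof.
move=> cE; apply: (@nsq_bounded _ 1); first exact: proj_linear.
by move=> x; rewrite mul1r; exact: proj_contr.
Qed.
Lemma proj_adj (E : set H) : closed_sub E -> adjoint_pair (oproj E) (oproj E).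
Proof. by move=> cE x y; exact: proj_sa. Qed.

Lemma proj_comm (E : set H) a a' : closed_sub E -> linear a -> adjoint_pair a a' ->
  (forall x, E x -> E (a x)) -> (forall x, E x -> E (a' x)) -> forall x, a (oproj E x) = oproj E (a x).
Proof.
move=> cE la aa' Ea Ea' x; apply/esym; apply: proj_uniq => //; first by apply: Ea; exact: projE.
move=> y Ey; rewrite -(linB la) aa'; exact: proj_orth cE _ _ (Ea' _ Ey).
Qed.

Lemma proj_commutant (S : set (H -> H)) E : closed_sub E -> S `<=` @bounded_op R H ->
  (forall a, S a -> exists2 a', adjoint_pair a a' & forall x, E x -> E (a x) /\ E (a' x)) ->
  commutant S (oproj E).
Proof.
move=> cE Sb h; apply: comm_intro; first exact: proj_bounded.
move=> a x Sa; have [a' aa' hE] := h _ Sa.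
by apply: (proj_comm cE (bop_lin (Sb _ Sa)) aa') => z /hE[].
Qed.

End OneSpace.

Lemma dense_ind H (S E : set H) : dense_span S -> closed_sub E -> S `<=` E -> forall x, E x.
Proof.
move=> dS cE SE x; apply: csub_cl => // e e0.
have [|n [c [s [Ss hs]]]] := dS x (Num.sqrt e); first by rewrite sqrtr_gt0.
exists (\sum_i c i *: s i); last by move: hs; rewrite hnorm_lt ?sqrtr_gt0 // sqr_sqrtr // ltW.
elim: n c s Ss {hs} => [|n IHn] c s Ss; first by rewrite big_ord0; exact: csub0.
rewrite big_ord_recr /=; apply: csubD => //; first by apply: IHn.
by apply: csubZ => //; exact: SE.
Qed.

End Operators.

Section Limits.
Variables (R : realType).

Lemma inv_small (e : R) : 0 < e -> exists N : nat, forall n, (N <= n)%N -> n.+1%:R^-1 < e.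
Proof.
move=> e0; have [N hN] : exists N : nat, N.+1%:R^-1 < e.
  near \oo => N; exists N; near: N; exact: near_infty_natSinv_lt (PosNum e0).
exists N => n Nn; apply: le_lt_trans hN.
by rewrite lef_pV2 ?posrE // ler_nat ltnS.
Unshelve. all: by end_near. Qed.

Lemma inv_pos n : 0 < n.+1%:R^-1 :> R.
Proof. by rewrite invr_gt0. Qed.

Lemma ler_small (a b k : R) : 0 <= k -> (forall e : R, 0 < e -> a <= b + k * e) -> a <= b.
Proof.
move=> k0 h; apply/ler_addgt0Pr => e e0.
have k1 : 0 < k + 1 by rewrite ltr_wpDl.
apply: le_trans (h (e / (k + 1)) _) _; first by rewrite divr_gt0.
by rewrite lerD2l mulrA ler_pdivrMr // mulrC ler_wpM2l ?ltW // ltrDl.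
Qed.

(** * Extension of a densely defined bounded linear relation *)

Section Extension.
Variables (H K : hilbert R) (D : H -> K -> Prop) (c : R).
Hypothesis c0 : 0 <= c.
Hypothesis DP : forall (k : R[i]) u v u' v', D u v -> D u' v' -> D (k *: u + u') (k *: v + v').
Hypothesis Dc : forall u v, D u v -> nsq v <= c * nsq u.
Hypothesis Dd : forall (x : H) (e : R), 0 < e -> exists u v, D u v /\ nsq (x - u) < e.

Let D_sub u v u' v' : D u v -> D u' v' -> D (u - u') (v - v').
Proof.
move=> h h'; have := DP (-1) h' h; rewrite !scaleN1r.
by rewrite addrC (addrC (- v')).
Qed.

Let G x y := forall e : R, 0 < e -> exists u v, [/\ D u v, nsq (x - u) < e & nsq (y - v) < e].

Let G_ex x : exists y, G x y.
Proof.
have /choice[u /choice[v hu]] n : exists u v, D u v /\ nsq (x - u) < n.+1%:R^-1.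
  by apply: Dd; exact: inv_pos.
have [e e0|l hl] := @nsq_complete R K v.
  have [|N hN] := @inv_small (e / (4 * (c + 1))).
    by rewrite divr_gt0 // mulr_gt0 // ltr_wpDl.
  exists N => m n /hN im /hN in_.
  have [Dm hm] := hu m; have [Dn hn] := hu n.
  apply: le_lt_trans (Dc (D_sub Dm Dn)) _.
  have := nsq_tri x (u m) (u n); rewrite (nsqBC (u m) x).
  have := inv_pos m; have := inv_pos n; move: im in_ hm hn; rewrite !ltr_pdivlMr ?mulr_gt0 // ?ltr_wpDl //.
  move: (m.+1%:R^-1) (n.+1%:R^-1) (nsq (x - u m)) (nsq (x - u n)) (nsq_ge0 (u m - u n)) => a b A B.
  move: (nsq (u m - u n)) => W W0 h1 h2 h3 h4 p1 p2 h5.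
  apply: (@le_lt_trans _ _ (c * (2 * a + 2 * b))); last by nra.
  by rewrite ler_wpM2l //; lra.
exists l => e e0; have [N1 h1] := hl _ e0; have [N2 h2] := inv_small e0.
exists (u (maxn N1 N2)), (v (maxn N1 N2)); have [? h3] := hu (maxn N1 N2); split => //.
  by apply: lt_trans h3 _; apply: h2; exact: leq_maxr.
by rewrite nsqBC; apply: h1; exact: leq_maxl.
Qed.

Let G_lin (k : R[i]) x y x' y' : G x y -> G x' y' -> G (k *: x + x') (k *: y + y').
Proof.
move=> h h' e e0.
have k1 : 0 < sqmod k + 1 by rewrite ltr_wpDl // sqmod_ge0.
have p : 0 < e / (4 * (sqmod k + 1)) by rewrite divr_gt0 // mulr_gt0.
have [u [v [Duv hu hv]]] := h _ p; have [u' [v' [Duv' hu' hv']]] := h' _ p.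
exists (k *: u + u'), (k *: v + v'); split; first exact: DP.
- rewrite opprD addrACA -scalerBr; apply: le_lt_trans (nsqD_le _ _) _; rewrite nsqZ.
  move: hu hu'; rewrite !ltr_pdivlMr ?mulr_gt0 //.
  move: (sqmod k) (sqmod_ge0 k) (nsq (x - u)) (nsq_ge0 (x - u)) (nsq (x' - u')) (nsq_ge0 (x' - u')).
  by move=> s s0 A A0 B B0; nra.
- rewrite opprD addrACA -scalerBr; apply: le_lt_trans (nsqD_le _ _) _; rewrite nsqZ.
  move: hv hv'; rewrite !ltr_pdivlMr ?mulr_gt0 //.
  move: (sqmod k) (sqmod_ge0 k) (nsq (y - v)) (nsq_ge0 (y - v)) (nsq (y' - v')) (nsq_ge0 (y' - v')).
  by move=> s s0 A A0 B B0; nra.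
Qed.

Let G_bound x y : G x y -> nsq y <= 4 * c * nsq x.
Proof.
move=> h; apply: (@ler_small _ _ (4 * c + 2)); first by rewrite addr_ge0 // mulr_ge0.
move=> e e0; have [u [v [Duv hu hv]]] := h e e0.
have := Dc Duv; have := nsqD_le (y - v) v; rewrite subrK.
have := nsqB_le x (x - u); rewrite opprB addrCA subrr addr0.
move: (nsq (x - u)) (nsq (y - v)) hu hv (nsq x) (nsq u) (nsq v) (nsq y) => A B hA hB X U V Y h1 h2 h3.
have : c * U <= c * (2 * X + 2 * A) by rewrite ler_wpM2l.
have : c * A <= c * e by rewrite ler_wpM2l // ltW.
nra.
Qed.

Let G_uniq x y y' : G x y -> G x y' -> y = y'.
Proof.
move=> h h'; have := G_bound (G_lin (-1) h' h).
rewrite !scaleN1r addNr nsq0 mulr0 => h0.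
have /eqP : - y' + y = 0 by apply: nsq_eq0; apply/eqP; rewrite eq_le h0 nsq_ge0.
by rewrite addrC subr_eq0 => /eqP.
Qed.

(** The graph of [f] is the closure [G] of [D]; completeness of [K] makes it everywhere defined, and
    its bound makes it single-valued. The factor 4 comes from two uses of
    [nsq (x + y) <= 2 * nsq x + 2 * nsq y], one on each side of the relation. *)
Lemma extension : exists f : H -> K, [/\ linear f, forall x, nsq (f x) <= 4 * c * nsq x &
  forall u v, D u v -> f u = v].
Proof.
have /choice[f hf] := G_ex; exists f; split.
- by move=> k x y; apply: G_uniq (hf _) _; exact: G_lin.
- by move=> x; exact: G_bound.
- move=> u v Duv; apply: G_uniq (hf _) _ => e e0; exists u, v; split => //.
    by rewrite subrr nsq0.
  by rewrite subrr nsq0.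
Qed.
End Extension.

(** * Monotone nets of operators and normality of vector states *)

Section Vigier.
Variables (H : hilbert R) (N D : set (H -> H)) (x : H -> H).
Local Notation ip := (hdot H).
Hypothesis Nb : N `<=` @bounded_op R H.
Hypothesis Nc : forall y, bounded_op y ->
  (forall x1 x2 (e : R), 0 < e -> exists b, [/\ N b,
     nsq (y x1 - b x1) < e & nsq (y x2 - b x2) < e]) -> N y.
Hypothesis DN : D `<=` N.
Hypothesis Dsa : forall a, D a -> adjoint_pair a a.
Hypothesis Ddir : forall a b, D a -> D b -> exists c, [/\ D c, op_le a c & op_le b c].
Hypothesis Nx : N x.
Hypothesis xsa : adjoint_pair x x.
Hypothesis xlub : is_op_lub N D x.

Let le_trans_op (a b c : H -> H) : op_le a b -> op_le b c -> op_le a c.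
Proof.
move=> h1 h2 z; have := addr_ge0 (h1 z) (h2 z); rewrite -ipDl.
by rewrite addrC addrA subrK.
Qed.

(** This is the inequality [P ^ 2 <= k P] for [0 <= P <= k]. It follows from positivity of [P] at
    [k u - P u] together with the upper bound at [P u]. *)
Lemma positive_nsq_le (P : H -> H) (k : R) : linear P -> adjoint_pair P P -> 0 < k ->
  (forall u, 0 <= Re (ip (P u) u) <= k * nsq u) -> forall u, nsq (P u) <= k * Re (ip (P u) u).
Proof.
move=> lP sP k0 h u; have /andP[_ hP] := h (P u).
have /andP[+ _] := h (k%:C%C *: u - P u).
rewrite (linB lP) (linZ lP) ipBl !ipBr !ipZl !ipZr (sP (P u)) !Defs.ReD !Defs.ReN !Defs.ReM.
rewrite Defs.ReJ !Defs.ImJ /= Defs.ReD !Defs.ReN !Defs.ReM Defs.ReJ Defs.ImJ /= -/(nsq (P u)).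
rewrite (sP u (P u)) in hP *; rewrite -?(sP u (P u)) in hP *.
have e : Re (ip (P (P u)) u) = nsq (P u) by rewrite (sP (P u)).
move: hP; rewrite -/(nsq (P u)).
move: (nsq (P u)) (Re (ip (P u) u)) (Re (ip (P (P u)) (P u))) => A B E hE h1.
rewrite -(ler_pM2l k0).
nra.
Qed.

(* The bounded increasing net [D] converges strongly to some [y]. As [y] lies in [N], it
   dominates the least upper bound [x]. *)
Lemma vector_state_normal (xi : H) (e : R) : D !=set0 -> 0 < e ->
  exists2 a, D a & Re (ip (x xi) xi) < Re (ip (a xi) xi) + e.
Proof.
move=> [a0 Da0] e0; have xub := xlub.1.
have lin_D a : D a -> linear a by move=> /DN/Nb/bop_lin.
have [k k0 hk] : exists2 k, 0 < k & forall u, Re (ip (x u - a0 u) u) <= k * nsq u.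
  have [c c0 hc] := bounded_nsq (bop_sub (Nb Nx) (Nb (DN Da0))).
  exists (c + 1) => [|u]; first by rewrite ltr_wpDl // ltW.
  have := CSRe (x u - a0 u) u; have := hc u; have := nsq_ge0 u.
  move: (nsq (_ - _)) (nsq u) (Re _) => A B r B0 hA hr.
  have {hA}hr : r ^+ 2 <= c * B ^+ 2.
    by apply: le_trans hr _; rewrite expr2 mulrA ler_wpM2r.
  rewrite leNgt; apply/negP => h.
  have : ((c + 1) * B) ^+ 2 < r ^+ 2.
    have : 0 <= (c + 1) * B by rewrite mulr_ge0 // addr_ge0 // ltW.
    by rewrite !expr2; nra.
  by rewrite exprMn; have := sqr_ge0 B; nra.
pose f a u := Re (ip (a u) u).
have mono a b u : op_le a b -> f a u <= f b u by exact: op_le_Re.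
have diff a b u : D a -> D b -> op_le a0 a -> op_le a b ->
    nsq (b u - a u) <= k * (f b u - f a u).
  move=> Da Db h1 h2; have := @positive_nsq_le (fun u => b u - a u) k.
  have -> : f b u - f a u = Re (ip (b u - a u) u) by rewrite ipBl Defs.ReD Defs.ReN.
  apply => //.
  - by move=> c y z; rewrite (lin_D _ Da) (lin_D _ Db) opprD addrACA -scalerBr.
  - exact: adjoint_sub (Dsa Db) (Dsa Da).
  - move=> v; rewrite ipBl Defs.ReD Defs.ReN subr_ge0 (mono _ _ v h2) /=.
    apply: le_trans (hk v); rewrite ipBl Defs.ReD Defs.ReN lerB //; last exact: (mono _ _ v h1).
    exact: (mono _ _ v (xub _ Db)).
have above a b : D a -> D b -> exists c, [/\ D c, op_le a0 c, op_le a c & op_le b c].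
  move=> Da Db; have [c1 [Dc1 h1 h2]] := Ddir Da Db; have [c2 [Dc2 h3 h4]] := Ddir Dc1 Da0.
  by exists c2; split => //; [exact: le_trans_op h3|exact: le_trans_op h3].
(* The numbers [f a u] increase to their supremum along [D], so [diff] makes the vectors [a u] a
   Cauchy net. A sequence almost attaining the supremum gives the limit. Only indices above [a0]
   count, because the constant [k] bounds differences above [a0]. *)
have key u : exists l, forall d : R, 0 < d -> exists a, [/\ D a, op_le a0 a &
    forall b, D b -> op_le a b -> nsq (b u - l) < d].
  pose S := [set f a u | a in [set a | D a /\ op_le a0 a]].
  have r0 : op_le a0 a0 by move=> z; rewrite subrr ip0l.
  have hS : has_sup S.
    split; first by exists (f a0 u), a0.
    by exists (f x u) => _ [a [Da _] <-]; exact: mono _ _ u (xub _ Da).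
  have /choice[a ha] n : exists a, [/\ D a, op_le a0 a & sup S - n.+1%:R^-1 < f a u].
    by have [_ [a [Da h] <-] h2] := sup_adherent (inv_pos n) hS; exists a.
  have near n b : D b -> op_le (a n) b -> nsq (b u - a n u) <= k * n.+1%:R^-1.
    move=> Db h; have [Da h1 h2] := ha n.
    apply: le_trans (diff _ _ u Da Db h1 h) _; rewrite ler_wpM2l // ?ltW //.
    have : f b u <= sup S.
      by apply: ub_le_sup; [exact: hS.2|exists b => //; split => //; exact: le_trans_op h].
    by move: h2; move: (n.+1%:R^-1) (f _ _) (sup S) (f _ _) => p q s r; lra.
  have [d d0|l hl] := @nsq_complete R H (fun n => a n u).
    have [|M hM] := @inv_small (d / (4 * k)); first by rewrite divr_gt0 // mulr_gt0.
    exists M => m n /hM hm /hM hn.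
    have [Dm _ _] := ha m; have [Dn _ _] := ha n.
    have [b [Db _ h1 h2]] := above _ _ Dm Dn.
    apply: le_lt_trans (nsq_tri (b u) _ _) _; rewrite (nsqBC (a m u)).
    have := near _ _ Db h1; have := near _ _ Db h2; move: hm hn.
    rewrite !ltr_pdivlMr ?mulr_gt0 //.
    by move: (m.+1%:R^-1) (n.+1%:R^-1) (nsq _) (nsq _) => p q P Q; nra.
  exists l => d d0; have [M1 h1] := hl (d / 4) (ltac:(lra)).
  have [|M2 h2] := @inv_small (d / (4 * k)); first by rewrite divr_gt0 // mulr_gt0.
  pose n := maxn M1 M2; have [Dn hn _] := ha n; exists (a n); split => // b Db hb.
  apply: le_lt_trans (nsq_tri (a n u) _ _) _.
  have := near _ _ Db hb; have := h1 n (leq_maxl _ _); have := h2 n (leq_maxr _ _).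
  rewrite !ltr_pdivlMr ?mulr_gt0 //.
  by move: (n.+1%:R^-1) (nsq _) (nsq _) => p P Q; nra.
have /choice[y hy] := key.
(* Three vectors are controlled at once, beyond any prescribed index: linearity of [y] involves its
   values at [u], [v] and [c *: u + v]. *)
have two u v w (d : R) : 0 < d -> forall a, D a -> exists b, [/\ D b, op_le a b & op_le a0 b] /\
    [/\ nsq (b u - y u) < d, nsq (b v - y v) < d & nsq (b w - y w) < d].
  move=> d0 a Da; have [a1 [D1 _ h1]] := hy u d d0; have [a2 [D2 _ h2]] := hy v d d0.
  have [a3 [D3 _ h3]] := hy w d d0.
  have [c1 [Dc1 _ q1 q2]] := above _ _ D1 D2; have [c2 [Dc2 _ q3 q4]] := above _ _ D3 Da.
  have [b [Db q5 q6 q7]] := above _ _ Dc1 Dc2.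
  exists b; split; split => //; first exact: le_trans_op q7.
  - by apply: h1 => //; exact: le_trans_op q6.
  - by apply: h2 => //; exact: le_trans_op q6.
  - by apply: h3 => //; exact: le_trans_op q7.
have ylin : linear y.
  move=> c u v; apply/eqP; rewrite -subr_eq0; apply/eqP/nsq_small_eq0 => d d0.
  have p : 0 < d / (8 * (sqmod c + 1)) by rewrite divr_gt0 // mulr_gt0 // ltr_wpDl // sqmod_ge0.
  have [b [[Db _ _] [h1 h2 h3]]] := two u v (c *: u + v) _ p _ Da0.
  apply: le_lt_trans (nsq_tri (b (c *: u + v)) _ _) _.
  rewrite (nsqBC (y _)) {2}(lin_D _ Db) opprD addrACA -scalerBr.
  have := nsqD_le (c *: (b u - y u)) (b v - y v); rewrite nsqZ.
  move: h1 h2 h3; rewrite !ltr_pdivlMr ?mulr_gt0 // ?ltr_wpDl ?sqmod_ge0 //.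
  move: (sqmod c) (sqmod_ge0 c) (nsq (b u - _)) (nsq_ge0 (b u - y u)) (nsq (b v - _)) (nsq_ge0 (b v - y v)).
  move: (nsq (b _ - _)) (nsq_ge0 (b (c *: u + v) - y (c *: u + v))) (nsq _).
  by move=> *; nra.
have yb : bounded_op y.
  have [c c0 hc] := bounded_nsq (Nb (DN Da0)).
  apply: (@nsq_bounded _ _ _ (4 * k ^+ 2 + 4 * c)) => // u.
  apply: (@ler_small _ _ 2) => // d d0.
  have [b [[Db _ h] [h1 _ _]]] := two u u u _ d0 _ Da0.
  have r0 : op_le a0 a0 by move=> z; rewrite subrr ip0l.
  have := nsqD_le (y u - b u) (b u); rewrite subrK (nsqBC (y u)).
  have := nsqD_le (b u - a0 u) (a0 u); rewrite subrK; have := hc u.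
  have := diff _ _ u Da0 Db r0 h.
  have : f b u - f a0 u <= k * nsq u.
    apply: le_trans (hk u); rewrite ipBl Defs.ReD Defs.ReN lerD2r; exact: mono _ _ u (xub _ Db).
  move: h1; move: (nsq _) (f b u - _) (nsq _) (nsq _) (nsq _) (nsq _) => A B C E F G.
  by rewrite expr2; nra.
have ysa : adjoint_pair y y.
  move=> u v; apply/eqP; rewrite -subr_eq0; apply/eqP.
  apply: (@small_eq0 _ _ (2 * nsq v + 2 * nsq u)) => d d0.
  have [b [[Db _ _] [h1 h2 _]]] := two u v v _ d0 _ Da0.
  have -> : ip (y u) v - ip u (y v) = - ip (b u - y u) v + ip u (b v - y v).
    by rewrite ipBl ipBr (Dsa Db); ring.
  apply: le_trans (sqmodD_le _ _) _; rewrite sqmodN [X in _ <= X]mulrDl.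
  rewrite lerD // -[X in _ <= X]mulrA ler_wpM2l //; apply: le_trans (CS _ _) _.
    by rewrite mulrC ler_wpM2l ?nsq_ge0 // ltW.
  by rewrite ler_wpM2l ?nsq_ge0 // ltW.
have yN : N y.
  apply: Nc => // u v d d0; have [b [[Db _ _] [h1 h2 _]]] := two u v v _ d0 _ Da0.
  by exists b; split; [exact: DN|rewrite nsqBC|rewrite nsqBC].
have yx : op_le x y.
  apply: xlub.2 => // a Da; apply/op_leP => //; first exact: Dsa.
  move=> u; apply/ler_addgt0Pr => d d0.
  have p : 0 < d ^+ 2 / (nsq u + 1) by rewrite divr_gt0 ?exprn_gt0 // ltr_wpDl // nsq_ge0.
  have [b [[Db h _] [h1 _ _]]] := two u u u _ p _ Da.
  apply: le_trans (mono _ _ u h) _; rewrite /f -lerBlDl -Defs.ReN -Defs.ReD -ipBl.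
  have := CSRe (b u - y u) u.
  move: h1; rewrite ltr_pdivlMr ?ltr_wpDl ?nsq_ge0 //.
  move: (nsq _) (nsq_ge0 (b u - y u)) (nsq u) (nsq_ge0 u) (Re _) => A A0 B B0 r h1 h2.
  rewrite leNgt; apply/negP => h3; move: h1 h2; rewrite !expr2; nra.
have p : 0 < (e / 2) ^+ 2 / (nsq xi + 1).
  by rewrite divr_gt0 ?exprn_gt0 ?divr_gt0 // ltr_wpDl // nsq_ge0.
have [b [[Db h _] [h1 _ _]]] := two xi xi xi _ p _ Da0.
exists b => //; apply: le_lt_trans (mono _ _ xi yx) _.
rewrite -ltrBlDl -Defs.ReN -Defs.ReD -ipBl.
have := CSRe (y xi - b xi) xi.
move: h1; rewrite ltr_pdivlMr ?ltr_wpDl ?nsq_ge0 // nsqBC.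
move: (nsq _) (nsq_ge0 (y xi - b xi)) (nsq xi) (nsq_ge0 xi) (Re _) => A A0 B B0 r g1 g2.
rewrite ltNge; apply/negP => g3; move: g1 g2; rewrite !expr2; nra.
Qed.
End Vigier.
End Limits.

Section ClosedSubspaces.
Variable R : realType.

Lemma adherent_closed (H : hilbert R) (P : set H) : P 0 ->
  (forall (k : R[i]) x y, P x -> P y -> P (k *: x + y)) -> closed_sub (adherent P).
Proof.
move=> P0 PP; split.
- by move=> e e0; exists 0 => //; rewrite subrr nsq0.
- move=> k x y hx hy e e0.
  have k1 : 0 < sqmod k + 1 by rewrite ltr_wpDl // sqmod_ge0.
  have p : 0 < e / (4 * (sqmod k + 1)) by rewrite divr_gt0 // mulr_gt0.
  have [u Pu xu] := hx _ p; have [v Pv yv] := hy _ p; exists (k *: u + v); first exact: PP.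
  rewrite opprD addrACA -scalerBr; apply: le_lt_trans (nsqD_le _ _) _; rewrite nsqZ.
  move: xu yv; rewrite !ltr_pdivlMr ?mulr_gt0 //.
  move: (sqmod k) (sqmod_ge0 k) (nsq (x - u)) (nsq_ge0 (x - u)) (nsq (y - v)) (nsq_ge0 (y - v)).
  by move=> *; nra.
- move=> x hx e e0; have [|y hy xy] := hx (e / 4); first by rewrite divr_gt0.
  have [|z Pz yz] := hy (e / 4); first by rewrite divr_gt0.
  exists z => //; apply: le_lt_trans (nsq_tri y x z) _.
  by move: (nsq _) (nsq _) xy yz => A B; lra.
Qed.

Lemma sub_adherent (H : hilbert R) (P : set H) : P `<=` adherent P.
Proof. by move=> x Px e e0; exists x => //; rewrite subrr nsq0. Qed.

Lemma eq_closed (H K : hilbert R) (f g : H -> K) (c d : R) : linear f -> linear g ->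
  (forall x, nsq (f x) <= c * nsq x) -> (forall x, nsq (g x) <= d * nsq x) ->
  closed_sub [set x | f x = g x].
Proof.
move=> lf lg hf hg; split => /=; first by rewrite (lin0 lf) (lin0 lg).
  by move=> k x y /= hx hy; rewrite lf lg hx hy.
move=> x hx; apply/eqP; rewrite -subr_eq0; apply/eqP/nsq_small_eq0 => e e0.
have h (a : R) : 0 < e / (4 * (`|a| + 1)) by rewrite divr_gt0 // mulr_gt0 // ltr_wpDl.
have [|y /= fg xy] := hx (Num.min (e / (4 * (`|c| + 1))) (e / (4 * (`|d| + 1)))).
  by rewrite lt_min !h.
apply: le_lt_trans (nsq_tri (f y) _ _) _; rewrite {2}fg -(linB lf) -(linB lg).
have := hf (x - y); have := hg (y - x); rewrite (nsqBC y).
move: xy; rewrite lt_min => /andP[]; rewrite !ltr_pdivlMr ?mulr_gt0 // ?ltr_wpDl //.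
have := ler_norm c; have := ler_norm d; move: `|c| (normr_ge0 c) `|d| (normr_ge0 d).
move: (nsq (f (x - y))) (nsq (g (y - x))) => B C m m0 n n0.
move: (nsq (x - y)) (nsq_ge0 (x - y)) => A A0 *.
have : c * A <= m * A by rewrite ler_wpM2r.
have : d * A <= n * A by rewrite ler_wpM2r.
nra.
Qed.

Lemma preim_closed (H K : hilbert R) (f : H -> K) (c : R) (E : set K) : linear f ->
  (forall x, nsq (f x) <= c * nsq x) -> closed_sub E -> closed_sub [set x | E (f x)].
Proof.
move=> lf hf cE; split => /=; first by rewrite (lin0 lf); exact: csub0.
  by move=> k x y /= hx hy; rewrite lf; exact: csubP.
move=> x hx; apply: (csub_cl cE) => e e0.
have [|y /= Ey xy] := hx (e / (`|c| + 1)); first by rewrite divr_gt0 // ltr_wpDl.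
exists (f y) => //; rewrite -(linB lf); apply: le_lt_trans (hf _) _.
move: xy; rewrite ltr_pdivlMr ?ltr_wpDl //; have := ler_norm c; move: `|c| (normr_ge0 c).
move: (nsq _) (nsq_ge0 (x - y)) => A A0 m m0 *.
have : c * A <= m * A by rewrite ler_wpM2r.
nra.
Qed.
End ClosedSubspaces.

(** * Abelian projections in type I algebras *)

Section Tensor.
Variables (R : realType) (I : choiceType) (K L T : hilbert R) (A : set (K -> K)).
Variables (e : I -> L) (t : K -> L -> T).
Hypotheses (vnA : von_neumann A) (abA : abelian_alg A).
Hypotheses (eo : orthonormal_basis e) (ht : hilbert_tensor t).

Local Notation S := [set c | @bounded_op R T c /\
    exists a b, [/\ A a, @bounded_op R L b & forall x y, c (t x y) = t (a x) (b y)]].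

Let t_ip x x' y y' : hdot T (t x y) (t x' y') = hdot K x x' * hdot L y y'.
Proof. by case: ht. Qed.
Let t_nsq x y : nsq (t x y) = nsq x * nsq y.
Proof. by rewrite /nsq t_ip !ipxxE /= mulr0 subr0. Qed.
Let tl y : linear (t ^~ y). Proof. by case: ht. Qed.
Let tr x : linear (t x). Proof. by case: ht. Qed.
Let ee i : hdot L (e i) (e i) = 1. Proof. by case: eo. Qed.
Let nsqe i : nsq (e i) = 1. Proof. by rewrite /nsq ee. Qed.
Let te_nsq x i : nsq (t x (e i)) = nsq x. Proof. by rewrite t_nsq nsqe mulr1. Qed.

Lemma sum_uniq_sub (V : nmodType) (s s' : seq I) (F : I -> V) : uniq s -> uniq s' ->
  {subset s <= s'} -> \sum_(i <- s') (if i \in s then F i else 0) = \sum_(i <- s) F i.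
Proof.
move=> us us' ss; rewrite -big_mkcond -big_filter; apply: perm_big.
apply: uniq_perm => //; first exact: filter_uniq.
by move=> i; rewrite mem_filter andbC; case: (boolP (i \in s)) => [/ss ->|]; rewrite ?andbF.
Qed.

Lemma nsq_sum_te (s : seq I) (X : I -> K) : uniq s ->
  nsq (\sum_(i <- s) t (X i) (e i)) = \sum_(i <- s) nsq (X i).
Proof.
elim: s => [|i s IHs] /=; first by rewrite !big_nil nsq0.
move=> /andP[ns us]; rewrite !big_cons nsqD IHs // te_nsq.
suff -> : hdot T (t (X i) (e i)) (\sum_(j <- s) t (X j) (e j)) = 0 by rewrite /= mulr0 addr0.
rewrite linear_sumr /= big_seq big1 // => j js.
rewrite t_ip (_ : hdot L (e i) (e j) = 0) ?mulr0 //.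
by case: eo => _ h _; apply: h => ij; move: ns; rewrite ij js.
Qed.

Lemma tensor_ind (E : set T) : closed_sub E -> (forall x i, E (t x (e i))) -> forall u, E u.
Proof.
move=> cE hE; apply: dense_ind (cE) _; first by case: ht => _ _ _; exact.
move=> _ [x _ [y _ <-]]; have [_ _ de] := eo.
have : closed_sub [set y | E (t x y)].
  by apply: (@preim_closed _ _ _ _ (nsq x)) => // z; rewrite t_nsq.
by move=> /(dense_ind de); apply => _ [i _ <-]; exact: hE.
Qed.

(** The operator [b (x) 1] is defined on finite sums of vectors [t (X i) (e i)]. These summands are
    orthogonal, so the bound of [b] holds for each coordinate and is inherited by the sum;
    [extension] does the rest. *)
Lemma tensor_id_op (b : K -> K) : bounded_op b ->
  exists2 B : T -> T, bounded_op B & forall x y, B (t x y) = t (b x) y.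
Proof.
move=> bb; have lb := bop_lin bb; have [c c0 hc] := bounded_nsq bb.
pose D u v := exists s X, [/\ uniq s, u = \sum_(i <- s) t (X i) (e i)
  & v = \sum_(i <- s) t (b (X i)) (e i)].
have DP k u v u' v' : D u v -> D u' v' -> D (k *: u + u') (k *: v + v').
  move=> [s [X [us -> ->]]] [s' [X' [us' -> ->]]].
  pose Y i := k *: (if i \in s then X i else 0) + (if i \in s' then X' i else 0).
  exists (undup (s ++ s')), Y; split; first exact: undup_uniq.
    rewrite scaler_sumr -(@sum_uniq_sub _ s (undup (s ++ s'))) ?undup_uniq //; last first.
      by move=> i si; rewrite mem_undup mem_cat si.
    rewrite -(@sum_uniq_sub _ s' (undup (s ++ s'))) ?undup_uniq //; last first.
      by move=> i si; rewrite mem_undup mem_cat si orbT.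
    rewrite -big_split; apply: eq_bigr => i _ /=; rewrite /Y (tl (e i)); congr (_ + _).
      by case: ifP => // _; rewrite (lin0 (tl (e i))) scaler0.
    by case: ifP => // _; rewrite (lin0 (tl (e i))).
  rewrite scaler_sumr -(@sum_uniq_sub _ s (undup (s ++ s'))) ?undup_uniq //; last first.
    by move=> i si; rewrite mem_undup mem_cat si.
  rewrite -(@sum_uniq_sub _ s' (undup (s ++ s'))) ?undup_uniq //; last first.
    by move=> i si; rewrite mem_undup mem_cat si orbT.
  rewrite -big_split; apply: eq_bigr => i _ /=; rewrite /Y lb (tl (e i)); congr (_ + _).
    by case: ifP => // _; rewrite (lin0 lb) (lin0 (tl (e i))) scaler0.
  by case: ifP => // _; rewrite (lin0 lb) (lin0 (tl (e i))).
have Dc u v : D u v -> nsq v <= c * nsq u.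
  by move=> [s [X [us -> ->]]]; rewrite !nsq_sum_te // mulr_sumr; apply: ler_sum.
have De x i : D (t x (e i)) (t (b x) (e i)).
  by exists [:: i], (fun=> x); split; rewrite ?big_seq1.
have Dd (x : T) (d : R) : 0 < d -> exists u v, D u v /\ nsq (x - u) < d.
  move=> d0; pose P := [set u | exists v, D u v].
  have : closed_sub (adherent P).
    apply: adherent_closed.
      by exists 0, [::], (fun=> 0); split; rewrite ?big_nil.
    by move=> k y z [v hv] [v' hv']; exists (k *: v + v'); exact: DP.
  move=> /tensor_ind/(_ _ x d d0)[|u [v Duv] xu]; last by exists u, v.
  by move=> y i; apply: sub_adherent; exists (t (b y) (e i)).
have [B [lB hB BD]] := extension (ltW c0) DP Dc Dd.
exists B; first exact: nsq_bounded lB hB.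
move=> x y; have [_ _ de] := eo.
have : closed_sub [set y | B (t x y) = t (b x) y].
  apply: (@eq_closed _ _ _ _ _ (4 * c * nsq x) (nsq (b x))) => //.
  - by move=> k u v; rewrite (tr x) lB.
  - by move=> z; apply: le_trans (hB _) _; rewrite t_nsq mulrA.
  - by move=> z; rewrite t_nsq.
by move=> /(dense_ind de); apply => _ [i _ <-] /=; exact/BD/De.
Qed.

Lemma tensor_id_commutant (b : K -> K) (B : T -> T) : commutant A b -> bounded_op B ->
  (forall x y, B (t x y) = t (b x) y) -> commutant S B.
Proof.
move=> cb bB hB; apply: comm_intro => // s u [bs [a [b' [Aa bb' sab]]]].
have [c c0 hc] := bounded_nsq bB; have [d d0 hd] := bounded_nsq bs.
have : closed_sub [set u | s (B u) = B (s u)].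
  apply: (@eq_closed _ _ _ _ _ (d * c) (c * d)).
  - by move=> k x y; rewrite (bop_lin bB) (bop_lin bs).
  - by move=> k x y; rewrite (bop_lin bs) (bop_lin bB).
  - by move=> x; apply: le_trans (hd _) _; rewrite -mulrA ler_wpM2l // ltW.
  - by move=> x; apply: le_trans (hc _) _; rewrite -mulrA ler_wpM2l // ltW.
move=> /tensor_ind; apply => x i /=.
by rewrite hB !sab hB (commE _ cb).
Qed.

Variable i0 : I.

Let E := [set u : T | exists x, u = t x (e i0)].

Let cE : closed_sub E.
Proof.
split; first by exists 0; rewrite (lin0 (tl _)).
  by move=> k _ _ [x ->] [y ->]; exists (k *: x + y); rewrite (tl _).
move=> u hu.
have /choice[x hx] n : exists x, nsq (u - t x (e i0)) < n.+1%:R^-1.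
  by have [_ [x ->] h] := hu _ (inv_pos R n); exists x.
have [d d0|l hl] := @nsq_complete R K x.
  have [|N hN] := @inv_small _ (d / 4); first by rewrite divr_gt0.
  exists N => m n /hN hm /hN hn; rewrite -(te_nsq _ i0) (linB (tl (e i0))).
  apply: le_lt_trans (nsq_tri u _ _) _; rewrite (nsqBC _ u).
  have := hx m; have := hx n; move: hm hn.
  by move: (m.+1%:R^-1) (n.+1%:R^-1) (nsq _) (nsq _) => *; lra.
exists l; apply/eqP; rewrite -subr_eq0; apply/eqP/nsq_small_eq0 => d d0.
have [|N1 h1] := @inv_small _ (d / 4); first by rewrite divr_gt0.
have [|N2 h2] := hl (d / 4); first by rewrite divr_gt0.
pose n := maxn N1 N2; apply: le_lt_trans (nsq_tri (t (x n) (e i0)) _ _) _.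
rewrite -(linB (tl (e i0))) te_nsq.
have := hx n; have := h1 n (leq_maxl _ _); have := h2 n (leq_maxr _ _).
by move: (n.+1%:R^-1) (nsq _) (nsq _) => *; lra.
Qed.

Let c := oproj E.

Let c_t x y : c (t x y) = t (hdot L y (e i0) *: x) (e i0).
Proof.
apply: proj_uniq => //; first by eexists.
move=> _ [z ->]; rewrite ipBl !t_ip ipZl ee; ring.
Qed.

Let c_S : S c.
Proof.
split; first exact: proj_bounded.
exists id, (fun y => hdot L y (e i0) *: e i0); split.
- by case: vnA => _ _ <-; exact: comm_id.
- apply: (@nsq_bounded _ _ _ 1) => [k y z|y].
    by rewrite ipDl ipZl scalerDl scalerA.
  by rewrite nsqZ mul1r nsqe mulr1; have := CS y (e i0); rewrite nsqe mulr1.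
- by move=> x y; rewrite c_t (linZ (tr x)) (linZ (tl (e i0))).
Qed.

(** The compression by [c] acts on the copy [E] of [K] through some [w]. For [b] in the commutant of
    [A], the operator [b (x) 1] commutes with [n] and with [c], so [w] commutes with [b], and the
    bicommutant property puts [w] in [A]. *)
Let corner_op n : vn_tensor t A (@bounded_op R L) n ->
  exists2 w, A w & forall x, c (n (t x (e i0))) = t (w x) (e i0).
Proof.
move=> Nn; have bn := comm_bounded Nn; have [d d0 hd] := bounded_nsq bn.
have /choice[w hw] x : exists y, c (n (t x (e i0))) = t y (e i0) by exact: projE cE _.
have tinj x y : t x (e i0) = t y (e i0) -> x = y.
  move=> h; apply/eqP; rewrite -subr_eq0; apply/eqP/nsq_eq0.
  by rewrite -(te_nsq _ i0) (linB (tl (e i0))) h subrr nsq0.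
exists w => //; have [Ab _ <-] := vnA.
apply: comm_intro.
  apply: (@nsq_bounded _ _ _ d) => [k x y|x].
    apply: tinj; rewrite -hw [in RHS](tl (e i0)) -!hw (tl (e i0)) (bop_lin bn).
    exact: proj_linear cE _ _ _.
  by rewrite -(te_nsq _ i0) -hw; apply: le_trans (proj_contr cE _) _; rewrite -(te_nsq x i0).
move=> b x cb; have bb := comm_bounded cb; have [B bB hB] := tensor_id_op bb.
have cB := tensor_id_commutant cb bB hB.
by apply: tinj; rewrite -hB -!hw -(commE _ cB c_S) -hB (commE _ Nn cB).
Qed.

(* The projection [c] is [1 (x) p], with [p] the projection onto the line of [e i0]. *)
Lemma tensor_abelian_projection : exists c : T -> T,
  [/\ vn_tensor t A (@bounded_op R L) c, c \o c = c, (exists x : K, x <> 0) -> c <> @op_zero R T,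
     forall n1 n2, vn_tensor t A (@bounded_op R L) n1 -> vn_tensor t A (@bounded_op R L) n2 ->
       c \o n1 \o c \o n2 \o c = c \o n2 \o c \o n1 \o c
   & forall x, nsq (c x) <= nsq x].
Proof.
exists c; split.
- by apply: sub_bicommutant c_S => s [].
- by apply/funext => u /=; exact: proj_idem.
- move=> [x x0] c_0; apply: x0; apply: nsq_eq0; rewrite -(te_nsq x i0).
  have -> : t x (e i0) = c (t x (e i0)) by rewrite c_t ee scale1r.
  by rewrite c_0 nsq0.
- move=> n1 n2 /corner_op[w1 A1 h1] /corner_op[w2 A2 h2]; apply/funext => u /=.
  have [x ->] : E (c u) by exact: projE cE _.
  by rewrite h2 h1 h1 h2; have /(congr1 (@^~ x))/= -> := abA A1 A2.
- by move=> x; exact: proj_contr.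
Qed.
End Tensor.

Section TypeI.
Variables (R : realType) (H : hilbert R) (N : set (H -> H)).
Hypothesis Ncomp : forall a b, N a -> N b -> N (a \o b).
Hypothesis Nlc : forall (k : R[i]) a b, N a -> N b -> N (fun x => k *: a x + b x).

(** Each component contains an idempotent with abelian compression: that of
    [tensor_abelian_projection], or 0 when the index type is empty. All of them are contractions, so
    the family belongs to the product algebra and has a preimage under [phi]. *)
Lemma typeI_abelian_idempotent : typeI N -> (exists2 a, N a & a <> @op_zero R H) ->
  exists e, [/\ N e, e \o e = e, e <> @op_zero R H
    & forall x y, N x -> N y -> e \o x \o e \o y \o e = e \o y \o e \o x \o e].
Proof.
move=> [J [I [K [L [T [A [e [t [phi [_ hA he ht hphi]]]]]]]]]] [a Na a0].
have [[phiN phi_inj phi_surj] phi_lc phi_comp _] := hphi.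
pose N' j := vn_tensor (t j) (A j) (@bounded_op R (L j)).
have hex j : exists c : T j -> T j,
  [/\ N' j c, c \o c = c, (exists x : T j, x <> 0) -> c <> @op_zero R (T j),
     forall n1 n2, N' j n1 -> N' j n2 ->
       c \o n1 \o c \o n2 \o c = c \o n2 \o c \o n1 \o c
   & forall x, nsq (c x) <= nsq x].
  have [vA aA] := hA j.
  have [i|] := pselect (inhabited (I j)).
    have [i1] := i.
    have [c [c1 c2 c3 c4 c5]] :=
      @tensor_abelian_projection R {classic (I j)} _ _ _ _ _ _ vA aA (he j) (ht j) i1.
    exists c; split => // -[u u0]; apply: c3; apply: contrapT => hK; apply: u0.
    apply: (@tensor_ind R {classic (I j)} _ _ _ _ _ (he j) (ht j) [set 0]) => [|x i' /=].
      split => //= [k x y -> ->|x hx]; first by rewrite scaler0 addr0.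
      by apply: nsq_small_eq0 => d /hx[y ->]; rewrite subr0.
    have -> : x = 0 by apply: contrapT => x0; apply: hK; exists x.
    by case: (ht j) => /(_ (e j i'))/lin0.
  move=> noI; exists (@op_zero R (T j)); split => //.
  - by apply: comm_zero => s [].
  - move=> [u u0]; exfalso; apply: u0.
    apply: (@tensor_ind R {classic (I j)} _ _ _ _ _ (he j) (ht j) [set 0]) => [|x i' /=].
      split => //= [k x y -> ->|x hx]; first by rewrite scaler0 addr0.
      by apply: nsq_small_eq0 => d /hx[y ->]; rewrite subr0.
    by exfalso; apply: noI.
  - by move=> x; rewrite nsq0 nsq_ge0.
pose c j := projT1 (cid (hex j)); have hc j := projT2 (cid (hex j)); rewrite -/(c _) in hc.
have [] := phi_surj c.
  split=> [j|]; first by case: (hc j).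
  exists 1 => j x; rewrite mul1r !hnormE ler_wsqrtr //.
  by have [_ _ _ _] := hc j; exact.
move=> f Nf phif.
have dext (g h : forall j, T j -> T j) : (forall j, g j = h j) -> g = h.
  by move=> gh; apply: functional_extensionality_dep.
have inj x y : N x -> N y -> phi x = phi y -> x = y.
  by move=> Nx Ny; apply: phi_inj; exact: mem_set.
have Nz : N (@op_zero R H).
  have := Nlc (-1) Na Na; congr N; apply/funext => x.
  by rewrite scaleN1r addNr.
have phi0 j : phi (@op_zero R H) j = @op_zero R (T j).
  have -> : @op_zero R H = (fun x => -1 *: a x + a x).
    by apply/funext => x; rewrite scaleN1r addNr.
  by rewrite phi_lc //; apply/funext => x; rewrite scaleN1r addNr.
exists f; split => //.
- apply: inj => //; first exact: Ncomp.
  by apply: dext => j; rewrite phi_comp // phif; case: (hc j).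
(* Since [a] is not 0, some [phi a j] has a non-zero value, so [T j] is not the zero space and [c j]
   cannot vanish. *)
- move=> f0; apply: a0; apply: inj => //; apply: dext => j; rewrite phi0.
  apply/funext => x; apply: contrapT => ax.
  have [_ _ h _ _] := hc j; apply: h; first by exists (phi a j x).
  by rewrite -[LHS]/(c j) -phif f0 phi0.
- move=> x y Nx Ny.
  have N2 u (Nu : N u) := Ncomp Nf Nu; have N3 u (Nu : N u) := Ncomp (N2 u Nu) Nf.
  have N4 u v (Nu : N u) (Nv : N v) := Ncomp (N3 u Nu) Nv.
  have phi5 u v j : N u -> N v -> phi (f \o u \o f \o v \o f) j =
      c j \o phi u j \o c j \o phi v j \o c j.
    move=> Nu Nv; rewrite (phi_comp _ _ _ (N4 u v Nu Nv) Nf).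
    rewrite (phi_comp _ _ _ (N3 u Nu) Nv) (phi_comp _ _ _ (N2 u Nu) Nf).
    by rewrite (phi_comp _ _ _ Nf Nu) phif.
  apply: inj; [exact: Ncomp (N4 x y Nx Ny) Nf|exact: Ncomp (N4 y x Ny Nx) Nf|].
  apply: dext => j; rewrite !phi5 //; have [_ _ _ h _] := hc j; apply: h.
    exact: (phiN _ Nx).1.
  exact: (phiN _ Ny).1.
Qed.
End TypeI.

Section Misc.
Variables (R : realType) (H : hilbert R).
Local Notation ip := (hdot H).
Implicit Types (x y z : H).

Lemma orth_closed (w : H) : closed_sub [set x | ip x w = 0].
Proof.
split=> /= [|a x y /= hx hy|x hx]; first by rewrite ip0l.
  by rewrite ipDl ipZl hx hy mulr0 addr0.
apply: (@small_eq0 _ _ (nsq w)) => e /hx[y /= yw xy].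
rewrite -[x](subrK y) ipDl yw addr0; apply: le_trans (CS _ _) _.
by rewrite mulrC ler_wpM2l ?nsq_ge0 // ltW.
Qed.

Lemma realC_conj (r : R) : Num.conj r%:C%C = r%:C%C :> R[i].
Proof. by apply: complex_eq; rewrite ?Defs.ReJ ?Defs.ImJ //= oppr0. Qed.

Lemma conjM (a b : R[i]) : Num.conj (a * b) = Num.conj a * Num.conj b.
Proof. exact: rmorphM. Qed.

Lemma natrC (n : nat) : (n%:R : R[i]) = (n%:R : R)%:C%C.
Proof. by rewrite rmorph_nat. Qed.
Lemma natrVC (n : nat) : (n%:R : R[i])^-1 = (n%:R^-1 : R)%:C%C.
Proof. by rewrite natrC fmorphV. Qed.

Lemma ler_sum_mem (T : eqType) (r : seq T) (F : T -> R) (x : T) : x \in r ->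
  (forall y : T, y \in r -> 0 <= F y) -> F x <= \sum_(y <- r) F y.
Proof.
elim: r => // y r IHr; rewrite inE big_cons => /orP[/eqP -> h|xr h].
  rewrite lerDl big_seq sumr_ge0 // => z zr; apply: h; rewrite inE zr orbT //.
apply: le_trans (IHr xr _) _; first by move=> z zr; apply: h; rewrite inE zr orbT.
by rewrite lerDr h // mem_head.
Qed.

Lemma Re_sum (T : Type) (r : seq T) (F : T -> R[i]) :
  Re (\sum_(y <- r) F y) = \sum_(y <- r) Re (F y).
Proof. by elim: r => [|y r IHr]; rewrite ?big_nil // !big_cons Defs.ReD IHr. Qed.

End Misc.

(** * Unitary representations and reflections *)

Section UnitaryReps.
Variables (R : realType) (G : groupType) (H : hilbert R).
Local Notation ip := (hdot H).
Implicit Types (s : G -> H -> H) (Q : set G) (g h : G) (x y : H).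

Definition urep s := [/\ forall g, linear (s g), forall g x y, ip (s g x) (s g y) = ip x y,
  s 1%g = id & forall g h, s (g * h)%g = s g \o s h].

Definition fixed s Q : set H := [set x | forall h, Q h -> s h x = x].
Definition fixp s Q : H -> H := oproj (fixed s Q).

Section OneRep.
Variable s : G -> H -> H.
Hypothesis us : urep s.

Lemma ulin g : linear (s g). Proof. by case: us. Qed.
Lemma uip g x y : ip (s g x) (s g y) = ip x y. Proof. by case: us. Qed.
Lemma unsq g x : nsq (s g x) = nsq x. Proof. by rewrite /nsq uip. Qed.
Lemma u1 x : s 1%g x = x. Proof. by case: us => _ _ ->. Qed.
Lemma uM g h x : s (g * h)%g x = s g (s h x). Proof. by case: us => _ _ _ ->. Qed.
Lemma uVK g x : s g^-1%g (s g x) = x. Proof. by rewrite -uM mulVg u1. Qed.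
Lemma uKV g x : s g (s g^-1%g x) = x. Proof. by rewrite -uM mulgV u1. Qed.
Lemma uadj g : adjoint_pair (s g) (s g^-1%g).
Proof. by move=> x y; rewrite -[in LHS](uKV g y) uip. Qed.
Lemma ubop g : bounded_op (s g).
Proof. by apply: (@nsq_bounded _ _ _ 1 (@ulin g)) => x; rewrite unsq mul1r. Qed.

Lemma fixed_closed Q : closed_sub (fixed s Q).
Proof.
split=> [h _|a x y hx hy h Qh|x hx h Qh].
- exact: lin0 (@ulin h).
- by rewrite (ulin h) hx // hy.
- apply/eqP; rewrite -subr_eq0; apply/eqP/nsq_small_eq0 => e e0.
  have [|y /(_ h Qh) hy xy] := hx (e / 4); first by rewrite divr_gt0.
  apply: le_lt_trans (nsq_tri y _ _) _.
  rewrite -{1}hy -(linB (ulin h)) unsq (nsqBC y).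
  by move: (nsq _) xy => A; lra.
Qed.

Lemma fixp_bop Q : bounded_op (fixp s Q). Proof. exact/proj_bounded/fixed_closed. Qed.
Lemma fixp_lin Q : linear (fixp s Q). Proof. exact: bop_lin (@fixp_bop Q). Qed.
Lemma fixp_in Q x : fixed s Q (fixp s Q x). Proof. exact: (projE (@fixed_closed Q)). Qed.
Lemma fixp_id Q x : fixed s Q x -> fixp s Q x = x.
Proof. exact: (proj_id (@fixed_closed Q)). Qed.
Lemma fixp_sa Q x y : ip (fixp s Q x) y = ip x (fixp s Q y).
Proof. exact: (proj_sa (@fixed_closed Q)). Qed.
Lemma fixp_idem Q x : fixp s Q (fixp s Q x) = fixp s Q x.
Proof. exact/fixp_id/fixp_in. Qed.
Lemma fixp_contr Q x : nsq (fixp s Q x) <= nsq x.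
Proof. exact: (proj_contr (@fixed_closed Q)). Qed.
Lemma fixp_ip Q x y : fixed s Q y -> ip (fixp s Q x) y = ip x y.
Proof. exact: (proj_ip (@fixed_closed Q)). Qed.

Definition gsub Q := [/\ Q 1%g, forall g h, Q g -> Q h -> Q (g * h)%g & forall g, Q g -> Q g^-1%g].

Lemma fixp_absorb Q h x : gsub Q -> Q h -> fixp s Q (s h x) = fixp s Q x.
Proof.
move=> [_ _ QV] Qh; apply: ip_ext => z; rewrite !fixp_sa uadj.
by rewrite (fixp_in z (QV _ Qh)).
Qed.

Lemma fixp_conj Q Q' a a' x : bounded_op a -> adjoint_pair a a' ->
  (forall y, fixed s Q y -> fixed s Q' (a y)) -> (forall y, fixed s Q' y -> fixed s Q (a' y)) ->
  a (fixp s Q x) = fixp s Q' (a x).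
Proof.
move=> ba aa' h h'; apply: ip_ext => z.
apply/esym; rewrite fixp_sa aa' -(fixp_ip x (h' _ (fixp_in z))) -aa' -fixp_sa.
by rewrite fixp_id //; apply: h; exact: fixp_in.
Qed.

Lemma fixp_norm Q Q' g x : (forall h, Q' h -> Q (g^-1 * h * g)%g) ->
  (forall h, Q h -> Q' (g * h * g^-1)%g) -> s g (fixp s Q x) = fixp s Q' (s g x).
Proof.
move=> h1 h2; apply: (fixp_conj _ (ubop g) (uadj g)) => y hy h Qh.
  rewrite -{2}(hy _ (h1 _ Qh)) -!uM.
  by congr (s _ y); rewrite !mulgA mulgV mul1g.
rewrite -{2}(hy _ (h2 _ Qh)) -!uM.
by congr (s _ y); rewrite !mulgA mulVg mul1g.
Qed.

Lemma fixp_commute Q a a' x : gsub Q -> bounded_op a -> adjoint_pair a a' ->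
  (forall h y, Q h -> a (s h y) = s h (a y)) -> a (fixp s Q x) = fixp s Q (a x).
Proof.
move=> [_ _ QV] ba aa' h; apply: (fixp_conj _ ba aa') => y hy k Qk.
  by rewrite -h // hy.
apply: ip_ext => z; rewrite uadj (adjoint_sym aa') h; last exact: QV.
by rewrite -uadj hy // (adjoint_sym aa').
Qed.

Lemma fixp_comm_ops Q x (a : H -> H) : gsub Q -> bounded_op a ->
  (forall h y, Q h -> a (s h y) = s h (a y)) -> a (fixp s Q x) = fixp s Q (a x).
Proof. by move=> gQ ba; apply: fixp_commute (ba) _ => //; exact: adj_pair. Qed.

Lemma fixp_ucomm Q g x : gsub Q -> (forall h, Q h -> (g * h)%g = (h * g)%g) ->
  s g (fixp s Q x) = fixp s Q (s g x).
Proof.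
move=> gQ h; apply: fixp_comm_ops => //; first exact: ubop.
by move=> k y /h e; rewrite -!uM e.
Qed.

Lemma fixp_fixp_comm Q Q' x : gsub Q -> gsub Q' ->
  (forall g h, Q g -> Q' h -> (g * h)%g = (h * g)%g) ->
  fixp s Q (fixp s Q' x) = fixp s Q' (fixp s Q x).
Proof.
move=> gQ gQ' h; apply: fixp_comm_ops => //; first exact: fixp_bop.
move=> k y Qk; apply/esym/fixp_ucomm => // g Qg; apply/esym; exact: h.
Qed.

(** The closed linear span of the [Q]-orbit of [x], described as the closure of what all closed
    subspaces containing the orbit have in common, which gives the induction principle
    [orbit_span_ind] at once. *)
Definition orbit_span Q x : set H :=
  adherent [set y | forall E, closed_sub E -> (forall h, Q h -> E (s h x)) -> E y].

Lemma orbit_span_closed Q x : closed_sub (orbit_span Q x).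
Proof.
apply: adherent_closed => [E cE _|k y z hy hz E cE hE]; first exact: csub0.
by apply: csubP => //; [exact: hy|exact: hz].
Qed.

Lemma orbit_span_in Q x h : Q h -> orbit_span Q x (s h x).
Proof. by move=> Qh; apply: sub_adherent => E _; apply. Qed.

Lemma orbit_span_ind Q x E : closed_sub E -> (forall h, Q h -> E (s h x)) -> orbit_span Q x `<=` E.
Proof.
move=> cE hE y hy; apply: (csub_cl cE) => e e0; have [z hz yz] := hy e e0.
by exists z => //; exact: hz.
Qed.

Lemma orbit_span_inv Q x g y : (forall h, Q h -> Q (g * h)%g) ->
  orbit_span Q x y -> orbit_span Q x (s g y).
Proof.
move=> h; move: y; apply: (@orbit_span_ind Q x [set y | orbit_span Q x (s g y)]).
  apply: (@preim_closed _ _ _ (s g) 1 _ (ulin g)); last exact: orbit_span_closed.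
  by move=> z; rewrite unsq mul1r.
by move=> k Qk /=; rewrite -uM; apply: orbit_span_in; exact: h.
Qed.

(** The projection onto the invariant subspace [E] commutes with the action of [Q], hence with the
    projection onto the fixed vectors. *)
Lemma fixp_inv Q E x : gsub Q -> closed_sub E -> (forall h y, Q h -> E y -> E (s h y)) ->
  E x -> E (fixp s Q x).
Proof.
move=> gQ cE hE Ex; have [_ _ QV] := gQ; rewrite -(proj_id cE Ex).
have -> : fixp s Q (oproj E x) = oproj E (fixp s Q x); last exact: projE.
apply/esym; apply: (fixp_comm_ops _ gQ (proj_bounded cE)) => h y Qh.
apply/esym; apply: (proj_comm cE (@ulin h) (uadj h)) => z Ez; apply: hE => //; exact: QV.
Qed.

(* Averaging over the group [Q] reduces to averaging over a finite orbit as soon as the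
   action on [eta] depends only on a parameter in a finite type. *)
Lemma fixp_orbit Q eta (F : finType) (delta : G -> F) : gsub Q ->
  (forall h h', Q h -> Q h' -> delta h = delta h' -> s h eta = s h' eta) ->
  exists o : seq H, [/\ (size o <= #|F|)%N, forall h, Q h -> s h eta \in o,
    forall y, y \in o -> exists2 h, Q h & y = s h eta
  & fixp s Q eta = ((size o)%:R)^-1 *: \sum_(y <- o) y].
Proof.
move=> [Q1 QM QV] hd.
pose P f := `[< exists2 h, Q h & delta h = f >].
pose r f := xget 1%g [set h | Q h /\ delta h = f].
have rP f : P f -> Q (r f) /\ delta (r f) = f.
  move=> /asboolP[h Qh hf]; rewrite /r; case: xgetP => [_ -> //|/(_ h)[]//].
pose o := undup [seq s (r f) eta | f <- enum F & P f].
have o1 h : Q h -> s h eta \in o.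
  move=> Qh; have Pd : P (delta h) by apply/asboolP; exists h.
  have [Qr dr] := rP _ Pd; rewrite mem_undup; apply/mapP; exists (delta h).
    by rewrite mem_filter Pd mem_enum.
  by apply: hd.
have o2 y : y \in o -> exists2 h, Q h & y = s h eta.
  by rewrite mem_undup => /mapP[f]; rewrite mem_filter => /andP[/rP[Qr _] _] ->; exists (r f).
have uo : uniq o := undup_uniq _.
have o0 : (0 < size o)%N by have := o1 _ Q1; case: (o).
exists o; split => //.
  apply: leq_trans (size_undup _) _; rewrite size_map size_filter cardE.
  exact: count_size.
apply: (proj_uniq (@fixed_closed Q)) => [h Qh|y yf].
  rewrite (linZ (ulin h)) (lin_sum (ulin h)); congr (_ *: _).
  rewrite -(big_map (s h) xpredT id); apply: perm_big; apply: uniq_perm => //.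
    by rewrite map_inj_uniq // => x z e; rewrite -(uVK h x) e uVK.
  move=> z; apply/mapP/idP => [[x /o2[g Qg ->] ->]|/o2[g Qg ->]].
    by rewrite -uM; apply/o1/QM.
  exists (s (h^-1 * g)%g eta); first by apply/o1/QM => //; exact: QV.
  by rewrite -uM mulgA mulgV mul1g.
have e z : z \in o -> ip z y = ip eta y.
  by move=> /o2[h Qh ->]; rewrite uadj yf //; exact: QV.
rewrite ipBl ipZl linear_sumlz /=.
rewrite (eq_big_seq (fun=> ip eta y)); last by move=> z /e.
have -> : \sum_(i <- o) ip eta y = (size o)%:R * ip eta y.
  by rewrite big_const_seq count_predT iter_addr_0 mulr_natl.
rewrite mulrA mulVf ?mul1r ?subrr //.
by rewrite pnatr_eq0 -lt0n.
Qed.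

Definition refl Q x : H := x - (fixp s Q x + fixp s Q x).

Lemma refl_lin Q : linear (refl Q).
Proof.
move=> a x y; rewrite /refl (fixp_lin Q a x y).
set p := fixp s Q x; set q := fixp s Q y.
by rewrite scalerBr scalerDr addrACA opprD (addrACA (a *: x)).
Qed.
Lemma refl_ip Q x y : ip (refl Q x) (refl Q y) = ip x y.
Proof.
have e : ip (fixp s Q x) (fixp s Q y) = ip x (fixp s Q y) by rewrite fixp_sa fixp_idem.
by rewrite /refl !(ipBl, ipBr, ipDl, ipDr) e (fixp_sa Q x y); ring.
Qed.
Lemma refl_nsq Q x : nsq (refl Q x) = nsq x. Proof. by rewrite /nsq refl_ip. Qed.
Lemma refl_bop Q : bounded_op (refl Q).
Proof. by apply: (@nsq_bounded _ _ _ 1 (@refl_lin Q)) => x; rewrite refl_nsq mul1r. Qed.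

Lemma refl_commute Q (a : H -> H) x : linear a -> (forall y, a (fixp s Q y) = fixp s Q (a y)) ->
  a (refl Q x) = refl Q (a x).
Proof. by move=> la h; rewrite /refl (linB la) (linD la) h. Qed.

Lemma refl_refl_comm Q Q' x : gsub Q -> gsub Q' ->
  (forall g h, Q g -> Q' h -> (g * h)%g = (h * g)%g) -> refl Q (refl Q' x) = refl Q' (refl Q x).
Proof.
move=> gQ gQ' h; apply: refl_commute; first exact: refl_lin.
move=> y; apply/esym; apply: refl_commute; first exact: fixp_lin.
by move=> z; apply/esym; exact: fixp_fixp_comm.
Qed.

Lemma refl_inv Q E x : gsub Q -> closed_sub E -> (forall h y, Q h -> E y -> E (s h y)) ->
  E x -> E (refl Q x).
Proof.
move=> gQ cE hE Ex; have Ep := fixp_inv gQ cE hE Ex.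
by apply: csubB => //; exact: csubD.
Qed.

Section Products.
Variables (V : eqType) (Q : V -> set G).

Definition prodr (l : seq V) : H -> H := foldr (fun v f => refl (Q v) \o f) id l.

Lemma prodr_lin l : linear (prodr l).
Proof. by elim: l => //= v l IHl a x y; rewrite /= IHl refl_lin. Qed.
Lemma prodr_nsq l x : nsq (prodr l x) = nsq x.
Proof. by elim: l => //= v l IHl; rewrite refl_nsq. Qed.
Lemma prodr_bop l : bounded_op (prodr l).
Proof. by apply: (@nsq_bounded _ _ _ 1 (@prodr_lin l)) => x; rewrite prodr_nsq mul1r. Qed.
Lemma prodr_commute (a : H -> H) l x : (forall v y, v \in l -> a (refl (Q v) y) = refl (Q v) (a y)) ->
  a (prodr l x) = prodr l (a x).
Proof.
elim: l => //= v l IHl h; rewrite h ?mem_head // IHl // => w y wl.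
by rewrite h // inE wl orbT.
Qed.
Lemma prodr_inv (E : set H) l x : closed_sub E -> (forall v, v \in l -> gsub (Q v)) ->
  (forall v h y, v \in l -> Q v h -> E y -> E (s h y)) -> E x -> E (prodr l x).
Proof.
move=> cE; elim: l => //= v l IHl gQ hE Ex; apply: refl_inv => //.
- by apply: gQ; rewrite mem_head.
- by move=> h y; apply: hE; rewrite mem_head.
- apply: IHl => // [w wl|w h y wl]; [apply: gQ|apply: hE]; by rewrite inE wl orbT.
Qed.
Lemma prodr_cat l l' x : prodr (l ++ l') x = prodr l (prodr l' x).
Proof. by elim: l => //= v l ->. Qed.

Lemma prodr_perm l l' x : (forall v w y, v \in l -> w \in l ->
    refl (Q v) (refl (Q w) y) = refl (Q w) (refl (Q v) y)) ->
  perm_eq l l' -> prodr l x = prodr l' x.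
Proof.
move=> h; elim: l l' h x => [|v l IHl] l' h x pl.
  by move: pl; rewrite perm_sym => /perm_nilP ->.
have vl' : v \in l' by rewrite -(perm_mem pl) mem_head.
case/splitPr: vl' pl => l1 l2 pl.
have pl2 : perm_eq l (l1 ++ l2).
  by rewrite -(perm_cons v); apply: perm_trans pl _; exact: permEl (perm_catCA l1 [:: v] l2).
rewrite prodr_cat /= (IHl (l1 ++ l2)) //; last first.
  by move=> u w y ul wl; apply: h; rewrite inE ?ul ?wl orbT.
rewrite prodr_cat; apply: prodr_commute => w y wl1; apply: h; first exact: mem_head.
by rewrite inE (perm_mem pl2) mem_cat wl1 orbT.
Qed.
End Products.

End OneRep.

Lemma fixp_two (s r : G -> H -> H) Q Q' x : urep s -> urep r -> gsub Q -> gsub Q' ->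
  (forall g h y, s g (r h y) = r h (s g y)) -> fixp s Q (fixp r Q' x) = fixp r Q' (fixp s Q x).
Proof.
move=> us ur gQ gQ' h; apply: fixp_comm_ops => //; first exact: fixp_bop.
move=> k y _; apply/esym; apply: fixp_comm_ops => //; first exact: ubop.
Qed.

Lemma fixp_two_rep (s r : G -> H -> H) Q g x : urep s -> urep r -> gsub Q ->
  (forall g h y, s g (r h y) = r h (s g y)) -> s g (fixp r Q x) = fixp r Q (s g x).
Proof. by move=> us ur gQ h; apply: fixp_comm_ops => //; exact: ubop. Qed.

End UnitaryReps.

(** * Corners and central summands *)

Section Corners.
Variables (R : realType) (H : hilbert R) (M : set (H -> H)).
Local Notation ip := (hdot H).
Hypothesis vM : von_neumann M.
Implicit Types (a b c p q w z : H -> H).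

Lemma vnb : M `<=` @bounded_op R H. Proof. by case: vM. Qed.
Lemma vn_lin a : M a -> linear a. Proof. by move=> /vnb/bop_lin. Qed.

Let M'b : commutant M `<=` @bounded_op R H. Proof. by move=> a []. Qed.

Lemma vnE : commutant (commutant M) = M. Proof. by case: vM. Qed.

Lemma vn_comp a b : M a -> M b -> M (a \o b).
Proof. by rewrite -vnE; exact: comm_comp. Qed.
Lemma vn_lc (k : R[i]) a b : M a -> M b -> M (fun x => k *: a x + b x).
Proof. by rewrite -vnE; exact: comm_lc. Qed.
Lemma vn_sub a b : M a -> M b -> M (fun x => a x - b x).
Proof. by rewrite -vnE; exact: comm_sub. Qed.
Lemma vn_id : M id. Proof. by rewrite -vnE; exact: comm_id. Qed.
Lemma vn_sclosed y : bounded_op y ->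
  (forall x1 x2 (e : R), 0 < e -> exists b, [/\ M b,
     nsq (y x1 - b x1) < e & nsq (y x2 - b x2) < e]) -> M y.
Proof. by rewrite -vnE; exact: comm_sclosed. Qed.

Lemma vn_adj a : M a -> M (hadj a).
Proof.
by case: vM => Mb Ma _ aM; have [b bM ab] := Ma _ aM; rewrite -(adj_eq (Mb _ aM) ab).
Qed.

Lemma cornerP q a : M q -> q \o q = q -> corner q M a <->
  [/\ M a, forall x, q (a x) = a x & forall x, a (q x) = a x].
Proof.
move=> Mq qq; have qx x : q (q x) = q x by rewrite -[in RHS]qq.
split=> [[b Mb <-]|[Ma qa aq]].
  by split=> [|x|x] /=; rewrite ?qx //; apply: vn_comp => //; exact: vn_comp.
by exists a => //; apply/funext => x /=; rewrite aq qa.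
Qed.

Section OneCorner.
Variable q : H -> H.
Hypotheses (Mq : M q) (qq : q \o q = q).

Lemma corner_sub : corner q M `<=` M. Proof. by move=> a /(cornerP _ Mq qq)[]. Qed.

Lemma corner_comp a b : corner q M a -> corner q M b -> corner q M (a \o b).
Proof.
move=> /(cornerP _ Mq qq)[Ma qa aq] /(cornerP _ Mq qq)[Mb qb bq]; apply/(cornerP _ Mq qq).
by split=> [|x|x] /=; [exact: vn_comp|exact: qa|rewrite bq].
Qed.

Lemma corner_lc (k : R[i]) a b : corner q M a -> corner q M b ->
  corner q M (fun x => k *: a x + b x).
Proof.
move=> /(cornerP _ Mq qq)[Ma qa aq] /(cornerP _ Mq qq)[Mb qb bq]; apply/(cornerP _ Mq qq).
by split=> [|x|x] /=; [exact: vn_lc|rewrite (vn_lin Mq) qa qb|rewrite aq bq].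
Qed.

Lemma corner_unit : corner q M q.
Proof. by apply/(cornerP _ Mq qq); split=> // x; rewrite -[in RHS]qq. Qed.

Lemma corner_corner c : corner q M c -> c \o c = c -> corner c (corner q M) = corner c M.
Proof.
move=> /(cornerP _ Mq qq)[Mc qc cq] cc; apply/seteqP; split=> [_ [_ [a Ma <-] <-]|_ [a Ma <-]].
  exists a => //; apply/funext => x /=; by rewrite cq qc.
exists (q \o a \o q); first by exists a.
by apply/funext => x /=; rewrite cq qc.
Qed.

Lemma corner_sclosed y : bounded_op y ->
  (forall x1 x2 (e : R), 0 < e -> exists b, [/\ corner q M b,
     nsq (y x1 - b x1) < e & nsq (y x2 - b x2) < e]) -> corner q M y.
Proof.
move=> by_ h; have ly := bop_lin by_; apply/(cornerP _ Mq qq); split.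
- by apply: vn_sclosed => // x1 x2 e /(h x1 x2)[b [/corner_sub Mb h1 h2]]; exists b.
- move=> x; apply/eqP; rewrite -subr_eq0; apply/eqP/nsq_small_eq0 => e e0.
  have [c c0 hc] := bounded_nsq (vnb Mq).
  have p : 0 < 2 * c + 2 by rewrite addr_gt0 // mulr_gt0.
  have [|b [/(cornerP _ Mq qq)[Mb qb bq] h1 _]] := h x x (e / (2 * c + 2)).
    by rewrite divr_gt0.
  apply: le_lt_trans (nsq_tri (b x) _ _) _; rewrite -{1}qb -(linB (vn_lin Mq)) (nsqBC (b x)).
  move: h1 (hc (y x - b x)); rewrite ltr_pdivlMr //.
  by move: (nsq (y x - b x)) (nsq _) => A B *; lra.
- move=> x; apply/eqP; rewrite -subr_eq0; apply/eqP/nsq_small_eq0 => e e0.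
  have [|b [/(cornerP _ Mq qq)[Mb qb bq] h1 h2]] := h x (q x) (e / 4).
    by rewrite divr_gt0.
  apply: le_lt_trans (nsq_tri (b x) _ _) _; rewrite -{1}bq (nsqBC (b x)).
  by move: h1 h2; lra.
Qed.
End OneCorner.

(** This excludes type I summands in all corners at the same time, because a corner of a corner is a
    corner of [M]. For the group algebra it is [no_abelian_idempotent]. *)
Hypothesis noab : forall e, M e -> e \o e = e ->
  (forall x y : H -> H, M x -> M y -> e \o x \o e \o y \o e = e \o y \o e \o x \o e) ->
  e = @op_zero R H.

Lemma corner_not_typeI q : M q -> q \o q = q -> q <> @op_zero R H -> ~ typeI (corner q M).
Proof.
move=> Mq qq q0 tI.
have cu : exists2 a, corner q M a & a <> @op_zero R H by exists q => //; exact: corner_unit.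
have [e [/(cornerP _ Mq qq)[Me qe eq] ee e0 eab]] :=
  typeI_abelian_idempotent (@corner_comp _ Mq qq) (@corner_lc _ Mq qq) tI cu.
apply: e0; apply: noab => // x y Mx My.
have := eab (q \o x \o q) (q \o y \o q) (ex_intro2 _ _ x Mx erefl) (ex_intro2 _ _ y My erefl).
by move=> E; apply/funext => v; have := congr1 (fun f => f v) E; rewrite /= !(eq, qe).
Qed.

Lemma no_typeI_summand q : M q -> q \o q = q -> no_summand (fun N _ => typeI N) (corner q M).
Proof.
move=> Mq qq c [[_ cc _] qc _] c0; rewrite corner_corner //.
by apply: corner_not_typeI => //; exact: corner_sub qc.
Qed.

Lemma central_comm c a x : central_projection M c -> M a -> a (c x) = c (a x).
Proof. by move=> [_ _ h] /h e; have := congr1 (fun f => f x) e. Qed.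

Lemma proj_op_idem p x : projection p -> p (p x) = p x.
Proof. by move=> [_ e _]; rewrite -[in RHS]e. Qed.

(* Compressing to a smaller central summand preserves normality: outside of it,
   an upper bound may be completed by the supremum itself. *)
Lemma compression_trace c z tau : central_projection M c -> central_projection M z ->
  (forall x, c (z x) = c x) -> normal_tracial_state (corner c M) c tau ->
  normal_tracial_state (corner z M) z (fun x => tau (c \o x \o c)).
Proof.
move=> hc hz cz [t1 t2 t3 t4 t5]; have [pc Mc Cc] := hc; have [pz Mz Cz] := hz.
have lc := vn_lin Mc; have lz := vn_lin Mz.
have cc x : c (c x) = c x by exact: proj_op_idem.
have zz x : z (z x) = z x by exact: proj_op_idem.
have zc x : z (c x) = c x by rewrite (central_comm x hc Mz) cz.
have ccE : c \o c = c by case: pc. have zzE : z \o z = z by case: pz.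
have sc : adjoint_pair c c by case: pc.
have sz : adjoint_pair z z by case: pz.
have cut a : corner z M a -> corner c M (c \o a \o c).
  by move=> /(corner_sub Mz zzE) Ma; exists a.
have sub a : corner z M a -> M a by exact: corner_sub.
split.
- move=> k a b Ma Mb; rewrite -t1; [|exact: cut..].
  by congr tau; apply/funext => x /=; rewrite lc.
- move=> a b Ma Mb ab.
  have -> : c \o (b \o a) \o c = (c \o b \o c) \o (c \o a \o c).
    by apply/funext => x /=; rewrite (central_comm x hc (sub _ Ma)) !cc.
  apply: t2; [exact: cut..|].
  by move=> x y; rewrite /= sc ab sc.
- by rewrite -[RHS]t3; congr tau; apply/funext => x /=; rewrite zc cc.
- move=> a b Ma Mb.
  have E a' b' : corner z M b' ->
      c \o (a' \o b') \o c = (c \o a' \o c) \o (c \o b' \o c).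
    by move=> Mb'; apply/funext => x /=; rewrite (central_comm x hc (sub _ Mb')) !cc.
  by rewrite (E a b) // (E b a) //; apply: t4; exact: cut.
- move=> D x [d0 Dd0] DN Dsa Ddir Nx xsa [xub xlub] eps eps0.
  pose D' := [set c \o a \o c | a in D].
  suff [_ [a Da <-] h] : exists2 a, D' a & Re (tau (c \o x \o c)) < Re (tau a) + eps.
    by exists a.
  apply: t5 eps0.
  - by exists (c \o d0 \o c); exists d0.
  - by move=> _ [a /DN Na <-]; exact: cut.
  - by move=> _ [a /Dsa h <-] u v; rewrite /= sc h sc.
  - move=> _ _ [a Da <-] [b Db <-]; have [e [De ae be]] := Ddir _ _ Da Db.
    exists (c \o e \o c); split; first by exists e.
      by move=> u; rewrite /= -(linB lc) sc; exact: ae.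
    by move=> u; rewrite /= -(linB lc) sc; exact: be.
  - exact: cut.
  - by move=> u v; rewrite /= sc xsa sc.
  - split=> [_ [a Da <-] u|y Ny ysa yub].
      by rewrite /= -(linB lc) sc; exact: xub.
    have [My cy yc] := (cornerP y Mc ccE).1 Ny.
    have lx := vn_lin (sub _ Nx).
    pose y' u := y u + (x u - x (c u)).
    have [Mx zx xz] := (cornerP x Mz zzE).1 Nx.
    have ay' : op_le x y'.
      apply: xlub.
      - apply/(cornerP y' Mz zzE); split.
        + have -> : y' = (fun u => (-1) *: (fun u => x (c u) - x u) u + y u).
            by apply/funext => u; rewrite /y' scaleN1r opprB addrC.
          by apply: vn_lc => //; apply: vn_sub => //; exact: vn_comp.
        + move=> u; rewrite /y' (linD lz) (linB lz) !zx; congr (_ + _).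
          by rewrite -cy zc.
        + move=> u; rewrite /y' xz (central_comm u hz Mc) zc.
          by rewrite -(yc (z u)) cz yc.
      - move=> u v; rewrite /y' ipDl ipBl ipDr ipBr ysa xsa; congr (_ + (_ - _)).
        by rewrite (central_comm u hc Mx) sc xsa (central_comm v hc Mx).
      - move=> a Da u; have Na := DN _ Da; have la := vn_lin (sub _ Na).
        have h1 := yub _ (ex_intro2 _ _ a Da erefl) u.
        have h2 := xub _ Da (u - c u).
        have cac v : c (a v) = a (c v) by rewrite (central_comm _ hc (sub _ Na)).
        have cxc v : c (x v) = x (c v) by rewrite (central_comm _ hc Mx).
        have E : ip (x (u - c u) - a (u - c u)) (u - c u) =
            ip (x u - x (c u) - (a u - a (c u))) u.
          rewrite (linB lx) (linB la) ipBr -sc (linB lc (x u - _)) (linB lc (x u)) (linB lc (a u)).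
          by rewrite !cac !cxc !cc !subrr ip0l subr0.
        rewrite E in h2; have := addr_ge0 h1 h2; rewrite -ipDl.
        congr (0 <= ip _ u); rewrite /= cac cc /y' opprB -!addrA; congr (_ + _).
        by rewrite (addrCA (- x (c u))) [X in _ + X]addrCA addKr.
    move=> u; have := ay' (c u); rewrite /y' cc subrr addr0 yc.
    by rewrite -sc (linB lc) cy.
Qed.

(* The complement of [II1_null] is the supremum of the type II_1 central summands; their
   traces separate the points of the corresponding summand. *)
Definition II1_summands := [set c | central_projection M c /\ typeII1 (corner c M) c].
Definition II1_null : set H := [set x | forall c, II1_summands c -> c x = 0].
Definition II1_rest : H -> H := oproj II1_null.

Lemma II1_null_closed : closed_sub II1_null.
Proof.
split=> [c [[_ /vn_lin lc _] _]|a x y hx hy c hc|x hx c hc]; first exact: lin0.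
  by have [[_ /vn_lin lc _] _] := hc; rewrite lc hx // hy // scaler0 addr0.
have [[_ Mc _] _] := hc; have [k k0 hk] := bounded_nsq (vnb Mc).
apply: nsq_small_eq0 => e e0; have [|y yn xy] := hx (e / k); first by rewrite divr_gt0.
have := hk (x - y); rewrite (linB (vn_lin Mc)) (yn c hc) subr0 => h.
by apply: le_lt_trans h _; rewrite mulrC -ltr_pdivlMr.
Qed.

Lemma II1_rest_M : M II1_rest.
Proof.
rewrite -vnE; apply: proj_commutant => //; first exact: II1_null_closed.
move=> b cb; have bb := comm_bounded cb; have cb' : commutant M (hadj b).
  by apply: comm_adj cb; [exact: vnb|move=> a Ma; case: vM => _ /(_ _ Ma)].
exists (hadj b); first exact: adj_pair.
have inv b' : commutant M b' -> forall x, II1_null x -> II1_null (b' x).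
  move=> hb' x hx c hc; have [[_ Mc _] _] := hc.
  by rewrite (commE _ hb' Mc) hx // (lin0 (bop_lin (comm_bounded hb'))).
by move=> x hx; split; exact: inv.
Qed.

Lemma II1_rest_central : central_projection M II1_rest.
Proof.
have cn := II1_null_closed; split; [split|exact: II1_rest_M|].
- exact: proj_bounded.
- by apply/funext => x; exact: proj_idem.
- exact: proj_adj.
move=> a Ma; apply/funext => x /=; have ba := vnb Ma.
have inv a' : M a' -> forall x, II1_null x -> II1_null (a' x).
  move=> Ma' y hy c hc; have [hc' _] := hc; rewrite -(central_comm y hc' Ma') hy //.
  exact: lin0 (vn_lin Ma').
apply: (proj_comm cn (vn_lin Ma) (adj_pair ba)) => y; apply: inv => //.
exact: vn_adj.
Qed.

Lemma II1_restE c x : II1_summands c -> c (II1_rest x) = 0.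
Proof. by move=> hc; have := projE II1_null_closed x; apply. Qed.

Lemma complement_central w : central_projection M w -> central_projection M (fun x => x - w x).
Proof.
move=> [[bw ww sw] Mw cw]; have lw := bop_lin bw; split; [split|exact: (vn_sub vn_id)|].
- exact: (bop_sub (@bop_id _ _)).
- apply/funext => x /=; rewrite (linB lw).
  by have := congr1 (fun f => f x) ww => /= ->; rewrite subrr subr0.
- by move=> x y; rewrite ipBl ipBr sw.
- move=> a Ma; apply/funext => x /=; rewrite (linB (vn_lin Ma)).
  by have := congr1 (fun f => f x) (cw _ Ma) => /= ->.
Qed.

(** The type II_1 part is the corner of [z], the complement of [w]. Its traces separate: if they all
    vanish on [b \o a], then every type II_1 summand [c] kills the range of [a], which therefore
    lies in the range of [w], while [z] fixes it. A type II_1 summand of the corner of [w] would be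
    one of [M], and those annihilate [w]. *)
Lemma typeII_of_net (p : nat -> H -> H) : (forall n, M (p n)) -> (forall n, projection (p n)) ->
  (forall m n, (m <= n)%N -> op_le (p m) (p n)) ->
  (forall x (e : R), 0 < e -> exists m, forall n, (m <= n)%N -> hnorm (p n x - x) < e) ->
  (forall n w, central_projection M w -> typeII1 (corner (p n \o w) M) (p n \o w)) ->
  typeII M id.
Proof.
move=> Mp pp pmono pcvg pII; set w := II1_rest.
have hw : central_projection M w := II1_rest_central; have [[bw ww sw] Mw cw] := hw.
have wx x : w (w x) = w x by rewrite -[in RHS]ww.
pose z x := x - w x; have hz : central_projection M z := complement_central hw.
have [[bz zzE sz] Mz cz] := hz.
have Mnw n : M (p n \o w) by exact: vn_comp.
have lw := bop_lin bw.
have cwp n x : p n (w x) = w (p n x) by exact: central_comm.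
have pnn n x : p n (p n x) = p n x by exact: proj_op_idem.
have pw n : projection (p n \o w).
  split; first exact: vnb.
    by apply/funext => x /=; rewrite -cwp wx pnn.
  by move=> x y /=; have [_ _ sp] := pp n; rewrite sp sw cwp.
have cpw n : corner w M (p n \o w).
  by apply/(cornerP _ Mw ww); split=> // x /=; rewrite ?wx -?cwp ?wx.
exists z; split=> //.
- split; first exact: no_typeI_summand.
  exists [set tau | exists c sigma, [/\ II1_summands c, normal_tracial_state (corner c M) c sigma
    & tau = fun x => sigma (c \o x \o c)]].
  split=> [_ [c [s [hc hs ->]]]|a b Na Nb ab h].
    apply: compression_trace hs => //; first by case: hc.
    by move=> x; rewrite /z (linB (vn_lin (let: conj (And3 _ Mc _) _ := hc in Mc))) (II1_restE _ hc) subr0.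
  have [Ma za az] := (cornerP a Mz zzE).1 Na; have [Mb _ _] := (cornerP b Mz zzE).1 Nb.
  suff an x : II1_null (a x).
    apply/funext => x; rewrite /op_zero -za /z.
    by rewrite /w /II1_rest (proj_id II1_null_closed (an x)) subrr.
  move=> c hc; have [hc' [_ [F [hF sF]]]] := hc; have [pc Mc Cc] := hc'.
  have [bc cc sc] := pc; have cx y : c (c y) = c y by exact: proj_op_idem.
  have : c \o a \o c = @op_zero R H.
    apply: (sF _ (c \o b \o c)); [by exists a|by exists b| |].
      by move=> u v /=; rewrite sc ab sc.
    move=> s Fs; rewrite -(h (fun x => s (c \o x \o c))).
      congr s; apply/funext => y /=.
      by rewrite (central_comm y hc' Ma) !cx.
    by exists c, s; split=> //; exact: hF.
  move=> /(congr1 (fun f => f x)) /=; by rewrite (central_comm x hc' Ma) cx.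
- have -> : (fun x => id x - z x) = w by apply/funext => x; rewrite /z /= subKr.
  split; first exact: no_typeI_summand.
  + move=> c [pc Nc Cc] c0; have [bc cc sc] := pc; rewrite corner_corner // => II.
    have [Mc wc cw'] := (cornerP c Mw ww).1 Nc.
    (* A central projection of the corner of [w] is central in [M], because [w] is. *)
    have hc : central_projection M c.
      split=> // a Ma; apply/funext => x /=.
      have /(_ (ex_intro2 _ _ a Ma erefl)) := Cc (w \o a \o w) => /(congr1 (fun f => f x)) /=.
      by rewrite wc (central_comm x hw Ma) wx cw' -(central_comm _ hw Ma) wc.
    apply: c0; apply/funext => x; rewrite /op_zero -cw'.
    by apply: II1_restE; split.
  exists nat, (fun i j => (i <= j)%N), (fun n => p n \o w); split.
  + split=> [|i //|j i k|i j]; [exact: (inhabits 0%N)|exact: leq_trans|].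
    by exists (maxn i j); rewrite leq_maxl leq_maxr.
  + by move=> i; split.
  + by move=> i j ij x; have := pmono _ _ ij (w x); rewrite -sw (linB lw) -!cwp !wx.
  + move=> x e e0; have [m hm] := pcvg (w x) e e0; exists m => j mj.
    exact: hm.
  + move=> n; rewrite corner_corner //; first exact: pII.
    by case: (pw n).
Qed.
End Corners.

(** * Groups acting on the ends of the tree *)

Section Ends.
Variables d k : nat.

(* A ray from the root is encoded by its first vertex and an infinite word. *)
Definition ends : Type := ('I_k * (nat -> 'I_d))%type.
Implicit Types (s : ends -> ends) (v w : 'I_k * seq 'I_d).

(* The vertex at depth [n.+1], not [n], on the ray [x]. *)
Definition pre n (x : ends) : 'I_k * seq 'I_d := (x.1, mkseq x.2 n).

Lemma preP n x y : pre n x = pre n y <-> x.1 = y.1 /\ forall i, (i < n)%N -> x.2 i = y.2 i.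
Proof.
split=> [[-> e]|[e1 e2]].
  split=> // i hi; have := congr1 (fun l : seq 'I_d => nth (x.2 i) l i) e.
  by rewrite !nth_mkseq.
rewrite /pre e1; congr (_, _); apply: (@eq_from_nth _ (x.2 0)); rewrite !size_mkseq // => i hi.
by rewrite !nth_mkseq // e2.
Qed.

Lemma pre_le m n x y : (m <= n)%N -> pre n x = pre n y -> pre m x = pre m y.
Proof. by move=> mn /preP[e h]; apply/preP; split=> // i /leq_trans/(_ mn); exact: h. Qed.

Lemma pre_take m n x : (m <= n)%N -> pre m x = (x.1, take m (pre n x).2).
Proof. by move=> mn; rewrite /pre /mkseq -map_take take_iota (minn_idPl mn). Qed.

Lemma pre_ext m x y : (forall n, (m <= n)%N -> pre n x = pre n y) -> x = y.
Proof.
case: x y => [a b] [a' b'] h; have /preP[/= e _] := h m (leqnn _); congr (_, _) => //.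
apply/funext => i; have /preP[_] := h (maxn m i.+1) (leq_maxl _ _).
by apply; exact: leq_maxr.
Qed.

(* The boundary maps of the automorphisms of the forest outside the ball of radius [n]. *)
Definition forest_homeo n s := bijective s /\
  forall j x y, (n <= j)%N -> pre j (s x) = pre j (s y) <-> pre j x = pre j y.

Variables (G : groupType) (act : G -> ends -> ends).
Hypothesis act1 : act 1%g = id.
Hypothesis actM : forall g h, act (g * h)%g = act g \o act h.
Hypothesis act_inj : injective act.
Hypothesis act_ex : forall g, exists n, forest_homeo n (act g).
Hypothesis act_onto : forall n s, forest_homeo n s -> exists g, act g = s.
Implicit Types (g h : G).

Lemma actMx g h x : act (g * h)%g x = act g (act h x). Proof. by rewrite actM. Qed.
Lemma actK g x : act g^-1%g (act g x) = x. Proof. by rewrite -actMx mulVg act1. Qed.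
Lemma actKV g x : act g (act g^-1%g x) = x. Proof. by rewrite -actMx mulgV act1. Qed.
Lemma act_ext g h : (forall x, act g x = act h x) -> g = h.
Proof. by move=> /funext/act_inj. Qed.
Lemma act_xinj g x y : act g x = act g y -> x = y.
Proof. by move=> e; rewrite -(actK g x) e actK. Qed.
Lemma act_bij g : bijective (act g).
Proof. by exists (act g^-1%g) => x; rewrite ?actK ?actKV. Qed.

Definition On n : set G := [set g | forest_homeo n (act g)].
Definition Un n : set G := [set g | On n g /\ forall x, pre n (act g x) = pre n x].

Lemma OnP n g : (forall j x y, (n <= j)%N -> pre j (act g x) = pre j (act g y) <-> pre j x = pre j y) ->
  On n g.
Proof. by split; [exact: act_bij|]. Qed.

Lemma On_gsub n : gsub (On n).
Proof.
split=> [|g h [_ hg] [_ hh]|g [_ hg]]; apply: OnP => j x y nj.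
- by rewrite act1.
- by rewrite !actMx hg // hh.
- by rewrite -(hg j) // !actKV.
Qed.

Lemma On_mono m n : (m <= n)%N -> On m `<=` On n.
Proof. by move=> mn g [_ h]; apply: OnP => j x y nj; apply: h; exact: leq_trans nj. Qed.

Lemma On_ex g : exists n, On n g. Proof. exact: act_ex. Qed.

Lemma Un_gsub n : gsub (Un n).
Proof.
have [oe om ov] := On_gsub n.
split=> [|g h [Og hg] [Oh hh]|g [Og hg]].
- by split=> // x; rewrite act1.
- by split=> [|x]; [exact: om|rewrite actMx hg hh].
- by split=> [|x]; [exact: ov|rewrite -[in LHS]hg actKV].
Qed.

Lemma Un_On n : Un n `<=` On n. Proof. by move=> g []. Qed.

(** An element of [Un n] fixes all prefixes of length at most [n], so the condition on prefixes that
    [On m] requires between [m] and [n] holds for free. *)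
Lemma Un_anti m n : (m <= n)%N -> Un n `<=` Un m.
Proof.
move=> mn g [[bg hg] pg]; split; last by move=> x; exact: pre_le mn (pg x).
apply: OnP => j x y mj; have [nj|/ltnW jn] := leqP n j; first exact: hg.
by rewrite !(pre_le jn (pg _)).
Qed.

Lemma Un_norm n g h : On n g -> Un n h -> Un n (g * h * g^-1)%g.
Proof.
move=> Og [Oh hh]; have [oe om ov] := On_gsub n; split.
  exact: om (om _ _ Og Oh) (ov _ Og).
move=> x; rewrite !actMx -[in RHS](actKV g x); have [_ hg] := Og.
by apply/hg => //; rewrite hh.
Qed.

Definition under v x := pre (size v.2) x = v.

Definition Lin v : set G := [set g | forall x, ~ under v x -> act g x = x].
Definition Lout v : set G := [set g | forall x, under v x -> act g x = x].
(** The elements act below [v] only, fix the vertices given by prefixes of length [a], and respect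
    the tree structure from length [b] on. When [a < b] they may mix the subtrees in between, and so
    leave the group of tree automorphisms. *)
Definition Qn v a b : set G :=
  [set g | [/\ On b g, Lin v g & forall x, pre a (act g x) = pre a x]].

Lemma Lin_under v g x : Lin v g -> under v (act g x) <-> under v x.
Proof.
move=> h; split=> hx; apply: contrapT => n.
  by apply: (n); rewrite (h _ n) in hx.
by have := h _ n => /act_xinj e; apply: n; rewrite e.
Qed.
Lemma Lout_under v g x : Lout v g -> under v (act g x) <-> under v x.
Proof.
move=> h; split=> hx; last by rewrite h.
by have := h _ hx => /act_xinj e; rewrite e in hx.
Qed.

Lemma Lin_gsub v : gsub (Lin v).
Proof.
split=> [x _|g h hg hh x n|g hg x n]; first by rewrite act1.
  by rewrite actMx hh // hg.
by rewrite -[in LHS](hg x n) actK.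
Qed.
Lemma Lout_gsub v : gsub (Lout v).
Proof.
split=> [x _|g h hg hh x n|g hg x n]; first by rewrite act1.
  by rewrite actMx hh // hg.
by rewrite -[in LHS](hg x n) actK.
Qed.
Lemma Qn_gsub v a b : gsub (Qn v a b).
Proof.
have [oe om ov] := On_gsub b; have [le1 lm lv] := Lin_gsub v.
split=> [|g h [h1 h2 h3] [h4 h5 h6]|g [h1 h2 h3]]; split => //.
- by move=> x; rewrite act1.
- exact: om.
- exact: lm.
- by move=> x; rewrite actMx h3.
- exact: ov.
- exact: lv.
- by move=> x; rewrite -[in LHS]h3 actKV.
Qed.

Lemma Lin_Lout_comm v g h : Lin v g -> Lout v h -> (g * h = h * g)%g.
Proof.
move=> hg hh; apply: act_ext => x; rewrite !actMx.
have [u|n] := pselect (under v x).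
  by rewrite (hh x u) hh //; apply/Lin_under.
by rewrite (hg x n) hg // => /(Lout_under _ hh).
Qed.

Lemma Qn_Lin v a b : Qn v a b `<=` Lin v. Proof. by move=> g []. Qed.

Lemma Qn_Lout v w a b : size v.2 = size w.2 -> v <> w -> Qn w a b `<=` Lout v.
Proof. by move=> e vw g [_ h _] x u; apply: h => u'; apply: vw; rewrite -u -u' e. Qed.

Lemma Qn_comm v w a b a' b' g h : size v.2 = size w.2 -> v <> w ->
  Qn v a b g -> Qn w a' b' h -> (g * h = h * g)%g.
Proof. by move=> e vw /Qn_Lin hg /(Qn_Lout e vw); exact: Lin_Lout_comm. Qed.

(** The product equals [g] below [v] and [h] elsewhere, and membership in [Un] can be tested on the
    two parts separately. This is the source of all factorizations of inner products below. *)
Lemma Lin_Lout_U v g h : Lin v g -> Lout v h -> Un (size v.2) (g * h)%g <->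
  Un (size v.2) g /\ Un (size v.2) h.
Proof.
move=> hg hh; have [ue um uv] := Un_gsub (size v.2).
split=> [ugh|[ug uh]]; last exact: um.
suff ug : Un (size v.2) g.
  split=> //; rewrite -[h](mulKg g); apply: um => //; exact: uv.
have gx x : under v x -> act (g * h)%g x = act g x by move=> u; rewrite actMx hh.
split; last first.
  move=> x; have [u|n] := pselect (under v x); last by rewrite hg.
  by rewrite u; exact/Lin_under.
apply: OnP => j x y mj.
have uj z : under v z -> forall z', pre j z = pre j z' -> under v z'.
  by move=> uz z' /(pre_le mj) e; rewrite /under -e.
have [ux|nx] := pselect (under v x); have [uy|ny] := pselect (under v y).
- by rewrite -!gx //; case: ugh => -[_ h'] _; apply: h'.
- split=> [/(uj _ ((Lin_under x hg).2 ux))/(Lin_under _ hg)//|/(uj _ ux)//].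
- split=> [/esym/(uj _ ((Lin_under y hg).2 uy))/(Lin_under _ hg)//|/esym/(uj _ uy)//].
- by rewrite !hg.
Qed.

(** Only the vertices of one level are fixed here, with no condition on the tree structure below
    them. The group contains every [Qn v a b] with [m <= a], and meets [On m] in [Un m]. *)
Definition Lall m : set G := [set g | forall x, pre m (act g x) = pre m x].
Lemma Lall_gsub m : gsub (Lall m).
Proof.
split=> [x|g h hg hh x|g hg x]; first by rewrite act1.
  by rewrite actMx hg hh.
by rewrite -[in LHS]hg actKV.
Qed.
Lemma Qn_Lall v a b m : (m <= a)%N -> Qn v a b `<=` Lall m.
Proof. by move=> ma g [_ _ h] x; exact: pre_le ma (h x). Qed.

Hypothesis (hd : (1 < d)%N) (hk : (0 < k)%N).
Let d0 : 'I_d := Ordinal (ltnW hd).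
Let d1 : 'I_d := Ordinal hd.

Definition end_of v : ends := (v.1, fun i => nth d0 v.2 i).

Lemma pre_end_of v n : (n <= size v.2)%N -> pre n (end_of v) = (v.1, take n v.2).
Proof.
move=> hn; congr (_, _); apply: (@eq_from_nth _ d0).
  by rewrite size_mkseq size_takel.
by move=> i; rewrite size_mkseq => hi; rewrite nth_mkseq // nth_take.
Qed.
Lemma under_end_of v : under v (end_of v).
Proof. by rewrite /under pre_end_of // take_size; case: v. Qed.
Lemma size_pre m x : size (pre m x).2 = m. Proof. by rewrite size_mkseq. Qed.

Definition level m : seq ('I_k * seq 'I_d) :=
  [seq (i, val t) | i <- enum 'I_k, t <- enum {: m.-tuple 'I_d}].

Lemma mem_level m v : (v \in level m) = (size v.2 == m).
Proof.
apply/allpairsP/eqP => [[[i t] [_ _ ->]]|e]; first by rewrite size_tuple.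
case: v e => i s e; have es : size s == m by exact/eqP.
by exists (i, Tuple es); split; rewrite ?mem_enum.
Qed.
Lemma level_uniq m : uniq (level m).
Proof.
apply: allpairs_uniq; rewrite ?enum_uniq // => -[i t] [i' t'] _ _ /= [-> /val_inj ->//].
Qed.

(** For [g] in [On m] and [v] of level [m] this is the image of the vertex [v]: all ends below [v]
    have the same image prefix, so one of them is used. *)
Definition vact m g v := pre m (act g (end_of v)).

Lemma vact_under m g v x : size v.2 = m -> On m g -> under (vact m g v) (act g x) <-> under v x.
Proof.
move=> e [_ hg]; rewrite /under size_pre hg // -e.
by have := under_end_of v; rewrite /under => ->.
Qed.

Lemma vact_perm m g : On m g -> perm_eq (map (vact m g) (level m)) (level m).
Proof.
move=> Og; have inj : {in level m &, injective (vact m g)}.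
  move=> v w; rewrite !mem_level => /eqP ev /eqP ew; case: Og => _ h /h -/(_ (leqnn _)) e.
  have := under_end_of v; have := under_end_of w; rewrite /under ev ew -e => <-.
  by move=> ->.
apply: uniq_perm; first by rewrite map_inj_in_uniq ?level_uniq.
  exact: level_uniq.
apply: (uniq_min_size _ _ _).2; rewrite ?size_map //.
  by rewrite map_inj_in_uniq ?level_uniq.
by move=> _ /mapP[v _ ->]; rewrite mem_level size_pre.
Qed.

Lemma Qn_conj m g v a b h : size v.2 = m -> (m <= a)%N -> (m <= b)%N -> On m g ->
  Qn v a b h -> Qn (vact m g v) a b (g * h * g^-1)%g.
Proof.
move=> e ma mb Og [h1 h2 h3]; have [oe om ov] := On_gsub b.
have Ob := On_mono mb Og; split.
- exact: om (om _ _ Ob h1) (ov _ Ob).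
- move=> x nx; rewrite !actMx h2 ?actKV // => u; apply: nx.
  by rewrite -(actKV g x); apply/vact_under.
- move=> x; rewrite !actMx -[in RHS](actKV g x); case: Og => _ hg.
  by apply/hg => //; rewrite h3.
Qed.

Lemma vact_inv m g v : size v.2 = m -> On m g -> vact m g^-1%g (vact m g v) = v.
Proof.
move=> e Og; have [_ _ ov] := On_gsub m; have := vact_under (end_of (vact m g v)) _ (ov _ Og).
have e' : size (vact m g v).2 = m by exact: size_pre.
move=> /(_ _ e')[_ /(_ (under_end_of _))] h1.
have := vact_under (act g^-1%g (end_of (vact m g v))) e Og; rewrite actKV => -[/(_ (under_end_of _)) h2 _].
have e2 : size (vact m g^-1%g (vact m g v)).2 = m by exact: size_pre.
by move: h1 h2; rewrite /under e2 e => -> ->.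
Qed.

Lemma Qn_conj_inv m g v a b h : size v.2 = m -> (m <= a)%N -> (m <= b)%N -> On m g ->
  Qn (vact m g v) a b h -> Qn v a b (g^-1 * h * g)%g.
Proof.
move=> e ma mb Og; have [_ _ ov] := On_gsub m => h1.
have e' : size (vact m g v).2 = m by exact: size_pre.
by have := Qn_conj e' ma mb (ov _ Og) h1; rewrite vact_inv // invgK.
Qed.

Lemma vact_Un m u v : size v.2 = m -> Un m u -> vact m u v = v.
Proof.
by move=> e [_ h]; rewrite /vact h; have := under_end_of v; rewrite /under e.
Qed.

(* Modulo [U (m + 3)], an element of [Qn v a b] with [b <= m + 3] is determined by its effect on
   the three letters following the vertex [v] of level [m]. The number of such effects does not
   depend on [m], which makes the bound [gap] below uniform. *)
Definition word3 : finType := {ffun 'I_3 -> 'I_d}.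
Definition local_rule := {ffun word3 -> word3}.

Definition word_of m (x : ends) : word3 := [ffun i : 'I_3 => x.2 (m + i)%N].
Definition end_word v (w : word3) : ends := end_of (v.1, v.2 ++ [seq w i | i <- enum 'I_3]).
Definition rule_of v g : local_rule := [ffun w => word_of (size v.2) (act g (end_word v w))].

Lemma pre_word m x y : pre m x = pre m y -> word_of m x = word_of m y ->
  pre (m + 3) x = pre (m + 3) y.
Proof.
move=> /preP[e h] /ffunP w; apply/preP; split=> // i hi.
have [im|mi] := ltnP i m; first exact: h.
have i3 : (i - m < 3)%N by rewrite ltn_subLR.
by have := w (Ordinal i3); rewrite !ffunE /= subnKC.
Qed.

Lemma word_end v (w : word3) : word_of (size v.2) (end_word v w) = w.
Proof.
apply/ffunP => i; rewrite ffunE /= nth_cat ltnNge leq_addr /= addKn.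
by rewrite (nth_map i) ?nth_ord_enum // size_enum_ord.
Qed.
Lemma under_end_word v (w : word3) : under v (end_word v w).
Proof.
rewrite /under pre_end_of /=; last by rewrite size_cat leq_addr.
by rewrite take_size_cat //; case: v.
Qed.

Lemma rule_of_eq v a b g h : (size v.2 <= a)%N -> (b <= size v.2 + 3)%N ->
  Qn v a b g -> Qn v a b h -> rule_of v g = rule_of v h -> Un (size v.2 + 3) (h^-1 * g)%g.
Proof.
move=> va bv [g1 g2 g3] [h1 h2 h3] /ffunP e.
have Og := On_mono bv g1; have Oh := On_mono bv h1; have [oe om ov] := On_gsub (size v.2 + 3).
split; first by apply: om => //; exact: ov.
move=> x; rewrite actMx -[in RHS](actK h x).
have [_ hhV] := ov _ Oh; apply/hhV => //.
have [u|n] := pselect (under v x); last by rewrite g2 // h2.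
pose y := end_word v (word_of (size v.2) x).
have xy : pre (size v.2 + 3) x = pre (size v.2 + 3) y.
  apply: pre_word; last by rewrite word_end.
  by rewrite u; apply/esym; exact: under_end_word.
have [_ hg] := Og; have [_ hh] := Oh.
have -> : pre (size v.2 + 3) (act g x) = pre (size v.2 + 3) (act g y) by exact/hg.
have -> : pre (size v.2 + 3) (act h x) = pre (size v.2 + 3) (act h y) by exact/hh.
apply: pre_word; first by rewrite (pre_le va (g3 _)) (pre_le va (h3 _)).
by have := e (word_of (size v.2) x); rewrite !ffunE.
Qed.

(** * Exchange of two subtrees and a non-commuting pair *)

Definition rew (p : seq 'I_d) (x : ends) : ends := (x.1, fun j => if (j < size p)%N then nth d0 p j else x.2 j).
Definition swap i (p q : seq 'I_d) (x : ends) : ends :=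
  if pre (size p) x == (i, p) then rew q x else if pre (size p) x == (i, q) then rew p x else x.

Lemma pre_rew p x : pre (size p) (rew p x) = (x.1, p).
Proof.
congr (_, _); apply: (@eq_from_nth _ d0); rewrite size_mkseq // => i hi.
by rewrite nth_mkseq //= hi.
Qed.
Lemma rew_pre j p x y : (size p <= j)%N -> pre j x = pre j y -> pre j (rew p x) = pre j (rew p y).
Proof.
move=> _ /preP[e h]; apply/preP; split=> //= i hi; case: ifP => // _; exact: h.
Qed.
Lemma rewK p q x : size p = size q -> pre (size p) x = (x.1, p) -> rew p (rew q x) = x.
Proof.
case: x => a b e [h]; congr (_, _); apply/funext => j /=.
case: ltnP => [hj|]; first by rewrite -h nth_mkseq.
by rewrite e leqNgt => /negbTE ->.
Qed.

Section Swap.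
Variables (i : 'I_k) (p q : seq 'I_d).
Hypothesis pq : size p = size q.

Lemma swapl x : pre (size p) x = (i, p) -> swap i p q x = rew q x.
Proof. by rewrite /swap => ->; rewrite eqxx. Qed.
Lemma swapr x : pre (size p) x = (i, q) -> swap i p q x = rew p x.
Proof.
rewrite /swap => e; rewrite e eqxx; case: eqP => // -[->] //.
Qed.
Lemma swap_out x : pre (size p) x <> (i, p) -> pre (size p) x <> (i, q) -> swap i p q x = x.
Proof. by rewrite /swap => /eqP/negbTE -> /eqP/negbTE ->. Qed.

Lemma swapK : involutive (swap i p q).
Proof.
move=> x; have [e|n] := pselect (pre (size p) x = (i, p)).
  have xi : x.1 = i by have := congr1 fst e.
  rewrite (swapl e) swapr; last by rewrite pq pre_rew xi.
  by apply: rewK => //; rewrite e xi.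
have [e|n'] := pselect (pre (size p) x = (i, q)); last by rewrite !swap_out.
have xi : x.1 = i by have := congr1 fst e.
rewrite (swapr e) swapl; last by rewrite pre_rew xi.
by apply: rewK => //; rewrite -pq e xi.
Qed.

Lemma swap_homeo : forest_homeo (size p) (swap i p q).
Proof.
split; first by exists (swap i p q); exact: swapK.
have h j x y : (size p <= j)%N -> pre j x = pre j y -> pre j (swap i p q x) = pre j (swap i p q y).
  move=> pj e; have ep := pre_le pj e; rewrite /swap ep.
  by case: ifP => _; [apply: rew_pre => //; rewrite -pq|case: ifP => // _; exact: rew_pre].
move=> j x y pj; split; last exact: h.
by move=> /(h j _ _ pj); rewrite !swapK.
Qed.

Lemma swap_Qn v a g : act g = swap i p q -> v.1 = i -> (size v.2 <= a)%N -> (a <= size p)%N ->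
  take (size v.2) p = v.2 -> take a p = take a q -> Qn v a (size p) g.
Proof.
move=> eg vi va ap hp hpq; split.
- by rewrite /On /= eg; exact: swap_homeo.
- have ta (z : seq 'I_d) x : take (size v.2) z = v.2 -> pre (size p) x = (i, z) -> under v x.
    move=> hz e; rewrite /under (pre_take _ (leq_trans va ap)) e /= hz.
    by rewrite (_ : x.1 = v.1) -?surjective_pairing // vi; have := congr1 fst e.
  move=> x nx; rewrite eg swap_out // => e; apply: nx.
    exact: ta e.
  apply: ta e; have := congr1 (take (size v.2)) hpq; rewrite !take_takel //.
  by move=> <-; rewrite hp.
- have pa z x : pre a (rew z x) = (x.1, take a z) \/ (size z < a)%N.
    have [az|] := leqP a (size z); last by right.
    left; congr (_, _); apply: (@eq_from_nth _ d0); rewrite size_mkseq ?size_takel // => j hj.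
    by rewrite nth_mkseq //= (leq_trans hj az) nth_take.
  have px z x : pre (size p) x = (i, z) -> pre a x = (x.1, take a z).
    by move=> e; rewrite (pre_take _ ap) e.
  move=> x; rewrite eg.
  have [e|n] := pselect (pre (size p) x = (i, p)).
    rewrite (swapl e) (px _ _ e); case: (pa q x) => [->|]; first by rewrite hpq.
    by rewrite -pq ltnNge ap.
  have [e|n'] := pselect (pre (size p) x = (i, q)); last by rewrite swap_out.
  rewrite (swapr e) (px _ _ e); case: (pa p x) => [->|]; first by rewrite hpq.
  by rewrite ltnNge ap.
Qed.
End Swap.

(* [h1] exchanges [v000] and [v010], and [h2] exchanges [v00] and [v10]. The inverse of
   [h1 * h2] sends [v010] and [v011] to vertices with distinct ancestors at the level following
   that of [v], which the inverse of [b * a * u] cannot do. *)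
Lemma noncommuting_pair m v : size v.2 = m -> exists h1 h2,
  [/\ Qn v m.+1 (m + 3) h1, Qn v m (m + 2) h2 & forall b a u,
     Qn v m (m + 2) b -> Qn v m.+1 (m + 3) a -> Un m u -> (h1 * h2)%g <> (b * a * u)%g].
Proof.
move=> e; pose W l := v.2 ++ l.
have sW l : size (W l) = (m + size l)%N by rewrite size_cat e.
have [h2 e2] := act_onto (@swap_homeo v.1 (W [:: d0; d0]) (W [:: d1; d0]) (ltac:(by rewrite !sW))).
have [h1 e1] := act_onto (@swap_homeo v.1 (W [:: d0; d0; d0]) (W [:: d0; d1; d0]) (ltac:(by rewrite !sW))).
have tW l : take m (W l) = v.2 by rewrite -e take_size_cat.
have m13 : (m.+1 <= m + 3)%N by rewrite addnS ltnS leq_addr.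
have m12 : (m.+1 <= m + 2)%N by rewrite addnS ltnS leq_addr.
have m23 : (m + 2 <= m + 3)%N by rewrite leq_add2l.
have tW1 c l : take m.+1 (W (c :: l)) = v.2 ++ [:: c].
  by rewrite /W take_cat e ltnNge leqnSn /= subSnn /= take0.
have tW2 c c' l : take (m + 2) (W [:: c, c' & l]) = v.2 ++ [:: c; c'].
  by rewrite /W take_cat e ltnNge leq_addr /= addKn /= take0.
exists h1, h2; split.
- have := @swap_Qn v.1 (W [:: d0; d0; d0]) (W [:: d0; d1; d0]) (ltac:(by rewrite !sW)) v m.+1 h1 e1.
  by rewrite sW; apply; rewrite ?e ?tW ?tW1 ?leqnSn.
- have := @swap_Qn v.1 (W [:: d0; d0]) (W [:: d1; d0]) (ltac:(by rewrite !sW)) v m h2 e2.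
  by rewrite sW; apply; rewrite ?e ?tW ?leq_addr.
move=> b a u [Ob _ _] [_ _ pa] [Ou _] E.
pose y := end_of (v.1, W [:: d0; d1; d0]); pose y' := end_of (v.1, W [:: d0; d1; d1]).
have py l n : (n <= m + size l)%N -> pre n (end_of (v.1, W l)) = (v.1, take n (W l)).
  by move=> hn; rewrite pre_end_of //= sW.
have invE x : act (h1 * h2)^-1%g x = act h2^-1%g (act h1^-1%g x).
  by rewrite invgM actMx.
have iV h i p q x : size p = size q -> act h = swap i p q -> act h^-1%g x = swap i p q x.
  by move=> pq eh; apply: (@act_xinj h); rewrite actKV eh swapK.
(* The ends [y] and [y'] share [m + 2] letters. The inverse of [b] preserves this, that of [a] fixes
   the first [m.+1] letters, and that of [u], in [On m], preserves agreement on [m.+1] letters. *)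
have key : pre m.+1 (act (h1 * h2)^-1%g y) = pre m.+1 (act (h1 * h2)^-1%g y').
  rewrite E !invgM !actMx; have [_ _ ov] := On_gsub m.
  have [_ _ ov'] := On_gsub (m + 2).
  have [_ hu] := ov _ Ou; apply/hu => //.
  have pa' x : pre m.+1 (act a^-1%g x) = pre m.+1 x by rewrite -[in LHS](pa _) actKV.
  rewrite !pa'; apply: (@pre_le _ (m + 2)); first by rewrite addn2.
  have [_ hb] := ov' _ Ob; apply/hb => //.
  by rewrite !py ?leq_add2l // !tW2.
have pW l l' : size l = size l' -> (W l == W l') = (l == l').
  by move=> _; rewrite eqseq_cat // eqxx.
have ny' : act (h1 * h2)^-1%g y' = y'.
  rewrite invE (iV _ _ _ _ _ _ e1) ?sW // swap_out ?sW ?py // ?take_oversize ?sW //.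
  - rewrite (iV _ _ _ _ _ _ e2) ?sW // swap_out ?sW ?py ?leq_add2l // tW2.
      by move=> -[] /eqP; rewrite -/(W _) pW.
    by move=> -[] /eqP; rewrite -/(W _) pW.
  - by move=> -[] /eqP; rewrite pW.
  - by move=> -[] /eqP; rewrite pW.
have ny : pre m.+1 (act (h1 * h2)^-1%g y) = (v.1, v.2 ++ [:: d1]).
  rewrite invE (iV _ _ _ _ _ _ e1) ?sW // swapr ?sW //; last first.
    by rewrite py // take_oversize ?sW.
  have h : pre (m + 3) (rew (W [:: d0; d0; d0]) y) = (v.1, W [:: d0; d0; d0]).
    by have := pre_rew (W [:: d0; d0; d0]) y; rewrite sW.
  rewrite (iV _ _ _ _ _ _ e2) ?sW // swapl ?sW //; last by rewrite (pre_take _ m23) h /= tW2.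
  have := pre_rew (W [:: d1; d0]) (rew (W [:: d0; d0; d0]) y); rewrite sW => h'.
  by rewrite (pre_take _ m12) h' /= tW1.
move: key; rewrite ny ny' !py // tW1 => -[] /eqP.
by rewrite eqseq_cat // eqxx.
Qed.

(** * The regular representation *)

Section Regular.
(** An abstract form of the left and right regular representations, with [xi n] in the role of the
    indicator of [Un n]. Measure theory enters only when these properties are verified for Haar
    measure. *)
Variables (R : realType) (H : hilbert R) (lam rho : G -> H -> H) (xi : nat -> H).
Local Notation ip := (hdot H).
Implicit Types (x y z : H).
Hypotheses (ul : urep lam) (ur : urep rho).
Hypothesis lr : forall g h x, lam g (rho h x) = rho h (lam g x).
Hypothesis xiU : forall n u, Un n u -> lam u (xi n) = xi n.
Hypothesis xiO : forall n g, On n g -> lam g (xi n) = rho g^-1%g (xi n).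
Hypothesis xi_orth : forall n g, ~ Un n g -> ip (lam g (xi n)) (xi n) = 0.
Hypothesis xi0 : forall n, xi n <> 0.
Hypothesis xiS : forall m n, (m <= n)%N -> exists us : seq G,
  (forall u, u \in us -> Un m u) /\ xi m = \sum_(u <- us) lam u (xi n).
Hypothesis total : forall E, closed_sub E -> (forall g n, E (lam g (xi n))) -> forall x, E x.

Definition LG : set (H -> H) := bicommutant (range lam).

Lemma range_bounded : range lam `<=` @bounded_op R H.
Proof. by move=> _ [g _ <-]; exact: ubop. Qed.
Lemma LG_bounded : LG `<=` @bounded_op R H.
Proof. by move=> a []. Qed.
Lemma lam_LG g : LG (lam g).
Proof. by apply: (sub_bicommutant range_bounded); exists g. Qed.

Lemma LG_rho a h y : LG a -> a (rho h y) = rho h (a y).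
Proof.
move=> Ma; have cr : commutant (range lam) (rho h).
  by apply: comm_intro; [exact: ubop|move=> _ z [g _ <-]].
by apply/esym; exact: commE Ma cr.
Qed.

Lemma commutant_lam b : commutant (range lam) b <->
  bounded_op b /\ forall g x, lam g (b x) = b (lam g x).
Proof.
split=> [cb|[bb h]]; last by apply: comm_intro => // _ x [g _ <-].
by split=> [|g x]; [exact: comm_bounded cb|apply: (commE _ cb); exists g].
Qed.

Lemma fixp_LG Q : gsub Q -> LG (fixp lam Q).
Proof.
move=> gQ; apply: comm_intro; first exact: fixp_bop.
move=> b x /commutant_lam[bb hb]; by apply: fixp_comm_ops.
Qed.

Lemma xi_nsq_gt0 n : 0 < nsq (xi n). Proof. exact/nsq_gt0/xi0. Qed.

Lemma xi_ip n g h : ip (lam g (xi n)) (lam h (xi n)) =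
  if `[< Un n (h^-1 * g)%g >] then (nsq (xi n))%:C%C else 0.
Proof.
rewrite -(uip ul h^-1%g) uVK // -uM //; case: asboolP => [u|/xi_orth //].
by rewrite xiU // ipxxE.
Qed.

(** The algebraic span of the translates of [xi m] by [On m]. As an inductive predicate it allows
    identities to be proved on translates and extended by linearity. *)
Inductive Fm m : H -> Prop :=
| Fm0 : Fm m 0
| FmP (a : R[i]) x y : Fm m x -> Fm m y -> Fm m (a *: x + y)
| Fm_lam g : On m g -> Fm m (lam g (xi m)).

Lemma xi_Fm j m n g : (j <= n)%N -> (m <= n)%N -> On j g -> Fm n (lam g (xi m)).
Proof.
move=> jn mn Og; have [us [hus ->]] := xiS mn; rewrite (lin_sum (ulin ul g)).
rewrite big_seq; apply: (big_ind (Fm n)); first exact: Fm0.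
  by move=> x y hx hy; rewrite -[x]scale1r; exact: FmP.
move=> u /hus uu; rewrite -uM //; apply: Fm_lam.
have [_ om _] := On_gsub n; apply: om; first exact: On_mono Og.
by apply: (On_mono mn); apply: Un_On.
Qed.

Lemma Fm_mono m n : (m <= n)%N -> Fm m `<=` Fm n.
Proof.
by move=> mn y; elim=> [|a x z _ hx _ hz|g Og]; [exact: Fm0|exact: FmP|exact: xi_Fm Og].
Qed.

Lemma Fm_dense x (e : R) : 0 < e -> exists m y, Fm m y /\ nsq (x - y) < e.
Proof.
move=> e0; have cP : closed_sub (adherent [set y | exists m, Fm m y]).
  apply: adherent_closed; first by exists 0; exact: Fm0.
  move=> a y z [m hy] [n hz]; exists (maxn m n); apply: FmP.
    exact: Fm_mono (leq_maxl _ _) _ hy.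
  exact: Fm_mono (leq_maxr _ _) _ hz.
have [|y [m hy] xy] := total cP _ x _ e0; last by exists m, y.
move=> g n; apply: sub_adherent; have [j Oj] := On_ex g; exists (maxn j n).
by apply: (xi_Fm _ _ Oj); rewrite ?leq_maxl ?leq_maxr.
Qed.

Lemma rho_xi n u : Un n u -> rho u (xi n) = xi n.
Proof.
have [_ _ uv] := Un_gsub n => uu; rewrite -{1}(invgK u) -xiO; first by rewrite xiU //; exact: uv.
by apply: Un_On; exact: uv.
Qed.

(** As [xi m] is a sum of [Un m]-translates of [xi n], it is, up to their number [c], the average of
    [xi n] over [Un m]. The translations can be taken on the right as well, because [Un m] lies in
    [On n]. *)
Lemma xi_fixp m n : (m <= n)%N -> exists2 c : R[i], c != 0 &
  xi m = c *: fixp lam (Un m) (xi n) /\ xi m = c *: fixp rho (Un m) (xi n).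
Proof.
move=> mn; have [us [hus e]] := xiS mn; have gU := Un_gsub m; have [_ _ uv] := gU.
exists (size us)%:R.
  by apply/eqP => us0; apply: (@xi0 m); rewrite e; case: (us) us0 => [|u s /eqP]; rewrite ?big_nil ?pnatr_eq0.
split.
- rewrite -(@fixp_id _ _ _ _ ul (Un m) (xi m)); last by move=> u; exact: xiU.
  rewrite {1}e (lin_sum (fixp_lin ul _)) scaler_nat.
  rewrite (eq_big_seq (fun=> fixp lam (Un m) (xi n))).
    by rewrite big_const_seq count_predT iter_addr_0.
  by move=> u /hus uu; rewrite fixp_absorb.
- rewrite -(@fixp_id _ _ _ _ ur (Un m) (xi m)); last by move=> u; exact: rho_xi.
  rewrite {1}e (lin_sum (fixp_lin ur _)) scaler_nat.
  rewrite (eq_big_seq (fun=> fixp rho (Un m) (xi n))).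
    by rewrite big_const_seq count_predT iter_addr_0.
  move=> u /hus uu; rewrite xiO; last by apply: (On_mono mn); apply: Un_On.
  by rewrite fixp_absorb //; exact: uv.
Qed.

(* Thus operators of the commutant, built from [rho], act on [xi m] like the corresponding
   operators of the algebra. *)
Lemma fixp_rho_xi m n Q : (m <= n)%N -> gsub Q -> Q `<=` On n ->
  (forall u h, Un m u -> Q h -> Q (u * h * u^-1)%g) ->
  fixp rho Q (xi m) = fixp lam Q (xi m).
Proof.
move=> mn gQ Qn nQ; have gU := Un_gsub m.
have [_ _ QV] := gQ; have [_ _ uv] := gU.
have [c c0 [ek ek']] := xi_fixp mn.
have QU (s : G -> H -> H) x : urep s ->
    fixp s Q (fixp s (Un m) x) = fixp s (Un m) (fixp s Q x).
  move=> us'; apply: (fixp_comm_ops us' _ gU (fixp_bop us' _)) => u y uu.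
  apply/esym; apply: fixp_norm => // h Qh; last exact: nQ.
  by have := nQ _ _ (uv _ uu) Qh; rewrite invgK.
(* With [Q] inside [On n], right translation of [xi n] by [Q] is left translation by the inverse,
   which [fixp lam Q] absorbs. So the left projection of [xi m] is right-invariant; symmetrically
   for [fr], and the two projections commute. *)
have fl : fixed rho Q (fixp lam Q (xi m)).
  move=> h Qh; rewrite ek (linZ (fixp_lin ul _)) (linZ (ulin ur h)); congr (_ *: _).
  rewrite !(fixp_two_rep _ _ ur ul) // -{1}(invgK h) -xiO; last exact: Qn (QV _ Qh).
  by rewrite !QU // fixp_absorb //; exact: QV.
have fr : fixed lam Q (fixp rho Q (xi m)).
  move=> h Qh; rewrite ek' (linZ (fixp_lin ur _)) (linZ (ulin ul h)); congr (_ *: _).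
  rewrite !(fixp_two_rep _ _ ul ur) // xiO; last exact: Qn.
  by rewrite !QU // fixp_absorb //; exact: QV.
rewrite -[RHS](fixp_id ur fl) -[LHS](fixp_id ul fr).
by apply: fixp_two.
Qed.

(** The finite parameter for [fixp_orbit] is [rule_of v]. Elements with equal rules differ by
    [Un (m + 3)]; this group is normalized by [g] and fixes [xi m]. The bound on the orbit is
    therefore independent of [m]. *)
Lemma orbit_avg m v a b g : size v.2 = m -> (m <= a)%N -> (b <= m + 3)%N -> On (m + 3) g ->
  exists o : seq H, [/\ (0 < size o <= #|{: local_rule}|)%N,
    forall h, Qn v a b h -> lam (h * g)%g (xi m) \in o,
    forall y, y \in o -> exists2 h, Qn v a b h & y = lam (h * g)%g (xi m)
  & fixp lam (Qn v a b) (lam g (xi m)) = (size o)%:R^-1 *: \sum_(y <- o) y].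
Proof.
move=> e ma bm Og; have gQ := Qn_gsub v a b; have [q1 _ _] := gQ.
have hr h h' : Qn v a b h -> Qn v a b h' -> rule_of v h = rule_of v h' ->
    lam h (lam g (xi m)) = lam h' (lam g (xi m)).
  move=> Qh Qh' r; have := @rule_of_eq v a b h h'; rewrite e => /(_ ma bm Qh Qh' r) u.
  have [_ _ ov] := On_gsub (m + 3).
  have := Un_norm (ov _ Og) u; rewrite invgK => /(Un_anti (leq_addr 3 m))/xiU u'.
  rewrite -[in RHS]u' -!uM //; congr (lam _ _).
  by rewrite !mulgA mulgK mulgV mul1g.
have [s [s1 s2 s3 s4]] := fixp_orbit ul gQ hr.
exists s; split => //.
- by rewrite s1 andbT; have := s2 _ q1; case: (s).
- by move=> h /s2; rewrite -uM.
- by move=> y /s3[h Qh ->]; exists h => //; rewrite -uM.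
Qed.

(** The square of [4 / N ^ 2], where [N] is the number of local rules: 4 is the coefficient of the
    product of projections in a product of two reflections, and each of two orbit averages
    contributes [1 / N]. *)
Definition gap : R := 16 / #|{: local_rule}|%:R ^+ 4.

Lemma card_rule_gt0 : 0 < #|{: local_rule}|%:R :> R.
Proof.
by rewrite ltr0n; apply/card_gt0P; exists [ffun w => w].
Qed.
Lemma gap_gt0 : 0 < gap.
Proof. by rewrite divr_gt0 // exprn_gt0 // card_rule_gt0. Qed.

Lemma ip_avg (o o' : seq H) : ip ((size o)%:R^-1 *: \sum_(y <- o) y) ((size o')%:R^-1 *: \sum_(z <- o') z) =
  ((size o)%:R^-1 * (size o')%:R^-1 : R)%:C%C * \sum_(y <- o) \sum_(z <- o') ip y z.
Proof.
rewrite ipZl ipZr !natrVC realC_conj mulrA -rmorphM; congr (_ * _).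
by rewrite linear_sumlz; apply: eq_bigr => y _; rewrite linear_sumr.
Qed.

(** The translate [z] of [xi m] by [h1 * h2] is orthogonal to [B], while its inner product with [A]
    is at least [4 / N ^ 2] times [nsq (xi m)], with [N] the number of local rules. Hence the
    component of [A] along [z] is lost in [ip A B]. *)
Lemma reflections_gap m v : size v.2 = m ->
  sqmod (ip (refl lam (Qn v m.+1 (m + 3)) (refl lam (Qn v m (m + 2)) (xi m)))
            (refl lam (Qn v m (m + 2)) (refl lam (Qn v m.+1 (m + 3)) (xi m))))
  <= nsq (xi m) ^+ 2 * (1 - gap).
Proof.
move=> e; have [h1 [h2 [Q1h Q2h hnot]]] := noncommuting_pair e.
set Q1 := Qn v m.+1 (m + 3) in Q1h hnot *; set Q2 := Qn v m (m + 2) in Q2h hnot *.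
set x := xi m; pose ka := (h1 * h2)%g; pose z := lam ka x.
have g1 : gsub Q1 := Qn_gsub _ _ _; have g2 : gsub Q2 := Qn_gsub _ _ _.
have [e1 _ v1] := g1; have [e2 _ v2] := g2.
have m23 : (m + 2 <= m + 3)%N by rewrite leq_add2l.
have [oe om ov] := On_gsub (m + 3).
have O1 : On (m + 3) h1 by case: Q1h.
have O2 : On (m + 3) h2 by apply: (On_mono m23); case: Q2h.
have x1 : lam 1%g x = x by exact: u1.
have [r1 [/andP[r10 r1n] r1a r1b r1c]] := orbit_avg e (leqnSn m) (leqnn _) oe.
have [r2 [/andP[r20 r2n] r2a r2b r2c]] := orbit_avg e (leqnn m) m23 oe.
have [r3 [/andP[r30 r3n] r3a r3b r3c]] := orbit_avg e (leqnSn m) (leqnn _) O2.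
have [r4 [/andP[r40 r4n] r4a r4b r4c]] := orbit_avg e (leqnn m) m23 (om _ _ O1 O2).
rewrite -/Q1 -/Q2 -/x ?x1 in r1c r2c r3c r4c.
(* A non-zero inner product would write [h1 * h2] as a product of elements of [Q2], [Q1] and [Un m]
   in this order, which [noncommuting_pair] excludes. *)
have z0 a b : Q1 a -> Q2 b -> ip (lam a x) (lam b z) = 0.
  move=> Qa Qb; rewrite /z -uM // xi_ip; case: asboolP => // u; exfalso.
  have [_ _ uv] := Un_gsub m; apply: (hnot b^-1%g a _ (v2 _ Qb) Qa (uv _ u)).
  by rewrite !invgM !invgK !mulgA mulgK mulVg mul1g.
have zz (y w : H) : y \in r1 -> w \in r4 -> ip y w = 0.
  by move=> /r1b[a Qa ->] /r4b[b Qb ->]; rewrite mulg1 (uM ul b) z0.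
have z0' a : Q1 a -> ip (lam a x) z = 0.
  by move=> Qa; have := z0 a 1%g Qa e2; rewrite (u1 ul).
have z0'' b : Q2 b -> ip x (lam b z) = 0.
  by move=> Qb; have := z0 1%g b e1 Qb; rewrite (u1 ul).
have q1z : ip (fixp lam Q1 x) z = 0.
  rewrite r1c ipZl linear_sumlz big_seq big1 ?mulr0 // => y /r1b[a Qa ->].
  by rewrite mulg1; exact: z0'.
have q2z : ip (fixp lam Q2 x) z = 0.
  rewrite fixp_sa // r4c ipZr linear_sumr big_seq big1 ?mulr0 // => y /r4b[b Qb ->].
  by rewrite (uM ul b); exact: z0''.
have xz : ip x z = 0 by have := z0' _ e1; rewrite (u1 ul).
have q21z : ip (fixp lam Q2 (fixp lam Q1 x)) z = 0.
  rewrite fixp_sa // r1c r4c ip_avg big_seq big1 ?mulr0 // => y yo.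
  by rewrite big_seq big1 // => w wo; exact: zz.
set A := refl lam Q1 _; set B := refl lam Q2 (refl lam Q1 x).
have Bz : ip B z = 0.
  rewrite /B {1}/refl !(ipBl, ipDl) /refl (linB (fixp_lin ul Q2)) (linD (fixp_lin ul Q2)).
  by rewrite !(ipBl, ipDl) q1z q2z xz q21z !(addr0, subr0, oppr0).
have Az : ip A z = 4 * ip (fixp lam Q2 x) (fixp lam Q1 (lam h2 x)).
  rewrite /A {1}/refl !(ipBl, ipDl) /refl (linB (fixp_lin ul Q1)) (linD (fixp_lin ul Q1)).
  rewrite !(ipBl, ipDl) q1z q2z xz (fixp_sa ul Q1) /z /ka uM // fixp_absorb //; ring.
have N0 := xi_nsq_gt0 m; rewrite -/x in N0.
have posR g h : 0 <= Re (ip (lam g x) (lam h x)).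
  by rewrite xi_ip; case: asboolP => // _; rewrite /= ltW.
(* All inner products of translates of [x] are non-negative, so one term bounds the double sum from
   below: the translate by [h2] belongs to both orbits. *)
have low : nsq x / #|{: local_rule}|%:R ^+ 2 <= Re (ip (fixp lam Q2 x) (fixp lam Q1 (lam h2 x))).
  rewrite r2c r3c ip_avg Defs.ReM /= mul0r subr0.
  have S : nsq x <= Re (\sum_(y <- r2) \sum_(w <- r3) ip y w).
    have hw : lam h2 x \in r2 by have := r2a _ Q2h; rewrite mulg1.
    have hw' : lam h2 x \in r3 by have := r3a _ e1; rewrite mul1g.
    rewrite Re_sum.
    have p (y : H) : y \in r2 -> 0 <= Re (\sum_(w <- r3) ip y w).
      move=> /r2b[b _ ->]; rewrite Re_sum.
      rewrite big_seq sumr_ge0 // => w /r3b[a _ ->]; exact: posR.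
    apply: le_trans (ler_sum_mem hw p).
    rewrite Re_sum.
    have p' (w : H) : w \in r3 -> 0 <= Re (ip (lam h2 x) w) by move=> /r3b[a _ ->]; exact: posR.
    by apply: le_trans (ler_sum_mem hw' p'); rewrite -/(nsq _) unsq.
  have c0 := card_rule_gt0.
  have s20 : 0 < (size r2)%:R :> R by rewrite ltr0n.
  have s30 : 0 < (size r3)%:R :> R by rewrite ltr0n.
  have i2 : #|{: local_rule}|%:R^-1 <= (size r2)%:R^-1 :> R.
    by rewrite lef_pV2 ?posrE // ler_nat.
  have i3 : #|{: local_rule}|%:R^-1 <= (size r3)%:R^-1 :> R.
    by rewrite lef_pV2 ?posrE // ler_nat.
  rewrite mulrC -exprVn expr2.
  have ci0 : 0 <= #|{: local_rule}|%:R^-1 :> R by rewrite invr_ge0 ltW.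
  by apply: ler_pM (mulr_ge0 ci0 ci0) (ltW N0) (ler_pM ci0 ci0 i2 i3) S.
have nA : nsq A = nsq x by rewrite /A !refl_nsq.
have nB : nsq B = nsq x by rewrite /B !refl_nsq.
have nz : nsq z = nsq x by exact: unsq.
clearbody A B.
pose c := ip A z * ((nsq x)^-1)%:C%C.
have -> : ip A B = ip (A - c *: z) B.
  by rewrite ipBl ipZl (ipJ z) Bz rmorph0 mulr0 subr0.
apply: le_trans (CS _ _) _; rewrite nB expr2 -mulrA mulrC ler_wpM2l ?(ltW N0) //.
rewrite nsqB nA nsqZ nz ipZr sqmodM.
have : (4 * (nsq x / #|{: local_rule}|%:R ^+ 2)) ^+ 2 <= sqmod (ip A z).
  apply: (@le_trans _ _ (Re (ip A z) ^+ 2)); last by rewrite lerDl sqr_ge0.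
  rewrite Az Defs.ReM [X in X - _](_ : _ = 4 * Re (ip (fixp lam Q2 x) (fixp lam Q1 (lam h2 x)))); last first.
    by rewrite natrC.
  have -> : Im (4 : R[i]) = 0 by rewrite natrC.
  have p0 : 0 <= nsq x / #|{: local_rule}|%:R ^+ 2.
    by rewrite divr_ge0 ?ltW // exprn_gt0 // card_rule_gt0.
  rewrite mul0r subr0; have q0 := le_trans p0 low.
  by rewrite ler_pXn2r ?nnegrE ?(mulr_ge0 (ler0n _ 4) p0) ?(mulr_ge0 (ler0n _ 4) q0) // ler_wpM2l.
have -> : Re (Num.conj c * ip A z) = sqmod (ip A z) / nsq x.
  by rewrite Defs.ReM Defs.ReJ Defs.ImJ /c Defs.ReM Defs.ImM /sqmod /=; ring.
rewrite /gap; move: (sqmod (ip A z)) => s.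
rewrite [sqmod _]/sqmod /= expr0n /= addr0.
move: #|_|%:R card_rule_gt0 (nsq x) N0 => n n0 N N0' hs.
have : (4 * (N / n ^+ 2)) ^+ 2 / N <= s / N
  by rewrite ler_pM2r ?invr_gt0.
have -> : (4 * (N / n ^+ 2)) ^+ 2 / N = N * (16 / n ^+ 4) by field; rewrite !gt_eqF.
have -> : s * (N^-1) ^+ 2 * N = s / N by field; rewrite gt_eqF.
by move: (16 / n ^+ 4) (s / N) => g t; lra.
Qed.

(** On translates by [p] and [q] in [Lin v] both sides are indicators: [p^-1 * q * r] is in [Un m]
    exactly when [p^-1 * q] and [r] are. Each argument is then extended to the closed span, one at a
    time. *)
Lemma Lin_Lout_ip m v x y r : size v.2 = m -> orbit_span lam (Lin v) (xi m) x ->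
  orbit_span lam (Lin v) (xi m) y -> Lout v r ->
  ip x (lam r y) * (nsq (xi m))%:C%C = ip x y * ip (xi m) (lam r (xi m)).
Proof.
move=> e hx hy hr; set N := (nsq _)%:C%C; set ka := ip (xi m) _.
suff : ip x (N *: lam r y - Num.conj ka *: y) = 0.
  rewrite ipBr !ipZr conjCK realC_conj => /eqP; rewrite subr_eq0 => /eqP h.
  by rewrite mulrC h mulrC.
move: x hx; apply: (orbit_span_ind (orth_closed _)) => p hp /=.
suff : ip y (N *: lam (r^-1 * p)%g (xi m) - Num.conj (Num.conj ka) *: lam p (xi m)) = 0.
  rewrite !ipBr !ipZr !conjCK realC_conj => /eqP; rewrite subr_eq0 => /eqP h.
  have := congr1 Num.conj h; rewrite !conjM realC_conj conjCK -!ipJ => h'.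
  by rewrite -(uip ul r^-1%g _ (lam r y)) uVK // -uM // h' subrr.
move: y hy; apply: (orbit_span_ind (orth_closed _)) => q hq /=.
have [_ lm lv] := Lin_gsub v; have [_ om ov] := Lout_gsub v.
rewrite conjCK ipBr !ipZr realC_conj !xi_ip /ka -[X in ip X (lam r _)](u1 ul) xi_ip mulg1.
have gU := Un_gsub m; have [_ _ uv] := gU.
have -> : ((r^-1 * p)^-1 * q = (p^-1 * q) * r)%g.
  by rewrite invgM invgK -!mulgA -(Lin_Lout_comm hq hr).
have key : Un m (p^-1 * q * r)%g <-> Un m (p^-1 * q)%g /\ Un m r.
  by have := @Lin_Lout_U v (p^-1 * q)%g r; rewrite e; apply => //; apply: lm => //; exact: lv.
have rr : Un m r^-1%g <-> Un m r by split=> [/uv|/uv]; rewrite ?invgK.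
case: (asboolP (Un m (p^-1 * q * r)%g)) => [/key[h1 h2]|nk].
  by rewrite (asboolT (rr.2 h2)) (asboolT h1) realC_conj subrr.
case: (asboolP (Un m (p^-1 * q)%g)) => [h1|_]; last by rewrite !mulr0 subrr.
case: asboolP => [/rr h2|_]; last by rewrite rmorph0 mulr0 mul0r subrr.
by exfalso; apply: nk; exact/key.
Qed.

(** Subspaces attached to the inside and to the outside of [v] behave like tensor factors with
    [xi m] as the common unit vector, up to normalization. For outside translates by [s] and [t],
    the operators [a] and [b] commute with these, and [Lin_Lout_ip] applies with [r = s^-1 * t]. *)
Lemma independent_ip m v (a b : H -> H) x y : size v.2 = m -> bounded_op a -> bounded_op b ->
  (forall r z, Lout v r -> a (lam r z) = lam r (a z)) ->
  (forall r z, Lout v r -> b (lam r z) = lam r (b z)) ->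
  orbit_span lam (Lin v) (xi m) (a (xi m)) -> orbit_span lam (Lin v) (xi m) (b (xi m)) ->
  orbit_span lam (Lout v) (xi m) x -> orbit_span lam (Lout v) (xi m) y ->
  ip (a x) (b y) * (nsq (xi m))%:C%C = ip (a (xi m)) (b (xi m)) * ip x y.
Proof.
move=> e ba bb ca cb ha hb hx hy; set N := (nsq _)%:C%C; set ka := ip (a (xi m)) _.
suff : ip x (N *: hadj a (b y) - Num.conj ka *: y) = 0.
  rewrite ipBr !ipZr conjCK realC_conj -adjP // => /eqP; rewrite subr_eq0 => /eqP h.
  by rewrite mulrC h.
move: x hx; apply: (orbit_span_ind (orth_closed _)) => s hs /=.
suff : ip y (N *: hadj b (a (lam s (xi m))) - ka *: lam s (xi m)) = 0.
  rewrite !ipBr !ipZr conjCK realC_conj -!adjP // => /eqP; rewrite subr_eq0 => /eqP h.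
  have := congr1 Num.conj h; rewrite !conjM realC_conj conjCK -!ipJ => h'.
  by rewrite h' subrr.
move: y hy; apply: (orbit_span_ind (orth_closed _)) => t ht /=.
rewrite ipBr !ipZr realC_conj -adjP // ca // cb //.
have [_ om ov] := Lout_gsub v; have hr := om _ _ (ov _ hs) ht.
have := Lin_Lout_ip e ha hb hr; rewrite -/ka.
rewrite uM // -[in ip _ (lam s^-1%g _)](uVK ul s (a _)) uip // => h.
rewrite (ipJ _ (lam s (a _))) (ipJ (lam t (xi m))) -(realC_conj (nsq (xi m))) -/N.
rewrite -!rmorphM mulrC h uM // -(uip ul s) uKV // subrr //.
Qed.

Local Notation lp a b m := (prodr lam (fun v => Qn v a b) (level m)).
Local Notation rp a b m := (prodr rho (fun v => Qn v a b) (level m)).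

Lemma Qn_refl_comm (s : G -> H -> H) v w a b a' b' x : urep s -> size v.2 = size w.2 -> v <> w ->
  refl s (Qn v a b) (refl s (Qn w a' b') x) = refl s (Qn w a' b') (refl s (Qn v a b) x).
Proof.
move=> us e vw; apply: refl_refl_comm => //; [exact: Qn_gsub|exact: Qn_gsub|].
by move=> g h; exact: Qn_comm.
Qed.

Lemma Qn_refl_comm' (s : G -> H -> H) v w a b x : urep s -> size v.2 = size w.2 ->
  refl s (Qn v a b) (refl s (Qn w a b) x) = refl s (Qn w a b) (refl s (Qn v a b) x).
Proof. by move=> us e; have [->//|/eqP vw] := eqVneq v w; exact: Qn_refl_comm. Qed.

(** Conjugation by [g] permutes the groups [Qn v a b] along with the vertices of level [m], and the
    order of the factors is irrelevant because they commute. *)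
Lemma lam_prodr m a b g x : (m <= a)%N -> (m <= b)%N -> On m g ->
  lam g (lp a b m x) = lp a b m (lam g x).
Proof.
move=> ma mb Og.
have h l y : {subset l <= level m} -> lam g (prodr lam (fun v => Qn v a b) l y) =
    prodr lam (fun v => Qn v a b) [seq vact m g v | v <- l] (lam g y).
  elim: l y => //= v l IHl y lm; rewrite -IHl; last by move=> w wl; apply: lm; rewrite inE wl orbT.
  have ev : size v.2 = m by apply/eqP; rewrite -mem_level; apply: lm; rewrite mem_head.
  rewrite /refl (linB (ulin ul g)) (linD (ulin ul g)).
  rewrite (@fixp_norm _ _ _ _ ul (Qn v a b) (Qn (vact m g v) a b)) //.
    by move=> k'; exact: Qn_conj_inv.
  by move=> k'; exact: Qn_conj.
rewrite h //; apply: prodr_perm => //; last exact: vact_perm.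
move=> v w y /mapP[v' _ ->] /mapP[w' _ ->].
by apply: Qn_refl_comm' => //; rewrite !size_pre.
Qed.

(** The right reflection at [v] is moved past the left ones at the other vertices, becomes a left
    reflection when it reaches [xi m], and is moved back. *)
Lemma rho_prodr_xi m a b : (m <= a)%N -> (m <= b)%N -> rp a b m (xi m) = lp a b m (xi m).
Proof.
move=> ma mb.
suff h l : {subset l <= level m} -> prodr rho (fun v => Qn v a b) l (xi m) =
    prodr lam (fun v => Qn v a b) l (xi m) by exact: h.
elim: l => //= v l IHl lm; rewrite IHl; last by move=> w wl; apply: lm; rewrite inE wl orbT.
have ev w : w \in v :: l -> size w.2 = m by move=> /lm; rewrite mem_level => /eqP.
have gQ w : gsub (Qn w a b) by exact: Qn_gsub.
rewrite prodr_commute; last first.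
  move=> w y _; apply: refl_commute; first exact: refl_lin.
  move=> z; apply/esym; apply: refl_commute; first exact: fixp_lin.
  by move=> z'; exact: fixp_two.
have -> : refl rho (Qn v a b) (xi m) = refl lam (Qn v a b) (xi m).
  rewrite /refl (@fixp_rho_xi m b) // => [g []//|u h' uu Qh].
  have := Qn_conj (ev v (mem_head _ _)) ma mb (Un_On uu) Qh.
  by rewrite vact_Un // ev ?mem_head.
apply/esym; apply: prodr_commute => w y wl; apply: Qn_refl_comm' => //.
by rewrite !ev ?mem_head // inE wl orbT.
Qed.

Lemma rho_prodr_Fm m a b x : (m <= a)%N -> (m <= b)%N -> Fm m x -> rp a b m x = lp a b m x.
Proof.
move=> ma mb; elim=> [|c y z _ hy _ hz|g Og].
- by rewrite !(lin0 (prodr_lin _ _ _)).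
- by rewrite !prodr_lin // hy hz.
- rewrite -lam_prodr // -rho_prodr_xi //; apply/esym; apply: prodr_commute => v y _.
  apply: refl_commute; first exact: ulin.
  by move=> z; apply: fixp_two_rep => //; exact: Qn_gsub.
Qed.

Lemma rho_prodr_commutant m a b : commutant (range lam) (rp a b m).
Proof.
apply/commutant_lam; split; first exact: prodr_bop.
move=> g x; apply: prodr_commute => v y _; apply: refl_commute; first exact: ulin.
by move=> z; apply: fixp_two_rep => //; exact: Qn_gsub.
Qed.

Lemma prodr_LG m a b : LG (lp a b m).
Proof.
apply: comm_intro; first exact: prodr_bop.
move=> c x /commutant_lam[bc hc]; apply: prodr_commute => v y _.
apply: refl_commute; first exact: bop_lin.
by move=> z; apply: fixp_comm_ops => //; exact: Qn_gsub.
Qed.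

(** Replacing left products by right ones reverses their order, since the right product commutes
    with the left one that acts first. *)
Lemma prodr_Fm_comm m a b a' b' x : (m <= a)%N -> (m <= b)%N -> (m <= a')%N -> (m <= b')%N ->
  Fm m x -> rp a' b' m (rp a b m x) = lp a b m (lp a' b' m x).
Proof.
move=> ma mb ma' mb' Fx; rewrite (@rho_prodr_Fm m a b x) //.
by rewrite (commE _ (prodr_LG m a b) (rho_prodr_commutant m a' b')) rho_prodr_Fm.
Qed.

(* On [Fm m], the operator [w m] of the algebra coincides with the operator [w' m] of the
   commutant, and the subspaces [Fm m] increase to a dense one. *)
Lemma asymptotically_central (w w' : nat -> H -> H) a z (e : R) :
  (forall m, linear (w m)) -> (forall m x, nsq (w m x) = nsq x) ->
  (forall m, commutant (range lam) (w' m)) -> (forall m x, nsq (w' m x) = nsq x) ->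
  (forall m x, Fm m x -> w' m x = w m x) ->
  LG a -> 0 < e -> exists m0, forall m, (m0 <= m)%N -> nsq (a (w m z) - w m (a z)) < e.
Proof.
move=> lw nw cw nw' ww Ma e0; have ba := LG_bounded Ma; have la := bop_lin ba.
have [c c0 hc] := bounded_nsq ba.
have p : 0 < e / (16 * (c + 1)) by rewrite divr_gt0 // mulr_gt0 // addr_gt0.
have [L [y [Fy zy]]] := Fm_dense z p; have [L' [y' [Fy' ay]]] := Fm_dense (a y) p.
exists (maxn L L') => m; rewrite geq_max => /andP[Lm Lm'].
have e1 : a (w m y) = w' m (a y).
  by rewrite -ww; [exact/esym/(commE _ Ma)|exact: Fm_mono Lm _ Fy].
have e2 : w' m y' = w m y' by apply: ww; exact: Fm_mono Lm' _ Fy'.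
have lw' := bop_lin (comm_bounded (cw m)).
have -> : a (w m z) - w m (a z) = (a (w m (z - y)) + w' m (a y - y')) +
    (w m (y' - a y) + w m (a (y - z))).
  rewrite (linB (lw m)) (linB la) (linB lw') e1 e2 !(linB (lw m)) (linB la) (linB (lw m)).
  by rewrite !addrA !subrK.
apply: le_lt_trans (nsqD_le _ _) _.
have := nsqD_le (a (w m (z - y))) (w' m (a y - y')).
have := nsqD_le (w m (y' - a y)) (w m (a (y - z))).
rewrite !nw nw' (nsqBC y').
have := hc (w m (z - y)); rewrite nw; have := hc (y - z); rewrite (nsqBC y).
move: zy ay; rewrite !ltr_pdivlMr ?mulr_gt0 // ?addr_gt0 //.
move: (nsq (z - y)) (nsq_ge0 (z - y)) (nsq (a y - y')) (nsq_ge0 (a y - y')) (nsq (a (y - z))) (nsq (a (w m (z - y)))).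
move: (nsq (_ + _)) (nsq (_ + _)) => A B C C0 D D0 E F *.
nra.
Qed.

Local Notation xm m := (lp m.+1 (m + 3) m).
Local Notation ym m := (lp m (m + 2) m).

(* The factors of the products at the vertices other than [v] are independent of those at [v],
   so that the inner product factorizes and [reflections_gap] applies to one factor. *)
Lemma commutator_xi_gap m : sqmod (ip (xm m (ym m (xi m))) (ym m (xm m (xi m)))) <=
  nsq (xi m) ^+ 2 * (1 - gap).
Proof.
have [v [l el]] : exists v l, level m = v :: l.
  have : (Ordinal hk, nseq m d0) \in level m by rewrite mem_level size_nseq.
  by case: (level m) => // v l _; exists v, l.
have ev w : w \in level m -> size w.2 = m by rewrite mem_level => /eqP.
have vl : v \in level m by rewrite el mem_head.
have lsub w : w \in l -> w \in level m /\ v <> w.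
  move=> wl; split; first by rewrite el inE wl orbT.
  by have := level_uniq m; rewrite el => /andP[+ _] vw; rewrite vw wl.
set x := xi m; set N := nsq x.
pose r1 := refl lam (Qn v m.+1 (m + 3)); pose r2 := refl lam (Qn v m (m + 2)).
pose X := prodr lam (fun v => Qn v m.+1 (m + 3)) l.
pose Y := prodr lam (fun v => Qn v m (m + 2)) l.
have Xr2 y : X (r2 y) = r2 (X y).
  apply/esym; apply: prodr_commute => w z /lsub[wl vw].
  by apply: Qn_refl_comm => //; rewrite !ev.
have Yr1 y : Y (r1 y) = r1 (Y y).
  apply/esym; apply: prodr_commute => w z /lsub[wl vw].
  by apply: Qn_refl_comm => //; rewrite !ev.
rewrite el /= -/(X _) -/(Y _) -/r1 -/r2.
have -> : r1 (X (r2 (Y x))) = (r1 \o r2) (X (Y x)) by rewrite Xr2.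
have -> : r2 (Y (r1 (X x))) = (r2 \o r1) (Y (X x)) by rewrite Yr1.
have oc := orbit_span_closed; have b1 := refl_bop ul; have vm := ev _ vl.
have lo a b w h y : w \in l -> Qn w a b h -> orbit_span lam (Lout v) x y ->
    orbit_span lam (Lout v) x (lam h y).
  move=> /lsub[wl vw] Qh; apply: orbit_span_inv => // k' hk'.
  have [_ om _] := Lout_gsub v; apply: om => //.
  by apply: Qn_Lout Qh => //; rewrite !ev.
have hX y : orbit_span lam (Lout v) x y -> orbit_span lam (Lout v) x (X y).
  by apply: prodr_inv => // [w _|w h z wl Qh]; [exact: Qn_gsub|exact: lo Qh].
have hY y : orbit_span lam (Lout v) x y -> orbit_span lam (Lout v) x (Y y).
  by apply: prodr_inv => // [w _|w h z wl Qh]; [exact: Qn_gsub|exact: lo Qh].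
have xo : orbit_span lam (Lout v) x x.
  by rewrite -{2}(u1 ul x); apply: orbit_span_in; case: (Lout_gsub v).
have li a b h y : Qn v a b h -> orbit_span lam (Lin v) x y -> orbit_span lam (Lin v) x (lam h y).
  move=> /Qn_Lin Qh; apply: orbit_span_inv => // k' hk'.
  by have [_ om _] := Lin_gsub v; exact: om.
have hr a b y : orbit_span lam (Lin v) x y -> orbit_span lam (Lin v) x (refl lam (Qn v a b) y).
  by apply: refl_inv => //; [exact: Qn_gsub|move=> h z; exact: li].
have xin : orbit_span lam (Lin v) x x.
  by rewrite -{2}(u1 ul x); apply: orbit_span_in; case: (Lin_gsub v).
have cr a b r z : Lout v r -> refl lam (Qn v a b) (lam r z) = lam r (refl lam (Qn v a b) z).
  move=> hr'; apply/esym; apply: refl_commute; first exact: ulin.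
  move=> y; apply: fixp_ucomm => //; first exact: Qn_gsub.
  by move=> h /Qn_Lin hh; apply/esym; exact: Lin_Lout_comm hr'.
have E : ip ((r1 \o r2) (X (Y x))) ((r2 \o r1) (Y (X x))) * N%:C%C =
    ip ((r1 \o r2) x) ((r2 \o r1) x) * ip (X (Y x)) (Y (X x)).
  apply: (@independent_ip m v) => //.
  - by apply: bop_comp; exact: b1.
  - by apply: bop_comp; exact: b1.
  - by move=> r z hr'; rewrite /r1 /r2 /= !cr.
  - by move=> r z hr'; rewrite /r1 /r2 /= !cr.
  - by apply: (hr); apply: (hr).
  - by apply: (hr); apply: (hr).
  - exact/hX/hY.
  - exact/hY/hX.
have N0 := xi_nsq_gt0 m; rewrite -/x -/N in N0.
have := congr1 (@sqmod R) E; rewrite !sqmodM [sqmod N%:C%C]/sqmod /= expr0n /= addr0 => {}E.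
rewrite -(@ler_pM2r _ (N ^+ 2)) ?exprn_gt0 // E.
apply: ler_pM; rewrite ?sqmod_ge0 //; first exact: reflections_gap.
by apply: le_trans (CS _ _) _; rewrite !prodr_nsq // expr2.
Qed.

(** On translates by [On m] in different cosets of [Un m] both sides vanish: the products of
    reflections stay in the closed span of [Lall m]-translates of [xi m], and overlapping spans
    would force [r] into [Lall m], hence into [Un m]. On one coset the products commute with the
    translation. *)
Lemma commutator_ip m z z' : Fm m z -> Fm m z' ->
  ip (xm m (ym m z)) (ym m (xm m z')) * (nsq (xi m))%:C%C =
  ip (xm m (ym m (xi m))) (ym m (xm m (xi m))) * ip z z'.
Proof.
move=> hz hz'; set N := (nsq _)%:C%C; set ka := ip _ (ym m (xm m (xi m))).
have lX : linear (xm m) by exact: prodr_lin.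
have lY : linear (ym m) by exact: prodr_lin.
elim: hz => [|a x y _ hx _ hy|g Og].
- by rewrite (lin0 lY) (lin0 lX) !ip0l mul0r mulr0.
- by rewrite lY lX !ipDl !ipZl mulrDl mulrDr -mulrA hx hy; ring.
elim: hz' => [|a x y _ hx _ hy|h Oh].
- by rewrite (lin0 lX) (lin0 lY) !ip0r mul0r mulr0.
- by rewrite lX lY !ipDr !ipZr mulrDl mulrDr -mulrA hx hy; ring.
have [_ om ov] := On_gsub m; have [_ um uv] := Un_gsub m; have [le1 lm lv] := Lall_gsub m.
have m1 : (m <= m.+1)%N by []. have m2 : (m <= m + 2)%N by rewrite leq_addr.
have m3 : (m <= m + 3)%N by rewrite leq_addr.
pose r := (h^-1 * g)%g; have Or : On m r by apply: om => //; exact: ov.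
rewrite -!lam_prodr // -[in LHS](uip ul h^-1%g) uVK // -uM // -/r xi_ip -/r.
case: asboolP => [u|nu]; first by rewrite !lam_prodr // xiU.
rewrite mulr0; set A := xm m (ym m _); set B := ym m _.
have oc := orbit_span_closed; have xo : orbit_span lam (Lall m) (xi m) (xi m).
  by rewrite -{2}(u1 ul (xi m)); exact: orbit_span_in.
have inv a b y : (m <= a)%N -> orbit_span lam (Lall m) (xi m) y ->
    orbit_span lam (Lall m) (xi m) (lp a b m y).
  move=> ma hy; apply: (prodr_inv ul (E := orbit_span lam (Lall m) (xi m))) => //.
    by move=> v _; exact: Qn_gsub.
  move=> v k' y' _ Qk hy'.
  apply: orbit_span_inv hy' => // k'' hk''; apply: lm => //; exact: Qn_Lall Qk.
have hA : orbit_span lam (Lall m) (xi m) A by do 2![apply: (inv) => //].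
have hB : orbit_span lam (Lall m) (xi m) B by do 2![apply: (inv) => //].
suff -> : ip (lam r A) B = 0 by rewrite mul0r.
rewrite -(uip ul r^-1%g) uVK //; move: hA; apply: (orbit_span_ind (orth_closed _)) => p hp /=.
rewrite -(uip ul r) uKV // -uM // ipJ.
suff -> : ip B (lam (r * p)%g (xi m)) = 0 by rewrite rmorph0.
move: hB; apply: (orbit_span_ind (orth_closed _)) => q hq /=.
rewrite xi_ip; case: asboolP => // u; exfalso; apply: nu; split => // x.
have := lm _ _ (lm _ _ hq (uv _ u).2) (lv _ hp).
by rewrite invgM invgK !mulgA mulgV mul1g mulgK; exact.
Qed.

(** Both vectors have the norm of [z], and their inner product is at most
    [sqrt (1 - gap) <= 1 - gap / 2] times [nsq z] in modulus. *)
Lemma commutator_gap m z : Fm m z ->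
  gap * nsq z <= nsq (xm m (ym m z) - ym m (xm m z)).
Proof.
move=> hz; have N0 := xi_nsq_gt0 m; have E := commutator_ip hz hz.
have := congr1 (@sqmod R) E; rewrite !sqmodM {E}; move: (commutator_xi_gap m).
rewrite ipxxE [sqmod (nsq (xi m))%:C%C]/sqmod [sqmod (nsq z)%:C%C]/sqmod /= !expr0n /= !addr0.
rewrite (nsqB (xm m (ym m z))) !prodr_nsq //.
move: (ip (xm m (ym m z)) _) => c; move: (ip _ _) => c' h1 h2.
have h3 : Re c ^+ 2 <= sqmod c by rewrite lerDl sqr_ge0.
have s0 : 0 <= sqmod c by exact: sqmod_ge0.
have s0' : 0 <= sqmod c' by exact: sqmod_ge0.
move: (nsq z) (nsq_ge0 z) (Re c) (sqmod c) (sqmod c') gap gap_gt0 (nsq (xi m)) N0 h1 h2 h3 s0 s0'.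
move=> M M0 r s s' g g0 N N0 h1 h2 h3 s0 s0'.
have g1 : g <= 1.
  by have := le_trans s0' h1; rewrite pmulr_rge0 ?exprn_gt0 // subr_ge0.
have h4 : s <= M ^+ 2 * (1 - g).
  rewrite -(@ler_pM2r _ (N ^+ 2)) ?exprn_gt0 // h2.
  by have := ler_wpM2r (sqr_ge0 M) h1; lra.
have : r <= M * (1 - g / 2).
  rewrite leNgt; apply/negP => h5.
  have p0 : 0 <= M * (1 - g / 2) by rewrite mulr_ge0 //; lra.
  have : (M * (1 - g / 2)) ^+ 2 < r ^+ 2 by rewrite ltr_pXn2r // nnegrE // (le_trans p0) // ltW.
  have : M ^+ 2 * (1 - g) <= (M * (1 - g / 2)) ^+ 2.
    by rewrite exprMn ler_wpM2l ?sqr_ge0 // !expr2; nra.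
  by lra.
by lra.
Qed.

(** For [f] in the range of [e], asymptotic centrality makes [e (X (e (Y f)))] close to [X (Y f)],
    and likewise with [X] and [Y] exchanged. The two left-hand sides are equal, so the commutator is
    small at [f], and [commutator_gap] makes [f] small. *)
Lemma no_abelian_idempotent e : LG e -> e \o e = e ->
  (forall x y : H -> H, LG x -> LG y -> e \o x \o e \o y \o e = e \o y \o e \o x \o e) ->
  e = @op_zero R H.
Proof.
move=> Me ee eab; have be := LG_bounded Me; have le := bop_lin be.
apply/funext => z; apply: nsq_eq0; set f := e z.
have ef : e f = f by rewrite /f -[in RHS]ee.
have [c c0 hc] := bounded_nsq be.
(* The commutator at the approximant [y] of [f] is bounded by [8 * (2 * c + 2) + 8] times [eps].
   Division by [gap] bounds [nsq y], and the return to [f] doubles this and adds 2. *)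
pose C := 2 + 2 * gap^-1 * (8 * (2 * c + 2) + 8).
apply/eqP; rewrite eq_le nsq_ge0 andbT.
have g0 := gap_gt0.
have C0 : 0 <= C by rewrite addr_ge0 // !mulr_ge0 ?invr_ge0 ?ltW //; lra.
apply: (ler_small (k := C)) => // eps eps0; rewrite add0r.
have m1 m : (m <= m.+1)%N by []. have m2 m : (m <= m + 2)%N by rewrite leq_addr.
have m3 m : (m <= m + 3)%N by rewrite leq_addr.
have lp_lin a b m : linear (lp a b m) by exact: prodr_lin.
have lp_nsq a b m y : nsq (lp a b m y) = nsq y by exact: prodr_nsq.
have rp_nsq a b m y : nsq (rp a b m y) = nsq y by exact: prodr_nsq.
have [N1 h1] := asymptotically_central f (w := fun m => xm m) (w' := fun m => rp m.+1 (m + 3) m)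
  (fun m => lp_lin _ _ m) (fun m => lp_nsq _ _ m) (fun m => rho_prodr_commutant m _ _)
  (fun m => rp_nsq _ _ m) (fun m x Fx => rho_prodr_Fm (m1 m) (m3 m) Fx) Me eps0.
have [N2 h2] := asymptotically_central f (w := fun m => ym m) (w' := fun m => rp m (m + 2) m)
  (fun m => lp_lin _ _ m) (fun m => lp_nsq _ _ m) (fun m => rho_prodr_commutant m _ _)
  (fun m => rp_nsq _ _ m) (fun m x Fx => rho_prodr_Fm (leqnn m) (m2 m) Fx) Me eps0.
have [N3 h3] : exists N, forall m, (N <= m)%N -> nsq (e (xm m (ym m f)) - xm m (ym m (e f))) < eps.
  apply: (asymptotically_central f (w := fun m => xm m \o ym m)
    (w' := fun m => rp m (m + 2) m \o rp m.+1 (m + 3) m)) => //.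
  - by move=> m a x y /=; rewrite !lp_lin.
  - by move=> m x /=; rewrite !lp_nsq.
  - by move=> m; apply: comm_comp; exact: rho_prodr_commutant.
  - by move=> m x /=; rewrite !rp_nsq.
  - by move=> m x Fx /=; rewrite prodr_Fm_comm.
have [N4 h4] : exists N, forall m, (N <= m)%N -> nsq (e (ym m (xm m f)) - ym m (xm m (e f))) < eps.
  apply: (asymptotically_central f (w := fun m => ym m \o xm m)
    (w' := fun m => rp m.+1 (m + 3) m \o rp m (m + 2) m)) => //.
  - by move=> m a x y /=; rewrite !lp_lin.
  - by move=> m x /=; rewrite !lp_nsq.
  - by move=> m; apply: comm_comp; exact: rho_prodr_commutant.
  - by move=> m x /=; rewrite !rp_nsq.
  - by move=> m x Fx /=; rewrite prodr_Fm_comm.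
have [L [y [Fy fy]]] := Fm_dense f eps0.
pose m := (maxn L (maxn (maxn N1 N2) (maxn N3 N4)))%N.
have hm : [/\ L <= m, N1 <= m, N2 <= m, N3 <= m & N4 <= m]%N.
  by rewrite /m !leq_max !leqnn !orbT; split.
have {hm}[Lm /h1 {}h1 /h2 {}h2 /h3 {}h3 /h4 {}h4] := hm.
have {Fy} Fy := Fm_mono Lm Fy.
rewrite !ef in h1 h2 h3 h4.
have E : e (xm m (e (ym m f))) = e (ym m (e (xm m f))).
  have := congr1 (fun a => a f) (eab _ _ (prodr_LG m m.+1 (m + 3)) (prodr_LG m m (m + 2))).
  by rewrite /= ef.
have lx := lp_lin m.+1 (m + 3)%N m; have ly := lp_lin m (m + 2)%N m.
have lxn := lp_nsq m.+1 (m + 3)%N m; have lyn := lp_nsq m (m + 2)%N m.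
have := commutator_gap Fy; move: lx ly lxn lyn E h1 h2 h3 h4.
move: (xm m) (ym m) => X Y lx ly lxn lyn E h1 h2 h3 h4 hg.
have a1 : nsq (e (X (e (Y f))) - X (Y f)) <= (2 * c + 2) * eps.
  apply: le_trans (nsq_tri (e (X (Y f))) _ _) _; rewrite -(linB le) -(linB lx).
  have := hc (X (e (Y f) - Y f)); rewrite lxn; move: h3 (ler_wpM2l (ltW c0) (ltW h2)).
  by lra.
have a2 : nsq (e (Y (e (X f))) - Y (X f)) <= (2 * c + 2) * eps.
  apply: le_trans (nsq_tri (e (Y (X f))) _ _) _; rewrite -(linB le) -(linB ly).
  have := hc (Y (e (X f) - X f)); rewrite lyn; move: h4 (ler_wpM2l (ltW c0) (ltW h1)).
  by lra.
have a3 : nsq (X (Y f) - Y (X f)) <= 4 * (2 * c + 2) * eps.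
  apply: le_trans (nsq_tri (e (X (e (Y f)))) _ _) _; rewrite nsqBC {2}E.
  by move: a1 a2; lra.
have a4 : nsq (X (Y y) - Y (X y)) <= (8 * (2 * c + 2) + 8) * eps.
  have -> : X (Y y) - Y (X y) = (X (Y f) - Y (X f)) + (X (Y (y - f)) - Y (X (y - f))).
    rewrite (linB ly y) (linB lx (Y y)) (linB lx y) (linB ly (X y)).
    by rewrite [RHS]addrC opprB [RHS]addrACA subrK addrAC subrr add0r.
  apply: le_trans (nsqD_le _ _) _.
  have := nsqB_le (X (Y (y - f))) (Y (X (y - f))); rewrite !lxn !lyn !lxn (nsqBC y).
  by move: a3 fy; lra.
apply: (@le_trans _ _ (2 * nsq (f - y) + 2 * nsq y)).
  by have := nsqD_le (f - y) y; rewrite subrK.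
have : nsq y <= gap^-1 * (8 * (2 * c + 2) + 8) * eps.
  by rewrite -mulrA -ler_pdivrMl ?invr_gt0 // invrK (le_trans hg).
rewrite /C; move: (gap^-1) (nsq y) (nsq (f - y)) fy => g u v fy; lra.
Qed.

Lemma LG_von_neumann : von_neumann LG.
Proof.
have cb : commutant (range lam) `<=` @bounded_op R H by move=> a [].
split=> [a []//|a Ma|].
  exists (hadj a); last exact/adj_pair/LG_bounded.
  apply: comm_adj Ma => // b cb'; exists (hadj b); last exact/adj_pair/cb.
  apply: comm_adj cb'; first exact: range_bounded.
  by move=> _ [g _ <-]; exists (lam g^-1%g); [exists g^-1%g|exact: uadj].
apply/seteqP; split=> [a|].
  by apply: comm_anti; apply: sub_bicommutant.
exact/sub_bicommutant/LG_bounded.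
Qed.

(** * The trace on the corners of the fixed-vector projections *)

Section Trace.
Variable n : nat.
Local Notation p := (fixp lam (Un n)).
Local Notation x0 := (xi n).

Let gU := Un_gsub n.
Let Mp : LG p. Proof. exact: fixp_LG. Qed.
Let pp : p \o p = p. Proof. by apply/funext => x; exact: fixp_idem. Qed.
Let lp : linear p. Proof. exact: fixp_lin. Qed.
Let p_xi : p x0 = x0. Proof. by apply: fixp_id => // u; exact: xiU. Qed.

(** The trace identity for [a] and a translation. On a finer [xi m], with [g] in [On m], the
    translation becomes a right one and commutes with [a]; it is then carried to the other argument
    and turned back into a left one. Averaging over [Un n] on either side relates [xi m] to
    [xi n]. *)
Lemma corner_lam_ip a g : corner p LG a -> ip (a (lam g x0)) x0 = ip (a x0) (lam g^-1%g x0).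
Proof.
move=> /(cornerP LG_von_neumann a Mp pp)[Ma pa ap].
have ba := LG_bounded Ma; have la := bop_lin ba.
have [m [nm Om]] : exists m, (n <= m)%N /\ On m g.
  have [m Om] := On_ex g; exists (maxn n m); split; first exact: leq_maxl.
  by apply: On_mono Om; exact: leq_maxr.
have [c c0 [e1 e2]] := xi_fixp nm.
have [_ _ ov] := On_gsub m; have gUm := gU.
pose q := fixp rho (Un n); have lq : linear q := fixp_lin ur _.
have q_a y : q (a y) = a (q y).
  by apply/esym; apply: fixp_comm_ops => // h z hh; rewrite LG_rho.
have pq y : p (q y) = q (p y) by exact: fixp_two.
have qx : q x0 = x0 by apply: fixp_id => // u; exact: rho_xi.
have q_lam h y : q (lam h y) = lam h (q y).
  by apply/esym; apply: fixp_two_rep.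
have p_rho h y : p (rho h y) = rho h (p y).
  by apply/esym; apply: fixp_two_rep.
have e3 : a (lam g x0) = q (rho g^-1%g (a x0)).
  rewrite {1}e2 -/q -(linZ lq) -q_lam (linZ (ulin ul g)) (xiO Om) -(linZ (ulin ur _)) -q_a.
  by rewrite LG_rho // (linZ la) -(ap (xi m)) -(linZ la) -e1.
have e4 : rho g x0 = p (lam g^-1%g (c *: xi m)).
  rewrite {1}e1 -(linZ lp) -p_rho (linZ (ulin ur g)) -{1}(invgK g) -xiO; last exact: ov.
  by rewrite -(linZ (ulin ul _)).
rewrite e3 (fixp_sa ur) -/q qx -(uip ur g) uKV // e4 -(fixp_sa ul) pa.
by rewrite -{1}qx -q_a -/q (fixp_sa ur) -/q q_lam (linZ lq) -e2.
Qed.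

(* The graph, on a dense subspace, of the conjugate-linear map sending [a (xi n)] to the image of
   [xi n] under the adjoint of [a], for [a] in the corner. *)
Inductive conj_rel : H -> H -> Prop :=
| CR0 : conj_rel 0 0
| CRP (a : R[i]) x x' y y' : conj_rel x x' -> conj_rel y y' ->
    conj_rel (a *: x + y) (Num.conj a *: x' + y')
| CR_lam g : conj_rel (p (lam g x0)) (p (lam g^-1%g x0)).

Lemma conj_rel_sym (v v' : H) : conj_rel v v' -> conj_rel v' v.
Proof.
elim=> [|a x x' y y' _ h1 _ h2|g]; first exact: CR0.
  by have := CRP (Num.conj a) h1 h2; rewrite conjCK.
by have := CR_lam g^-1%g; rewrite invgK.
Qed.

Lemma conj_rel_adj (y : H -> H) (v v' : H) : corner p LG y -> conj_rel v v' ->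
  ip (hadj y x0) v = ip v' (y x0).
Proof.
move=> My; have [My' py yp] := (cornerP LG_von_neumann y Mp pp).1 My.
have b := LG_bounded My'; elim=> [|a x x' z z' _ h1 _ h2|g].
- by rewrite ip0l ip0r.
- by rewrite ipDl ipDr ipZr ipZl h1 h2.
- by rewrite adjP' // yp fixp_sa // py ipJ corner_lam_ip // -ipJ.
Qed.

Lemma conj_rel_ip (u u' v v' : H) : conj_rel u u' -> conj_rel v v' -> ip u' v = ip v' u.
Proof.
move=> hu hv; elim: hu => [|a x x' y y' _ h1 _ h2|g].
- by rewrite ip0l ip0r.
- by rewrite ipDl ipDr ipZr ipZl h1 h2.
have Mg : corner p LG (p \o lam g \o p) by exists (lam g) => //; exact: lam_LG.
have [My' py yp] := (cornerP LG_von_neumann _ Mp pp).1 Mg.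
have := conj_rel_adj Mg hv; rewrite /= p_xi => <-; congr (ip _ v).
apply: ip_ext => z; rewrite adjP' /=; last exact: LG_bounded.
rewrite -[RHS](fixp_sa ul) p_xi fixp_sa //.
by rewrite -(uip ul g) uKV.
Qed.

(** The vector [a x0] is invariant under [p] and under its right counterpart [q], so both may be
    applied to an approximant in [Fm m]. They send a translate of [xi m] to a multiple of the vector
    [p (lam g x0)]. *)
Lemma conj_rel_dense a : corner p LG a -> adherent [set v : H | exists v' : H, conj_rel v v'] (a x0).
Proof.
move=> /(cornerP LG_von_neumann a Mp pp)[Ma pa ap] e e0.
have [L [y [Fy hy]]] := Fm_dense (a x0) e0.
have [m [nm {}Fy]] : exists m, (n <= m)%N /\ Fm m y.
  exists (maxn n L); split; first exact: leq_maxl.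
  by apply: Fm_mono Fy; exact: leq_maxr.
have [c c0 [e1 e2]] := xi_fixp nm.
pose q := fixp rho (Un n); have lq : linear q := fixp_lin ur _.
have qx : q x0 = x0 by apply: fixp_id => // u; exact: rho_xi.
have q_a z : q (a z) = a (q z).
  by apply/esym; apply: fixp_comm_ops => //; [exact: LG_bounded|move=> h u hh; rewrite LG_rho].
have -> : a x0 = p (q (a x0)) by rewrite q_a qx pa.
exists (p (q y)); last first.
  rewrite -(linB lp) -(linB lq); apply: le_lt_trans (fixp_contr _ _ _) _ => //.
  by apply: le_lt_trans (fixp_contr _ _ _) _.
elim: Fy => [|b x z _ [x' hx] _ [z' hz]|g Og].
- by exists 0; rewrite (lin0 lq) (lin0 lp); exact: CR0.
- by exists (Num.conj b *: x' + z'); rewrite lq lp; exact: CRP.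
have -> : p (q (lam g (xi m))) = c^-1 *: p (lam g x0) + 0.
  have q_lam h z : q (lam h z) = lam h (q z) by apply/esym; apply: fixp_two_rep.
  rewrite addr0 q_lam e2 (linZ (ulin ul g)) (linZ lp) scalerA mulVf // scale1r.
  by [].
by eexists; apply: CRP; [exact: CR_lam|exact: CR0].
Qed.

Lemma corner_hadj (y : H -> H) : corner p LG y -> [/\ bounded_op y, corner p LG (hadj y) & hadj (hadj y) = y].
Proof.
move=> My; have [My' py yp] := (cornerP LG_von_neumann y Mp pp).1 My.
have b := LG_bounded My'; split => //; last first.
  by apply/esym/adj_eq; [exact: adj_bounded|exact/adjoint_sym/adj_pair].
apply/(cornerP LG_von_neumann _ Mp pp); split.
- exact: vn_adj LG_von_neumann _ My'.
- by move=> x; apply: ip_ext => z; rewrite fixp_sa // !adjP' // yp.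
- by move=> x; apply: ip_ext => z; rewrite !adjP' // fixp_sa // py.
Qed.

(** With [v] close to [hadj y x0] and [v'] its partner, [v] and [v'] have the same norm, and the
    inner product of [hadj y x0] with [v] is that of [v'] with [y x0]. Non-negativity of
    [nsq (v' - y x0)] then gives the bound. *)
Lemma corner_adj_nsq (y : H -> H) : corner p LG y -> nsq (hadj y x0) <= nsq (y x0).
Proof.
move=> My; have [_ Mya _] := corner_hadj My.
apply: (ler_small (k := 1)) => // e e0; rewrite mul1r.
have [v [v' hv] hyv] := conj_rel_dense Mya e0.
have E := conj_rel_adj My hv; have E' := conj_rel_ip (conj_rel_sym hv) hv.
have nv : nsq v' = nsq v by rewrite /nsq E'.
have := nsq_ge0 (v' - y x0); have := nsqB (hadj y x0) v; rewrite (nsqB v') -E nv.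
by move: hyv; lra.
Qed.

(** Equality of [nsq (hadj y x0)] and [nsq (y x0)], polarized at the sum of [hadj a] and [b], gives
    the real part of the identity; replacing [a] by [i a] gives the imaginary part. *)
Lemma corner_trace (a b : H -> H) : corner p LG a -> corner p LG b ->
  ip (a (b x0)) x0 = ip (b (a x0)) x0.
Proof.
have nE (y : H -> H) : corner p LG y -> nsq (hadj y x0) = nsq (y x0).
  move=> My; have [_ Mya yy] := corner_hadj My; apply/eqP.
  by rewrite eq_le corner_adj_nsq // -{1}yy corner_adj_nsq.
have ReE (a' b' : H -> H) : corner p LG a' -> corner p LG b' ->
    Re (ip (a' (b' x0)) x0) = Re (ip (b' (a' x0)) x0).
  move=> Ma Mb; have [ba Maa aa] := corner_hadj Ma; have [bb Mbb bb'] := corner_hadj Mb.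
  pose y x := 1 *: hadj a' x + b' x.
  have My : corner p LG y by exact: (corner_lc LG_von_neumann Mp pp).
  have [by_ Mya yy] := corner_hadj My.
  have yE x : y x = hadj a' x + b' x by rewrite /y scale1r.
  have hyE : hadj y x0 = a' x0 + hadj b' x0.
    apply: ip_ext => z; rewrite adjP' // yE ipDr -adjP // ipDl; congr (_ + _).
    by rewrite adjP'.
  have := nE _ My; rewrite hyE yE !nsqD !nE // => /addrI/(mulfI _) E.
  rewrite (ipReC (a' _)) [ip x0 _](_ : _ = ip (hadj a' x0) (b' x0)); last by rewrite adjP'.
  by rewrite -E ?pnatr_eq0 // -adjP.
move=> Ma Mb; have h1 := ReE _ _ Ma Mb.
pose a' (x : H) := 'i%C *: a x + @op_zero R H x.
have Mz : corner p LG (@op_zero R H).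
  by exists (@op_zero R H); [by apply: comm_zero => z []|apply/funext => x /=; rewrite /op_zero (lin0 lp)].
have Ma' : corner p LG a' by exact: (corner_lc LG_von_neumann Mp pp).
have [Mb' _ _] := (cornerP LG_von_neumann b Mp pp).1 Mb.
have := ReE _ _ Ma' Mb; rewrite /a' /op_zero !addr0 (linZ (bop_lin (LG_bounded Mb'))) !ipZl.
move: h1; case: (ip (a _) _) => x y; case: (ip (b _) _) => z w /= -> /=.
by rewrite !mul0r !mul1r !sub0r => /oppr_inj ->.
Qed.
End Trace.

(** Since [a] commutes with right translations, it vanishes on right translates of [xi n]. A left
    translate of [xi m] by [On m] is a right translate, and the projection that [a] absorbs turns
    [xi m] into a multiple of [xi n]. *)
Lemma corner_faithful n (a : H -> H) : LG a -> (forall x, a (fixp lam (Un n) x) = a x) ->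
  a (xi n) = 0 -> a = @op_zero R H.
Proof.
move=> Ma ap a0; have la := bop_lin (LG_bounded Ma); have [c c0 hc] := bounded_nsq (LG_bounded Ma).
apply/funext => x; rewrite /op_zero; apply: nsq_small_eq0 => e e0.
have [|L [y [Fy hy]]] := Fm_dense x (e := e / c); first by rewrite divr_gt0.
have [m [nm {}Fy]] : exists m, (n <= m)%N /\ Fm m y.
  exists (maxn n L); split; first exact: leq_maxl.
  by apply: Fm_mono Fy; exact: leq_maxr.
suff ay : a y = 0.
  rewrite -(subrK y x) (linD la) ay addr0; apply: le_lt_trans (hc _) _.
  by rewrite mulrC -ltr_pdivlMr.
have [b b0 [e1 _]] := xi_fixp nm.
elim: Fy => [|k' u z _ hu _ hz|g Og]; first exact: lin0.
  by rewrite la hu hz scaler0 addr0.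
have [_ _ ov] := On_gsub m.
rewrite (xiO Og) LG_rho // -ap; suff -> : fixp lam (Un n) (xi m) = b^-1 *: xi n.
  by rewrite (linZ la) a0 scaler0 (lin0 (ulin ur _)).
by rewrite e1 scalerA mulVf // scale1r.
Qed.

Lemma fixp_Un_mono m n : (m <= n)%N -> op_le (fixp lam (Un m)) (fixp lam (Un n)).
Proof.
move=> mn x; have fx y : fixed lam (Un m) y -> fixed lam (Un n) y.
  by move=> hy u /(Un_anti mn)/hy.
set P := fixp lam (Un m); set Q := fixp lam (Un n).
have QP y : Q (P y) = P y by apply: fixp_id => //; apply: (fx); exact: fixp_in.
have PQ y : P (Q y) = P y.
  by apply: ip_ext => z; rewrite !fixp_sa // -/P -/Q QP.
have lP : linear P := fixp_lin ul _; have lQ : linear Q := fixp_lin ul _.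
have DD : Q (Q x - P x) - P (Q x - P x) = Q x - P x.
  by rewrite (linB lQ) (linB lP) QP PQ /P /Q !fixp_idem // subrr subr0.
have -> : ip (Q x - P x) x = ip (Q x - P x) (Q x - P x).
  by rewrite -{1}DD ipBl [RHS]ipBr {1}/Q {1}/P !fixp_sa.
by rewrite ipxxE lecR nsq_ge0.
Qed.

(** Vectors of [Fm m] are fixed by [Un n] as soon as [m <= n], because [On n] normalizes [Un n]; and
    these vectors are dense. *)
Lemma fixp_Un_cvg x (e : R) : 0 < e -> exists m, forall n, (m <= n)%N ->
  hnorm (fixp lam (Un n) x - x) < e.
Proof.
move=> e0; have [|m [y [Fy hy]]] := Fm_dense x (e := e ^+ 2 / 4).
  by rewrite divr_gt0 // exprn_gt0.
exists m => n mn; rewrite hnorm_lt //.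
have Py : fixp lam (Un n) y = y.
  have lp : linear (fixp lam (Un n)) by exact: fixp_lin.
  elim: Fy => [|a u z _ hu _ hz|g Og]; first exact: lin0.
    by rewrite lp hu hz.
  apply: fixp_id => // u Uu; have [_ _ ov] := On_gsub n.
  have Og' := On_mono mn Og; rewrite -uM // -[in RHS](@xiU m (g^-1 * u * g)%g).
    by rewrite -uM // !mulgA mulgV mul1g.
  by apply: (Un_anti mn); have := Un_norm (ov _ Og') Uu; rewrite invgK.
apply: le_lt_trans (nsq_tri y _ _) _; rewrite -{1}Py -(linB (fixp_lin ul _)) (nsqBC y).
have := fixp_contr ul (Un n) (x - y); move: hy.
by rewrite ltr_pdivlMr //; lra.
Qed.

Lemma corner_typeII1 n (w : H -> H) : central_projection LG w ->
  typeII1 (corner (fixp lam (Un n) \o w) LG) (fixp lam (Un n) \o w).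
Proof.
move=> hw; have [[bw ww sw] Mw cw] := hw; set p := fixp lam (Un n).
have vM := LG_von_neumann; have Mp : LG p by apply: fixp_LG; exact: Un_gsub.
have pp x : p (p x) = p x by exact: fixp_idem.
have ppE : p \o p = p by apply/funext.
have wx x : w (w x) = w x by rewrite -[in RHS]ww.
have cwp x : p (w x) = w (p x) by exact: (central_comm x hw Mp).
have Mq : LG (p \o w) by exact: vn_comp vM _ _ Mp Mw.
have qq : (p \o w) \o (p \o w) = p \o w.
  by apply/funext => x /=; rewrite -cwp wx pp.
have xin : p (xi n) = xi n by apply: fixp_id => // u; exact: xiU.
have sub a : corner (p \o w) LG a -> corner p LG a.
  move=> /(cornerP vM _ Mq qq)[Ma qa aq]; apply/(cornerP vM _ Mp ppE); split=> // x.
    by rewrite -qa /= pp.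
  by rewrite -(aq (p x)) /= cwp pp -cwp; exact: aq.
split; first by apply: (no_typeI_summand vM no_abelian_idempotent Mq qq).
pose c := nsq (w (xi n)).
have cE : ip (w (xi n)) (xi n) = c%:C%C by rewrite -ipxxE -sw wx.
have faithful a : corner (p \o w) LG a -> a (xi n) = 0 -> a = @op_zero R H.
  by move=> /sub/(cornerP vM _ Mp ppE)[Ma _ ap]; exact: corner_faithful.
(* If [w (xi n)] is 0, faithfulness shows that the corner is zero, and the empty family of traces
   separates it. Otherwise [c] normalizes the trace. *)
have [c0|c0] := eqVneq c 0.
  exists set0; split=> [//|a b Na Nb ab _]; apply: faithful => //.
  have /(cornerP vM _ Mq qq)[Ma qa aq] := Na.
  by rewrite -aq /= (nsq_eq0 c0) /p (lin0 (fixp_lin ul _)) (lin0 (bop_lin (LG_bounded Ma))).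
have cC : c%:C%C != 0 :> R[i] by rewrite fmorph_eq0.
have c_gt0 : 0 < c by rewrite lt_neqAle eq_sym c0 nsq_ge0.
pose tau (a : H -> H) : R[i] := (c%:C%C)^-1 * ip (a (xi n)) (xi n).
exists [set tau]; split=> [_ ->|a b Na Nb ab /(_ tau erefl)]; last first.
  rewrite /tau /= (adjoint_sym ab) ipxxE => /eqP.
  rewrite mulf_eq0 invr_eq0 (negbTE cC) /= fmorph_eq0 => /eqP/nsq_eq0.
  exact: faithful.
split.
- by move=> k' a b _ _; rewrite /tau ipDl ipZl mulrDr mulrCA.
- move=> a b _ _ ab; rewrite /tau /= (adjoint_sym ab) ipxxE -fmorphV -rmorphM lecR.
  by rewrite mulr_ge0 ?invr_ge0 ?nsq_ge0.
- by rewrite /tau /= fixp_sa // -/p xin cE mulVf.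
- by move=> a b /sub Na /sub Nb; rewrite /tau; congr (_ * _); exact: (corner_trace Na Nb).
- move=> D x D0 DN Dsa Ddir Nx xsa xlub eps eps0.
  have Nb : corner (p \o w) LG `<=` @bounded_op R H.
    by move=> a /(corner_sub vM Mq qq)/LG_bounded.
  have [|a Da h] := vector_state_normal Nb (corner_sclosed vM Mq qq) DN Dsa Ddir Nx xlub (xi n) D0 (e := eps * c).
    by rewrite mulr_gt0.
  exists a => //; have Re_tau b : Re (tau b) = c^-1 * Re (ip (b (xi n)) (xi n)).
    by rewrite /tau -fmorphV Defs.ReM /= mul0r subr0.
  rewrite !Re_tau -(ltr_pM2l c_gt0) mulrDr !mulrA divff // !mul1r; move: h.
  by rewrite (mulrC eps).
Qed.

Lemma LG_typeII : typeII LG id.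
Proof.
apply: (typeII_of_net LG_von_neumann no_abelian_idempotent (p := fun n => fixp lam (Un n))).
- by move=> n; apply: fixp_LG; exact: Un_gsub.
- move=> n; split; first exact: fixp_bop.
    by apply/funext => x; exact: fixp_idem.
  by move=> x y; exact: fixp_sa.
- exact: fixp_Un_mono.
- exact: fixp_Un_cvg.
- exact: corner_typeII1.
Qed.

Lemma LG_not_typeI : ~ typeI LG.
Proof.
have vM := LG_von_neumann => tI.
have := corner_not_typeI vM no_abelian_idempotent (vn_id vM) (erefl : id \o id = id).
apply; first by move=> /(congr1 (fun f => f (xi 0))); exact: xi0.
by rewrite (_ : corner id LG = LG) //; apply/seteqP; split=> [_ [a Ma <-]//|a Ma]; exists a.
Qed.
End Regular.
End Ends.

(** * The action of the group on the ends *)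

Section Action.
Variables d k : nat.
Hypothesis hd : (1 < d)%N.
Local Notation vertex := (vertex d k).
Local Notation ends := (ends d k).
Local Notation G := (neretinO d k).
Implicit Types (x y z : ends) (f : vertex -> vertex) (v : vertex) (g h : G).

(** The reversal reflects that vertices store their word last letter first, whereas [pre] lists
    letters from the root. *)
Definition vert n x : vertex := Some (x.1, rev (pre n x).2).

Lemma vert_pre m n x y : vert m x = vert n y -> m = n /\ pre n x = pre n y.
Proof.
move=> [e1 /(congr1 rev)]; rewrite !revK => e2.
have mn : m = n by have := congr1 size e2; rewrite !size_mkseq.
by split=> //; rewrite /pre e1 -mn e2 mn.
Qed.
Lemma pre_vert n x y : pre n x = pre n y -> vert n x = vert n y.
Proof. by move=> e; rewrite /vert e; case: e => ->. Qed.

Lemma vert_depth n x : depth (vert n x) = n.+1.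
Proof. by rewrite /= size_rev size_mkseq. Qed.
Lemma vert_out m n x : (m <= n)%N <-> ~ vball m (vert n x).
Proof. by rewrite /vball /mkset vert_depth ltnNge; split=> [h|]; [exact/negP/negPn|move/negP/negPn]. Qed.
Lemma vert_outP m n x : (m <= n)%N -> (~` vball m) (vert n x).
Proof. by move=> /(vert_out m n x).1. Qed.
Lemma vert_parent n x : parent (vert n.+1 x) = Some (vert n x).
Proof. by rewrite /vert /pre /= /mkseq -addn1 iotaD map_cat rev_cat. Qed.
Lemma vert_ex n v : depth v = n.+1 -> exists x, v = vert n x.
Proof.
case: v => [[i t]|//] [e]; exists (end_of hd (i, rev t)).
by rewrite /vert pre_end_of ?size_rev ?e //= take_oversize ?size_rev ?e // revK.
Qed.
Lemma vert_out_ex m v : ~ vball m v -> exists n x, (m <= n)%N /\ v = vert n x.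
Proof.
rewrite /vball /=; case E : (depth v) => [|n] h; first by case: h.
have [x vx] := vert_ex E; exists n, x; split=> //.
by move/negP: h; rewrite -ltnNge ltnS.
Qed.

(** A class of almost automorphisms determines its map only off a finite set, so its effect on an
    end is read far out on the ray. The same depth appears on both sides because elements of the
    group preserve depth outside a ball. *)
Definition ray_lim f x y := exists N, forall n, (N <= n)%N -> vert n y = f (vert n x).

Lemma ray_lim_uniq f x y y' : ray_lim f x y -> ray_lim f x y' -> y = y'.
Proof.
move=> [N h] [N' h']; apply: (@pre_ext _ _ (maxn N N')) => n.
rewrite geq_max => /andP[hn hn']; have := h n hn; rewrite -h' //.
by move=> /vert_pre[].
Qed.

Lemma cofin_vert f f' : cofin_eq f f' -> exists N, forall n x, (N <= n)%N -> f (vert n x) = f' (vert n x).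
Proof.
move=> /finite_sub_vball[N hN]; exists N => n x Nn; apply: contrapT => ne.
exact: (vert_out N n x).1 Nn (hN _ ne).
Qed.

Lemma ray_lim_cofin f f' x y : cofin_eq f f' -> ray_lim f x y -> ray_lim f' x y.
Proof.
move=> /cofin_vert[N hN] [N' h]; exists (maxn N N') => n.
by rewrite geq_max => /andP[hn hn']; rewrite -hN // h.
Qed.

Lemma ray_lim_comp f f' x y z : ray_lim f x y -> ray_lim f' y z -> ray_lim (f' \o f) x z.
Proof.
move=> [N h] [N' h']; exists (maxn N N') => n.
by rewrite geq_max => /andP[hn hn'] /=; rewrite -h // h'.
Qed.

Lemma ray_lim_ex m f x : forest_iso (vball m) (vball m) f ->
  exists y, forall n, (m <= n)%N -> vert n y = f (vert n x).
Proof.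
move=> fi; have sub : finite_subtree (vball m : set vertex) := vball_subtree _ _ m.
have /choice[c hc] n : exists z, (m <= n)%N -> f (vert n x) = vert n z.
  have [mn|_] := leqP m n; last by exists x.
  have /vert_out no : (m <= n)%N := mn.
  have [z e] := vert_ex (etrans (vball_depth fi (no x)) (vert_depth n x)); by exists z.
have step n : (m <= n)%N -> pre n (c n.+1) = pre n (c n).
  move=> mn; have mn' := leqW mn.
  have := forest_iso_parent sub sub fi ((vert_out _ _ _).1 mn') ((vert_out _ _ _).1 mn) (vert_parent n x).
  by rewrite !hc // vert_parent => /Some_inj/vert_pre[].
have mono n n' : (m <= n)%N -> (n <= n')%N -> pre n (c n') = pre n (c n).
  move=> mn; elim: n' => [|n' IHn]; first by rewrite leqn0 => /eqP ->.
  rewrite leq_eqVlt => /orP[/eqP <- //|]; rewrite ltnS => nn'.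
  by rewrite -IHn //; apply: (pre_le nn'); apply: step; exact: leq_trans nn'.
exists ((c m).1, fun i => (c (maxn m i.+1)).2 i) => n mn; rewrite hc //; apply: pre_vert.
apply/preP; split=> [|i hi] /=.
  by have /preP[->] := mono m n (leqnn m) mn.
have im : (maxn m i.+1 <= n)%N by rewrite geq_max mn.
have /preP[_ ->//] := mono _ _ (leq_maxl m i.+1) im; exact: leq_maxr.
Qed.

Definition rmap g : vertex -> vertex := aa_map (repr (val g)).

Lemma neretinO_rep g : exists m p, [/\ forest_iso (vball m) (vball m) (aa_map p),
  val g = nclass p & cofin_eq (aa_map p) (rmap g)].
Proof.
have /asboolP[m _ [p [pd pc e]]] := valP g; exists m, p; split=> //.
  by rewrite -{1}pd -pc; exact: aa_iso.
by apply/nclassP; rewrite -e nclass_repr.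
Qed.

Definition act g x : ends := xget x [set y | ray_lim (rmap g) x y].

Lemma actP g x : ray_lim (rmap g) x (act g x).
Proof.
rewrite /act; case: xgetP => [y -> //|h]; have [m [p [pi _ pg]]] := neretinO_rep g.
by have [y hy] := ray_lim_ex x pi; case: (h y); apply: ray_lim_cofin pg _; exists m.
Qed.
Lemma actE g x y : ray_lim (rmap g) x y -> act g x = y.
Proof. exact: ray_lim_uniq (actP g x). Qed.

Lemma act_rep g p x y : val g = nclass p -> ray_lim (aa_map p) x y -> act g x = y.
Proof.
by move=> e h; apply: actE; apply: ray_lim_cofin h; apply/nclassP; rewrite -e nclass_repr.
Qed.

Lemma act_vert g m p n x : forest_iso (vball m) (vball m) (aa_map p) -> val g = nclass p ->
  (m <= n)%N -> vert n (act g x) = aa_map p (vert n x).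
Proof. by move=> pi e mn; have [y hy] := ray_lim_ex x pi; rewrite (act_rep e (y := y)) ?hy //; exists m. Qed.

Lemma act1 : act 1%g = id.
Proof.
by apply/funext => x; apply: (@act_rep _ (aa_one d k)); [|exists 0].
Qed.

Lemma actM g h : act (g * h)%g = act g \o act h.
Proof.
apply/funext => x /=; apply: actE.
have := ray_lim_comp (actP h x) (actP g (act h x)); apply: ray_lim_cofin.
have := aa_mulP (repr (val g)) (repr (val h)); move=> /cofin_eq_sym/cofin_eq_trans; apply.
by apply/nclassP; rewrite nclass_repr.
Qed.

Lemma act_inj : injective act.
Proof.
move=> g h e; apply: val_inj.
have [m [p [pi eg _]]] := neretinO_rep g; have [m' [p' [pi' eh _]]] := neretinO_rep h.
rewrite eg eh; apply/nclassP; apply: sub_finite_set (@finite_vball d k (maxn m m')) => v /= ne.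
apply: contrapT => /vert_out_ex[n [x [mn vx]]]; apply: ne; move: mn; rewrite geq_max => /andP[mn mn'].
by rewrite vx -(act_vert x pi' eh mn') -(act_vert x pi eg mn) e.
Qed.

Lemma act_ex g : exists n, forest_homeo n (act g).
Proof.
have [m [p [pi e _]]] := neretinO_rep g; exists m; split.
  by exists (act g^-1%g) => x; have := actM; rewrite -[act _ (act _ x)]/((act _ \o act _) x) => <-; rewrite ?mulVg ?mulgV act1.
move=> j x y mj; split=> h.
  have := pre_vert h; rewrite !(act_vert _ pi e) // => E.
  have [[_ inj _] _] := pi.
  by have /vert_pre[] : vert j x = vert j y by apply: inj E; apply/mem_set; exact: vert_outP.
by have /vert_pre[] : vert j (act g x) = vert j (act g y) by rewrite !(act_vert _ pi e) // (pre_vert h).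
Qed.

(** The forest map induced by a map of ends: the image of a vertex is read from one end below it.
    Its values near the root are arbitrary unless [s] respects the tree from there on. *)
Definition vmap (s : ends -> ends) v : vertex :=
  if v is Some (i, t) then vert (size t) (s (end_of hd (i, rev t))) else Defs.root d k.

Lemma pre_end n x : pre n (end_of hd (pre n x)) = pre n x.
Proof. by rewrite pre_end_of ?size_mkseq // take_oversize ?size_mkseq //; case: (pre n x). Qed.

Lemma vmap_vert n s j x : forest_homeo n s -> (n <= j)%N -> vmap s (vert j x) = vert j (s x).
Proof.
move=> [_ h] nj; rewrite /vmap /vert size_rev size_mkseq revK -/(vert _ _); apply: pre_vert.
by apply/h => //; exact: pre_end.
Qed.

Lemma vmap_iso n s : forest_homeo n s -> forest_iso (vball n) (vball n) (vmap s).
Proof.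
move=> hs; have [[s' ss' s's] h] := hs; split; first split.
- move=> _ /= /vert_out_ex[j [x [nj ->]]]; rewrite (vmap_vert _ hs nj); exact: vert_outP.
- move=> _ _ /set_mem/vert_out_ex[j [x [nj ->]]] /set_mem/vert_out_ex[j' [x' [nj' ->]]].
  rewrite !(vmap_vert _ hs) // => /vert_pre[e]; rewrite e => /h e'.
  by apply: pre_vert; apply: e'.
- move=> _ /= /vert_out_ex[j [x [nj ->]]]; exists (vert j (s' x)); first exact: vert_outP.
  by rewrite (vmap_vert _ hs nj) s's.
have key j j' x y : (n <= j)%N -> (n <= j')%N -> parent (vmap s (vert j x)) = Some (vmap s (vert j' y)) <->
    parent (vert j x) = Some (vert j' y).
  move=> nj nj'; rewrite !(vmap_vert _ hs) //; split=> e; have := parent_depth e; rewrite !vert_depth => -[ej].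
    move: e nj; rewrite ej !vert_parent => /Some_inj/vert_pre[_ /h e] nj.
    by congr Some; apply: pre_vert; exact: e.
  move: e nj; rewrite ej !vert_parent => /Some_inj/vert_pre[_ e] nj.
  by congr Some; apply: pre_vert; apply/h.
move=> _ _ /vert_out_ex[j [x [nj ->]]] /vert_out_ex[j' [x' [nj' ->]]].
by apply/orP/orP => -[/eqP/key h'|/eqP/key h']; [left|right|left|right]; apply/eqP; exact: h'.
Qed.

Lemma act_onto n s : forest_homeo n s -> exists g, act g = s.
Proof.
move=> hs; have si := vmap_iso hs.
pose p := AlmostAut (vball_subtree _ _ n) (vball_subtree _ _ n) (card_eqxx _) si.
have pO : neretinO_pred (nclass p) by apply/asboolP; exists n => //; exists p.
pose g : G := Sub (nclass p) pO; exists g; apply/funext => x.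
have e : val g = nclass p by rewrite SubK.
by apply: (act_rep e); exists n => j nj; exact/esym/(vmap_vert _ hs nj).
Qed.

Local Notation "''On' n" := (On act n) (at level 8).
Local Notation "''Un' n" := (Un act n) (at level 8).

Lemma tree_autP (f : @tree_aut d k) : tree_aut (set_val f).
Proof. by case: f => f hf; exact: set_mem hf. Qed.

Lemma aut_embed_pred (f : @tree_aut d k) : neretinO_pred (aut_embed f).
Proof.
by apply/asboolP; exists 0%N => //; eexists; split; last by [].
Qed.
Definition embed (f : @tree_aut d k) : G := Sub (aut_embed f) (aut_embed_pred f).

Lemma embed_vert (f : @tree_aut d k) n x : vert n (act (embed f) x) = set_val f (vert n x).
Proof.
pose p := AlmostAut (vball_subtree d k 0) (vball_subtree d k 0) (card_eqxx _) (tree_aut_iso f).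
exact: (@act_vert (embed f) 0 p n x (tree_aut_iso f) erefl (leq0n n)).
Qed.

Lemma embed_On0 (f : @tree_aut d k) : On act 0 (embed f).
Proof.
have [[[f' ff' f'f] _ _] b] := (tree_autP f, 0%N); split; first exact: (act_bij act1 actM).
move=> j x y _; split=> h.
  have := pre_vert h; rewrite !embed_vert => /(can_inj ff') /vert_pre[] //.
by have /vert_pre[] : vert j (act (embed f) x) = vert j (act (embed f) y) by rewrite !embed_vert (pre_vert h).
Qed.

Lemma vmap_tree_aut s : forest_homeo 0 s -> tree_aut (vmap s).
Proof.
move=> hs; have [[s' ss' s's] h] := hs.
have hs' : forest_homeo 0 s' by split; [exists s|move=> j x y _; rewrite -(h j) // !s's].
have vE t v : forest_homeo 0 t -> v <> Defs.root d k -> exists j x, v = vert j x /\ vmap t v = vert j (t x).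
  case: v => [[i w]|//] ht _; have [|j [x [_ e]]] := @vert_out_ex 0 (Some (i, w)); first by [].
  by exists j, x; split=> //; rewrite e (vmap_vert x ht).
have can2 t t' : cancel t t' -> forest_homeo 0 t -> forest_homeo 0 t' -> cancel (vmap t) (vmap t').
  move=> tt' ht ht' v; have [->//|/eqP v0] := eqVneq v (Defs.root d k).
  by have [j [x [-> ->]]] := vE t v ht v0; rewrite (vmap_vert _ ht') // tt'.
split=> //; first by exists (vmap s'); exact: can2.
have rootE v : adj (vmap s v) (Defs.root d k) = adj v (Defs.root d k).
  have [->//|/eqP v0] := eqVneq v (Defs.root d k); have [j [x [-> ->]]] := vE s v hs v0.
  case: j => [//|j]; apply/idP/idP => /Defs.adjP[] //; rewrite vert_parent //.
move=> x y; have [->|/eqP y0] := eqVneq y (Defs.root d k); first exact: rootE.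
have [->|/eqP x0] := eqVneq x (Defs.root d k).
  by rewrite adjC rootE adjC.
have out v : v <> Defs.root d k -> ~ vball 0 v by case: v => [[i w]|].
by have [_ a] := vmap_iso hs; apply: a; exact: out.
Qed.

Lemma near_agree (f : {ptws vertex -> discrete_topology vertex}) n :
  nbhs f [set f' : {ptws vertex -> discrete_topology vertex} | forall v, vball n v -> f' v = f v].
Proof.
have [r ->] := (finite_seqP (vball n : set vertex)).1 (@finite_vball d k n).
elim: r => [|v r IHr]; first by apply: filterS filterT => f' _ v.
have hv : nbhs f [set f' : {ptws vertex -> discrete_topology vertex} | f' v = f v].
  have := @proj_continuous vertex (fun=> discrete_topology vertex) v f.
  by move=> /(_ _ (discrete_set1 (f v))).
apply: filterS (filterI hv IHr) => f' [/= e1 e2] w; rewrite inE => /orP[/eqP ->//|]; exact: e2.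
Qed.

(** Together with [near_agree], this says that agreement on balls describes the neighbourhoods for
    pointwise convergence: each coordinate condition concerns a vertex, which lies in some ball. *)
Lemma agree_near (f : {ptws vertex -> discrete_topology vertex}) A : nbhs f A ->
  exists n, forall f', (forall v, vball n v -> f' v = f v) -> A f'.
Proof.
pose B n := [set f' : {ptws vertex -> discrete_topology vertex} | forall v, vball n v -> f' v = f v].
pose F := filter_from setT B.
have FF : Filter F.
  apply: filter_from_filter; first by exists 0%N.
  move=> i j _ _; exists (maxn i j) => // f' h; split=> v hv; apply: h; apply: vball_mono hv.
    exact: leq_maxl.
  exact: leq_maxr.
suff : F --> f by move=> /[apply] -[n _ h]; exists n.
apply/cvg_sup => v U; rewrite nbhsE => -[_ [[C oC <-] Cv] CU].
exists (depth v) => // f' h; apply: CU; rewrite /= /proj h //.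
exact: leqnn.
Qed.

(** Openness is tested along each translate of the tree automorphisms. Two of these that agree on a
    large ball differ by an element of [Un n], so the coset contains a neighbourhood of each of its
    points. *)
Lemma coset_open g n : open [set x : G | Un act n (g^-1 * x)%g].
Proof.
pose W := [set y : neretin d k | exists2 u, Un act n u & y = (val g * val u)%g].
suff oW : neretin_open W.
  exists W => //; apply/seteqP; split=> [x [u hu /= e]|x hx] /=.
    have -> : x = (g * u)%g by apply: val_inj.
    by rewrite mulKg.
  exists (g^-1 * x)%g => //; rewrite -[in LHS](mulVKg g x).
    by [].
move=> g'; rewrite openE => f0 [u hu e]; rewrite /interior.
(* The radius is [n.+1] because [pre n] of an end is a vertex of depth [n.+1]. *)
pose N := [set f' : {ptws vertex -> discrete_topology vertex} | forall v, vball n.+1 v -> f' v = set_val f0 v].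
have : nbhs f0 (set_val @^-1` N).
  exact: (@initial_continuous _ _ (set_val : @tree_aut d k -> _) f0 _ (near_agree (set_val f0) n.+1)).
apply: filterS => f hf /=; have [_ om ov] := On_gsub act1 actM n.
have hE : Un act n ((embed f0)^-1 * embed f)%g.
  have O0 (f' : @tree_aut d k) : On act n (embed f') by apply: (On_mono act1 actM (leq0n n)); exact: embed_On0.
  split=> [|x]; first by apply: om => //; exact: ov.
  rewrite (actMx actM) -[in RHS](actK act1 actM (embed f0) x).
  have [_ /(_ n _ _ (leqnn n)) h] := ov _ (O0 f0); apply/h.
  have /vert_pre[] // : vert n (act (embed f) x) = vert n (act (embed f0) x).
  by rewrite !embed_vert; apply: hf; rewrite /vball /mkset vert_depth.
have [_ um _] := Un_gsub act1 actM n.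
exists (u * ((embed f0)^-1 * embed f))%g; first exact: um.
have -> : (g' * aut_embed f = (g' * aut_embed f0) * ((aut_embed f0)^-1 * aut_embed f))%g.
  by rewrite !mulgA mulgK.
by rewrite e -mulgA.
Qed.

(** An element of [Un n] is a tree automorphism, recovered from its boundary map by [vmap], and it
    agrees with the identity on the ball of radius [n]. So [x] is [g] times an automorphism close to
    the identity. *)
Lemma open_coset (V : set G) g : open V -> V g -> exists n, forall x : G, Un act n (g^-1 * x)%g -> V x.
Proof.
move=> [W oW <-] /= Vg; have hid : tree_aut (id : {ptws vertex -> discrete_topology vertex}).
  by split=> //; exists id.
pose e : @tree_aut d k := @exist _ (fun f' => f' \in @tree_aut d k) _ (mem_set hid).
have e1 : embed e = 1%g.
  apply: act_inj; rewrite act1; apply/funext => x; apply: (@pre_ext _ _ 0) => n _.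
  by have /vert_pre[] : vert n (act (embed e) x) = vert n x by rewrite embed_vert.
have [C oC CS] := oW (val g).
have Ce : nbhs (set_val e) C.
  apply: open_nbhs_nbhs; split=> //; suff : (set_val @^-1` C) e by [].
  rewrite CS /=; have -> : aut_embed e = val (embed e) by [].
  by rewrite e1 mulg1.
have [n hn] := agree_near Ce; exists n => x hu; set u := (g^-1 * x)%g in hu.
have u0 : forest_homeo 0 (act u) by have [] := Un_anti act1 actM (leq0n n) hu.
pose f : @tree_aut d k := @exist _ (fun f' => f' \in @tree_aut d k) _ (mem_set (vmap_tree_aut u0)).
have fu : embed f = u.
  apply: act_inj; apply/funext => y; apply: (@pre_ext _ _ 0) => j _.
  have /vert_pre[] // : vert j (act (embed f) y) = vert j (act u y).
  by rewrite embed_vert; exact: (vmap_vert y u0).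
have : (set_val @^-1` C) f.
  apply: hn => v vn; case: (v) vn => [[i t]|//] vn.
  have [|j [y [_ ev]]] := @vert_out_ex 0 (Some (i, t)); first by [].
  rewrite ev in vn *; rewrite /vball /mkset vert_depth in vn.
  change (vmap (act u) (vert j y) = vert j y); rewrite (vmap_vert y u0 (leq0n j)); apply: pre_vert.
  by have [_ /(_ y)] := hu; exact: pre_le (ltnW vn).
rewrite CS /=; have -> : aut_embed f = val (embed f) by [].
by rewrite fu; congr W; rewrite -[in RHS](mulVKg g x).
Qed.
End Action.

(** * Operators induced by measure-preserving maps *)

Section Koopman.
Context d (T : measurableType d) (R : realType) (mu : {measure set T -> \bar R}).
Implicit Types (f : T -> T) (g h : T -> R[i]).

Lemma L2_lc (a : R[i]) g h : l2fun mu g -> l2fun mu h ->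
  a *: (l2class mu g : L2 mu) + l2class mu h = l2class mu (fun t => a * g t + h t).
Proof.
move=> hg hh; have -> : a *: (l2class mu g : L2 mu) = l2class mu (fun t => a * g t) by exact: l2scaleE.
by apply: l2addE => //; exact: l2funZ.
Qed.

Lemma L2_ip g h : l2fun mu g -> l2fun mu h -> hdot (L2 mu) (l2class mu g) (l2class mu h) = l2ip mu g h.
Proof. exact: l2dotE. Qed.

Section OneMap.
Variable f : T -> T.
Hypothesis mf : measurable_fun setT f.
Hypothesis fmu : forall A, measurable A -> mu (f @^-1` A) = mu A.

Let nu : {measure set T -> \bar R} :=
  measure_function_pushforward__canonical__measure_function_Measure mu mf.

Lemma ge0_integral_comp (F : T -> \bar R) : measurable_fun setT F -> (forall t, 0 <= F t)%E ->
  (\int[mu]_t F (f t) = \int[mu]_t F t)%E.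
Proof.
move=> mF F0; transitivity (\int[nu]_t F t)%E.
  by rewrite /nu (ge0_integral_pushforward mf) // preimage_setT.
by apply: eq_measure_integral => A mA _; exact: fmu.
Qed.

Lemma l2fun_comp g : l2fun mu g -> l2fun mu (g \o f).
Proof.
move=> [gr gi /integrableP[gs gb]]; split; [exact: (measurableT_comp gr mf)|exact: (measurableT_comp gi mf)|].
apply/integrableP; split; first exact: (measurableT_comp gs mf).
rewrite (@ge0_integral_comp (fun t => `|(EFin \o sqmod (R:=R) \o g) t|)%E) //.
exact: measurableT_comp gs.
Qed.

Lemma ae_comp (P : T -> Prop) : {ae mu, forall t, P t} -> {ae mu, forall t, P (f t)}.
Proof.
move=> [N [mN N0 h]]; exists (f @^-1` N); split.
- by rewrite -[X in measurable X]setTI; exact: mf.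
- by rewrite fmu.
- by move=> t nt; exact: h.
Qed.

Definition koopman (x : L2 mu) : L2 mu := l2class mu (fun t => l2val x (f t)).

Lemma koopmanE g : l2fun mu g -> koopman (l2class mu g) = l2class mu (g \o f).
Proof.
move=> hg; apply/l2classP; [exact/l2fun_comp/l2valP|exact: l2fun_comp|].
exact: (@ae_comp (fun t => l2val (l2class mu g) t = g t) (l2classK hg)).
Qed.

Lemma koopman_lin : linear koopman.
Proof.
move=> a x y; elim/l2ind: x => g hg; elim/l2ind: y => h hh.
rewrite L2_lc // koopmanE; last exact: l2fun_lin.
by rewrite !koopmanE // L2_lc //; exact: l2fun_comp.
Qed.

Lemma koopman_ip x y : hdot (L2 mu) (koopman x) (koopman y) = hdot (L2 mu) x y.
Proof.
elim/l2ind: x => g hg; elim/l2ind: y => h hh.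
have hg' := l2fun_comp hg; have hh' := l2fun_comp hh.
rewrite !koopmanE // !L2_ip //.
have [i1 i2] := l2mul_integrable hg hh; have [j1 j2] := l2mul_integrable hg' hh'.
have key (p : R[i] -> R) : mu.-integrable setT (EFin \o (p \o (fun t => g t * Num.conj (h t)))) ->
    mu.-integrable setT (EFin \o (p \o (fun t => (g \o f) t * Num.conj ((h \o f) t)))) ->
    (\int[mu]_t p ((g \o f) t * Num.conj ((h \o f) t)) = \int[mu]_t p (g t * Num.conj (h t)))%R.
  move=> ip jp; rewrite /Rintegral; congr fine.
  transitivity (\int[nu]_t (p (g t * Num.conj (h t)))%:E)%E; last first.
    by apply: eq_measure_integral => A mA _; exact: fmu.
  have mp := measurable_int _ ip.
  by rewrite /nu (integral_pushforward mf mp) // preimage_setT.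
by apply: complex_eq; apply: key.
Qed.
End OneMap.

Lemma koopman_comp f f' x : measurable_fun setT f -> (forall A, measurable A -> mu (f @^-1` A) = mu A) ->
  measurable_fun setT f' -> (forall A, measurable A -> mu (f' @^-1` A) = mu A) ->
  koopman f (koopman f' x) = koopman (f' \o f) x.
Proof.
move=> mf fmu mf' fmu'; elim/l2ind: x => g hg; rewrite [koopman f' _]koopmanE // koopmanE //; last exact: l2fun_comp.
rewrite koopmanE //; first exact: measurableT_comp.
move=> A mA; rewrite comp_preimage fmu ?fmu' //.
by rewrite -[X in measurable X]setTI; exact: mf'.
Qed.

Lemma koopman_id x : koopman id x = x. Proof. exact: l2valK. Qed.

Definition l2ind_fun (A : set T) : T -> R[i] := fun t => (\1_A t)%:C%C.

Lemma l2fun_indic A : measurable A -> (mu A < +oo)%E -> l2fun mu (l2ind_fun A).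
Proof.
move=> mA fA; split.
- rewrite (_ : _ \o _ = \1_A); first exact: measurable_indic.
  by apply/funext.
- rewrite (_ : _ \o _ = cst 0) //; by apply/funext.
- have -> : EFin \o sqmod (R:=R) \o l2ind_fun A = EFin \o \1_A.
    apply/funext => t /=; rewrite /sqmod /= expr0n /= addr0 /indic.
    by case: (t \in A); rewrite ?expr1n ?expr0n.
  apply/integrableP; split; first exact/measurable_EFinP/measurable_indic.
  rewrite (eq_integral (fun x => (\1_A x)%:E)); last by move=> t _ /=; rewrite ger0_norm.
  by rewrite integral_indic // setIT.
Qed.

Lemma indic_ip A B : measurable A -> measurable B -> (mu A < +oo)%E -> (mu B < +oo)%E ->
  hdot (L2 mu) (l2class mu (l2ind_fun A)) (l2class mu (l2ind_fun B)) = (fine (mu (A `&` B)))%:C%C.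
Proof.
move=> mA mB fA fB; rewrite L2_ip; [|exact: l2fun_indic..].
have E t : l2ind_fun A t * Num.conj (l2ind_fun B t) = (\1_(A `&` B) t)%:C%C.
  rewrite realC_conj -rmorphM; congr (_%:C%C); by rewrite indicI.
rewrite /l2ip (_ : (fun t => _) = (fun t => (\1_(A `&` B) t)%:C%C)); last exact/funext.
apply: complex_eq => /=; last by rewrite Rintegral_cst ?mul0r.
by rewrite /Rintegral integral_indic ?setIT //; exact: measurableI.
Qed.

(** The measurable sets on which the integral of [F] vanishes form a Dynkin system, hence contain
    the generated sigma-algebra. *)
Lemma pi_system_ae0 (G : set (set T)) (F : T -> R) : @measurable _ T = <<s G >> -> setI_closed G ->
  mu.-integrable setT (EFin \o F) -> (\int[mu]_t (F t)%:E = 0)%E ->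
  (forall A, G A -> \int[mu]_(t in A) (F t)%:E = 0)%E -> {ae mu, forall t, F t = 0}.
Proof.
move=> mG GI iF F0 FA; have mF := measurable_int _ iF.
have H A : measurable A -> (\int[mu]_(t in A) (F t)%:E = 0)%E.
  rewrite mG; apply: (@dynkin_induction _ T G (fun A => (\int[mu]_(t in A) (F t)%:E)%E = 0)) => // {A}.
  - move=> A mA hA; have := F0; rewrite -(setUv A) integral_setU //.
    + by rewrite hA add0e.
    + exact: measurableC.
    + by rewrite setUv.
    + by rewrite disj_set2E setICr.
  - move=> S mS tS hS; rewrite integral_bigcup //.
      by rewrite (eq_eseriesr (g := fun=> 0%E)) ?eseries0 // => i _; exact: hS.
    by apply: integrableS iF => //; exact: bigcupT_measurable.
have := @integral_ae_eq _ _ _ mu setT measurableT (cst 0%E) (EFin \o F) iF (measurable_cst _).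
have h0 E : E `<=` setT -> measurable E -> (\int[mu]_(x in E) (EFin \o F) x = \int[mu]_(x in E) cst 0 x)%E.
  by move=> _ mE; rewrite integral_cst // mul0e; exact: H.
move=> /(_ h0); apply: filterS => t /(_ I) /=; by case.
Qed.

Lemma L2_sum I (r : seq I) (g : I -> T -> R[i]) : (forall i, l2fun mu (g i)) ->
  \sum_(i <- r) (l2class mu (g i) : L2 mu) = l2class mu (fun t => \sum_(i <- r) g i t).
Proof.
move=> hg; suff [] : l2fun mu (fun t => \sum_(i <- r) g i t) /\
    \sum_(i <- r) (l2class mu (g i) : L2 mu) = l2class mu (fun t => \sum_(i <- r) g i t) by [].
elim: r => [|i r [h e]].
  have E : (fun t : T => \sum_(i <- [::]) g i t) = fun=> 0 by apply/funext => t; rewrite big_nil.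
  by rewrite E big_nil; split=> //; exact: l2fun0.
have E : (fun t : T => \sum_(j <- i :: r) g j t) = fun t => g i t + \sum_(j <- r) g j t.
  by apply/funext => t; rewrite big_cons.
rewrite E big_cons e; split; first exact: l2funD.
exact: l2addE.
Qed.
End Koopman.

(** * Haar measure *)

Section Cosets.
Variables d k : nat.
Variables (G : groupTopType) (act : G -> ends d k -> ends d k).
Hypothesis act1 : act 1%g = id.
Hypothesis actM : forall g h, act (g * h)%g = act g \o act h.
Hypothesis act_inj : injective act.
Hypothesis act_ex : forall g, exists n, forest_homeo n (act g).
Hypothesis act_onto : forall n s, forest_homeo n s -> exists g, act g = s.
Hypotheses (hd : (1 < d)%N) (hk : (0 < k)%N).
Implicit Types (g h u x y : G) (m n : nat).
Local Notation U := (Un act).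
Local Notation O := (On act).
Let Ug n : gsub (U n) := Un_gsub act1 actM n.
Let Og n : gsub (O n) := On_gsub act1 actM n.

Lemma U1 n : U n 1%g. Proof. by case: (Ug n). Qed.
Lemma UM n g h : U n g -> U n h -> U n (g * h)%g. Proof. by case: (Ug n) => _ + _; apply. Qed.
Lemma UV n g : U n g -> U n g^-1%g. Proof. by case: (Ug n) => _ _; apply. Qed.
Lemma OM n g h : O n g -> O n h -> O n (g * h)%g. Proof. by case: (Og n) => _ + _; apply. Qed.
Lemma OV n g : O n g -> O n g^-1%g. Proof. by case: (Og n) => _ _; apply. Qed.

Definition coset g n : set G := [set x | U n (g^-1 * x)%g].

Lemma coset_self g n : coset g n g. Proof. by rewrite /coset /= mulVg; exact: U1. Qed.
Lemma coset_sym g n x : coset g n x -> coset x n g.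
Proof. by move=> /UV; rewrite invgM invgK. Qed.
Lemma coset_trans g n x y : coset g n x -> coset x n y -> coset g n y.
Proof. by move=> h1 h2; have := UM h1 h2; rewrite mulgA mulgK. Qed.
Lemma coset_eq g n x : coset g n x -> coset g n = coset x n.
Proof.
move=> h; apply/seteqP; split=> y; first exact/coset_trans/coset_sym.
exact: coset_trans.
Qed.
Lemma coset_sub g m n : (m <= n)%N -> coset g n `<=` coset g m.
Proof. by move=> mn x; exact: Un_anti. Qed.
Lemma coset_mul g h n x : coset (g * h)%g n x = coset h n (g^-1 * x)%g.
Proof. by rewrite /coset /mkset invgM mulgA. Qed.
Lemma coset1 n : coset 1%g n = U n.
Proof. by apply/seteqP; split=> x; rewrite /coset /= invg1 mul1g. Qed.

(** For [g] in [On n], the list of images of the vertices of level [n] is a complete invariant of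
    the coset of [Un n]. It is a permutation of a fixed list, whence the finite indices below. *)
Definition kseq n g := [seq vact act hd n g v | v <- level d k n].

Lemma pre_level n (x : ends d k) : pre n x \in level d k n.
Proof. by rewrite mem_level; apply/eqP/size_pre. Qed.

Lemma kseq_eq n g h : O n g -> O n h -> kseq n g = kseq n h <-> U n (g^-1 * h)%g.
Proof.
move=> hg hh; have pv s (x : ends d k) : O n s -> vact act hd n s (pre n x) = pre n (act s x).
  by move=> [_ hs]; rewrite /vact hs // pre_end_of ?size_mkseq // take_oversize ?size_mkseq //; case: (pre n x).
split=> [e|[_ e]].
  split=> [|x]; first by apply: OM => //; exact: OV.
  rewrite (actMx actM) -[in RHS](actK act1 actM g x).
  have [_ hV] := OV hg; apply/hV => //; rewrite -!pv //.
  by have /eq_in_map e' := e; exact/esym/e'/pre_level.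
apply/eq_in_map => v; rewrite mem_level => /eqP ev.
have {ev} -> : v = pre n (end_of hd v) by rewrite pre_end_of ?ev // take_oversize ?ev //; case: (v).
rewrite !pv //; have [_ h'] := hg; rewrite -[in RHS](mulVKg g h) (actMx actM).
by apply/h'.
Qed.

Lemma coset_reps m n : (m <= n)%N -> exists us : seq G, [/\ uniq us,
  forall u, u \in us -> U m u,
  forall x, U m x -> exists2 u, u \in us & U n (u^-1 * x)%g
  & forall u u', u \in us -> u' \in us -> U n (u^-1 * u')%g -> u = u'].
Proof.
move=> mn; pose P s := [set u | U m u /\ kseq n u = s].
pose S := [seq s <- permutations (level d k n) | `[< P s !=set0 >]].
pose rep s := xget 1%g (P s).
have repP s : s \in S -> P s (rep s).
  by rewrite mem_filter => /andP[/asboolP[u hu] _]; exact: xgetI hu.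
have UO u : U m u -> O n u by move=> /Un_On; exact: On_mono.
exists [seq rep s | s <- S]; split.
- rewrite map_inj_in_uniq ?filter_uniq ?permutations_uniq // => s s' /repP[_ e] /repP[_ e'] E.
  by rewrite -e -e' E.
- by move=> _ /mapP[s /repP[hu _] ->].
- move=> x hx; have sx : kseq n x \in S.
    rewrite mem_filter; apply/andP; split; first by apply/asboolP; exists x.
    by rewrite mem_permutations; exact: (vact_perm hd (UO _ hx)).
  exists (rep (kseq n x)); first exact: map_f.
  by have [hu e] := repP _ sx; apply/kseq_eq => //; exact: UO.
- move=> _ _ /mapP[s /repP[hs es] ->] /mapP[s' /repP[hs' es'] ->].
  by move=> /(kseq_eq (UO _ hs) (UO _ hs')); rewrite es es' => ->.
Qed.

Definition coset_rep n g : G := xget 1%g (coset g n).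
Definition coset_lev n g : nat := xget 0%N [set m | (n <= m)%N /\ O m (coset_rep n g)].
(** A numbering of the left cosets of [Un n], which makes them countable. The representative and the
    level depend on the coset alone; not every number is attained, so [nth_coset] may be empty. *)
Definition coset_code n g : nat := pickle (coset_lev n g, kseq (coset_lev n g) (coset_rep n g)).

Lemma coset_repP n g : coset g n (coset_rep n g).
Proof. exact: (xgetI _ (coset_self g n)). Qed.
Lemma coset_levP n g : (n <= coset_lev n g)%N /\ O (coset_lev n g) (coset_rep n g).
Proof.
have [m hm] := act_ex (coset_rep n g).
have h : [set m | (n <= m)%N /\ O m (coset_rep n g)] (maxn n m).
  by split; [exact: leq_maxl|apply: (On_mono act1 actM) hm; exact: leq_maxr].
exact: (xgetI _ h).
Qed.

Lemma coset_codeP n g h : coset_code n g = coset_code n h <-> coset g n h.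
Proof.
split=> [/(pcan_inj pickleK)[el ek]|/coset_eq e]; last by rewrite /coset_code /coset_lev /coset_rep e.
have [nm hg] := coset_levP n g; have [_ hh] := coset_levP n h.
move: el ek hg hh => <-; move: (coset_lev n g) nm => m nm ek hg hh.
have /(kseq_eq hg hh) := ek => /(Un_anti act1 actM nm) E.
apply: coset_trans (coset_repP n g) _; apply: coset_trans E _.
exact/coset_sym/coset_repP.
Qed.

Definition nth_coset n j : set G := [set x | coset_code n x = j].
Lemma nth_cosetE n j : nth_coset n j = set0 \/ exists g, nth_coset n j = coset g n.
Proof.
have [[g hg]|h] := pselect (nth_coset n j !=set0); last by left; apply/seteqP; split=> // x hx; case: h; exists x.
right; exists g; apply/seteqP; split=> x; rewrite /nth_coset /=.
  by move=> hx; apply/coset_codeP; rewrite hx.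
by move=> /coset_codeP <-.
Qed.
Lemma nth_coset_code n g : nth_coset n (coset_code n g) = coset g n.
Proof. by apply/seteqP; split=> x; [move=> /esym/coset_codeP|move=> /coset_codeP/esym]. Qed.

(* The actions of the [(c 0)^-1 * c n], which all lie in [U 0], converge together with their
   inverses, and the limit is again the boundary map of an automorphism of the tree. *)
Lemma nested_cosets (c : nat -> G) : (forall n, coset (c n) n (c n.+1)) ->
  exists g, forall n, coset (c n) n g.
Proof.
move=> hc; pose h n := ((c 0%N)^-1 * c n)%g.
have hS n : coset (h n) n (h n.+1).
  by rewrite /coset /mkset /h invgM invgK -mulgA mulVKg; exact: hc.
have hU n : U 0 (h n).
  elim: n => [|n IHn]; first by rewrite /h mulVg; exact: U1.
  have := Un_anti act1 actM (leq0n n) (hS n) => /(UM IHn); by rewrite mulVKg.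
have hO n j : O j (h n) by apply: (On_mono act1 actM (leq0n j)); exact: Un_On.
have stepS n (x : ends d k) : pre n (act (h n.+1) x) = pre n (act (h n) x).
  have -> : h n.+1 = (h n * ((h n)^-1 * h n.+1))%g by rewrite mulVKg.
  rewrite (actMx actM); have [_ h'] := hO n n; apply/h' => //.
  by have [_ ->] := hS n.
have stepV n (x : ends d k) : pre n (act (h n.+1)^-1%g x) = pre n (act (h n)^-1%g x).
  have -> : (h n.+1)^-1%g = (((h n)^-1 * h n.+1)^-1 * (h n)^-1)%g by rewrite (invgM (h n)^-1%g) invgK -mulgA mulgV mulg1.
  by rewrite (actMx actM); have [_ ->] := UV (hS n).
have lim (t : nat -> ends d k -> ends d k) : (forall n (x : ends d k), pre n (t n.+1 x) = pre n (t n x)) ->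
    exists s, forall n (x : ends d k), pre n (s x) = pre n (t n x).
  move=> ht; exists (fun x : ends d k => ((t 0%N x).1, fun i => (t i.+1 x).2 i)) => n x.
  have mono j i : (i <= j)%N -> pre i (t j x) = pre i (t i x).
    elim: j => [|j IHj]; first by rewrite leqn0 => /eqP ->.
    rewrite leq_eqVlt => /orP[/eqP -> //|]; rewrite ltnS => ij.
    by rewrite -IHj //; exact: pre_le ij (ht j x).
  apply/preP; split=> [|i hi] /=; first by have /preP[->] := mono n 0%N (leq0n n).
  by have /preP[_ ->//] := mono n i.+1 hi.
have [s hs] := lim _ stepS; have [s' hs'] := lim (fun n => act (h n)^-1%g) stepV.
have ss' : cancel s s'.
  move=> x; apply: (@pre_ext _ _ 0) => n _; rewrite hs' -[in RHS](actK act1 actM (h n) x).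
  have [_ h'] := OV (hO n n); apply/h' => //.
have s's : cancel s' s.
  move=> x; apply: (@pre_ext _ _ 0) => n _; rewrite hs -[in RHS](actKV act1 actM (h n) x).
  have [_ h'] := hO n n; apply/h' => //.
have [|g0 eg] := act_onto (n := 0) (s := s).
  split; first by exists s'.
  by move=> j x y _; rewrite !hs; have [_ h'] := hO j j; exact: h'.
have Og0 : O 0 g0.
  rewrite /On /mkset eg; split; first by exists s'.
  by move=> j x y _; rewrite !hs; have [_ h'] := hO j j; exact: h'.
exists (c 0%N * g0)%g => n; have : coset (h n) n g0.
  split=> [|x]; first by apply: OM; [exact/OV|exact: (On_mono act1 actM (leq0n n))].
  rewrite (actMx actM) -[in RHS](actK act1 actM (h n) x).
  by have [_ h'] := OV (hO n n); apply/h' => //; rewrite eg.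
by rewrite /coset /mkset /h invgM invgK -mulgA.
Qed.

Hypothesis coset_open : forall g n, open (coset g n).
Hypothesis open_coset : forall V g, open V -> V g -> exists n, coset g n `<=` V.

(** Finitely many cosets of [Un n] cover [U 0], so an ultrafilter on [U 0] selects one for each [n].
    The selected cosets are nested, and a common point of them is a limit. *)
Lemma U0_compact : compact (U 0).
Proof.
rewrite compact_ultra => F FU FA.
have FF : ProperFilter F by exact: ultra_proper.
have pick n : exists c, U 0 c /\ F (coset c n).
  have [us [_ us0 usx _]] := coset_reps (leq0n n).
  have : F (\bigcup_(u in [set` us]) coset u n).
    by apply: filterS FA => x /usx[u uu hx]; exists u.
  elim: us us0 {usx} => [|u us IHus] us0 Fus.
    by have [x []] := filter_ex Fus.
  have [Fu|Fu] := in_ultra_setVsetC (coset u n) FU.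
    by exists u; split=> //; apply: us0; rewrite mem_head.
  apply: IHus => [v vu|]; first by apply: us0; rewrite inE vu orbT.
  apply: filterS (filterI Fus Fu) => x [[v /=]]; rewrite inE => /orP[/eqP -> //|vu] hx _.
  by exists v.
have /choice[c hc] := pick.
have hcS n : coset (c n) n (c n.+1).
  have [x [h1 h2]] := filter_ex (filterI (hc n).2 (hc n.+1).2).
  by apply: coset_trans h1 _; apply: coset_sub (leqnSn n) _ _; exact: coset_sym.
have [g hg] := nested_cosets hcS; exists g; split.
  by have := UM (hc 0%N).1 (hg 0%N); rewrite mulVKg.
move=> V; rewrite nbhsE => -[W [oW Wg] WV]; have [n hn] := open_coset oW Wg.
apply: filterS (hc n).2 => x hx; apply/WV/hn; apply: coset_trans hx.
exact: coset_sym.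
Qed.

(** The lower bound [m] on the level is there for right translations: those by [g] in [On m]
    preserve the class, while they may destroy cosets of larger subgroups. *)
Definition coset_class m : set (set (borel G)) :=
  [set A | A = set0 \/ exists g n, (m <= n)%N /\ A = coset g n].

Lemma coset_measurable g n : measurable (coset g n : set (borel G)).
Proof. by apply: sub_sigma_algebra; exact: coset_open. Qed.

Lemma coset_class_measurable m : coset_class m `<=` @measurable _ (borel G).
Proof. by move=> A [->|[g [n [_ ->]]]]; [exact: measurable0|exact: coset_measurable]. Qed.

Lemma borel_coset_class m : @measurable _ (borel G) = <<s coset_class m >>.
Proof.
apply/seteqP; split; last first.
  apply: smallest_sub; first exact: sigma_algebra_measurable.
  exact: coset_class_measurable.
apply: smallest_sub; first exact: smallest_sigma_algebra.
move=> V oV; pose T := g_sigma_algebraType (coset_class m).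
pose W n j : set T := if `[< nth_coset (m + n) j `<=` V >] then nth_coset (m + n) j else set0.
have -> : V = \bigcup_n \bigcup_j W n j.
  apply/seteqP; split=> [g Vg|g [n _ [j _]]]; last by rewrite /W; case: asboolP => // h /h.
  have [n hn] := open_coset oV Vg; exists n => //; exists (coset_code (m + n) g) => //.
  have sub : nth_coset (m + n) (coset_code (m + n) g) `<=` V.
    rewrite nth_coset_code; apply: subset_trans hn; apply: coset_sub; exact: leq_addl.
  by rewrite /W asboolT.
suff : @measurable _ T (\bigcup_n \bigcup_j W n j) by [].
apply: bigcupT_measurable => n; apply: bigcupT_measurable => j; rewrite /W; case: asboolP => // _.
apply: sub_sigma_algebra; have [->|[g ->]] := nth_cosetE (m + n) j; first by left.
by right; exists g, (m + n)%N; split=> //; exact: leq_addr.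
Qed.

Lemma coset_classI m : setI_closed (coset_class m).
Proof.
move=> A B [->|[g [n [mn ->]]]]; first by rewrite set0I; left.
move=> [->|[h [n' [mn' ->]]]]; first by rewrite setI0; left.
have [[x [xg xh]]|h0] := pselect (coset g n `&` coset h n' !=set0); last first.
  by left; apply/seteqP; split=> // x hx; apply: h0; exists x.
right; rewrite (coset_eq xg) (coset_eq xh); exists x, (maxn n n'); split.
  by rewrite leq_max mn.
have [nn'|/ltnW nn'] := leqP n n'; apply/seteqP; split=> y //.
- by move=> [].
- by move=> h'; split=> //; exact: coset_sub nn' _ h'.
- by move=> [].
- by move=> h'; split=> //; exact: coset_sub nn' _ h'.
Qed.

Lemma nth_coset_class m j : coset_class m (nth_coset m j).
Proof. by have [->|[g ->]] := nth_cosetE m j; [left|right; exists g, m]. Qed.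

Lemma nth_coset_cover m : \bigcup_j nth_coset m j = setT.
Proof. by apply/seteqP; split=> // x _; exists (coset_code m x). Qed.

Lemma coset_measurable_fun d' (T : measurableType d') m (f : T -> borel G) :
  (forall g n, (m <= n)%N -> measurable (f @^-1` coset g n)) -> measurable_fun setT f.
Proof.
move=> h; apply: (measurability _ (borel_coset_class m)) => _ [A hA <-]; rewrite setTI.
by case: hA => [->|[g [n [mn ->]]]]; [rewrite preimage_set0|exact: h].
Qed.

(** * The regular representations for a given Haar measure *)

Section Haar.
Variables (R : realType) (mu : {measure set (borel G) -> \bar R}).

Lemma coset_measure_unique m (nu : {measure set (borel G) -> \bar R}) :
  (forall g n, (m <= n)%N -> mu (coset g n) = nu (coset g n)) ->
  (forall g, (mu (coset g m) < +oo)%E) -> forall A, measurable A -> mu A = nu A.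
Proof.
move=> e fin A mA; apply: (measure_unique (coset_class m) (nth_coset m)) => //.
- exact: borel_coset_class.
- exact: coset_classI.
- exact: nth_coset_class.
- exact: nth_coset_cover.
- by move=> B [->|[g [n [mn ->]]]]; [rewrite !measure0|exact: e].
- by move=> j; have [->|[g ->]] := nth_cosetE m j; rewrite ?measure0 ?ltry.
Qed.

Hypothesis mu_neq0 : mu [set: borel G] != 0%E.
Hypothesis mu_fin : (mu (U 0) < +oo)%E.
Hypothesis mu_inv : forall g (A : set (borel G)), measurable A -> mu [set (g * x : G)%g | x in A] = mu A.

Lemma haar_coset g n : mu (coset g n) = mu (U n).
Proof.
have mU : measurable (U n : set (borel G)) by rewrite -coset1; exact: coset_measurable.
rewrite -(mu_inv g mU); congr (mu _); apply/seteqP; split=> [x hx|_ [x hx <-]].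
  by exists (g^-1 * x)%g => //; rewrite mulVKg.
by rewrite /coset /= mulKg.
Qed.

Lemma haar_U_fin n : (mu (U n) < +oo)%E.
Proof.
apply: le_lt_trans mu_fin.
by apply: le_measure; rewrite ?inE -?coset1; [exact: coset_measurable..|exact: coset_sub].
Qed.

Lemma haar_U_gt0 n : (0 < mu (U n))%E.
Proof.
rewrite lt0e measure_ge0 andbT; apply/negP => /eqP h; move/negP: mu_neq0; apply.
apply/eqP; apply: measure_negligible => //; rewrite -(nth_coset_cover n).
apply: negligible_bigcup => j; have [->|[g ->]] := nth_cosetE n j; first exact: negligible_set0.
by apply/negligibleP; [exact: coset_measurable|exact: etrans (haar_coset g n) h].
Qed.

Definition ltrans g (x : borel G) : borel G := (g^-1 * x)%g.
Definition rtrans g (x : borel G) : borel G := (x * g)%g.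

Lemma ltrans_coset g h n : ltrans g @^-1` coset h n = coset (g * h)%g n.
Proof. by apply/seteqP; split=> x; rewrite /preimage /= coset_mul. Qed.

Lemma rtrans_coset g h m n : O m g -> (m <= n)%N -> rtrans g @^-1` coset h n = coset (h * g^-1)%g n.
Proof.
move=> hg mn; have {mn} On_ := On_mono act1 actM mn hg.
apply/seteqP; split=> x; rewrite /preimage /coset /rtrans /= invgM invgK => hx.
  by have := Un_norm act1 actM On_ hx; rewrite !mulgA mulgK.
have := Un_norm act1 actM (OV On_) hx; rewrite invgK !mulgA mulVg mul1g.
by [].
Qed.

Lemma ltrans_meas g : measurable_fun setT (ltrans g).
Proof. by apply: (@coset_measurable_fun _ _ 0) => h n _; rewrite ltrans_coset; exact: coset_measurable. Qed.
Lemma rtrans_meas g : measurable_fun setT (rtrans g).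
Proof.
have [m Om] := act_ex g; apply: (@coset_measurable_fun _ _ m) => h n mn.
by rewrite (rtrans_coset _ Om mn); exact: coset_measurable.
Qed.

Lemma ltrans_mu g A : measurable A -> mu (ltrans g @^-1` A) = mu A.
Proof.
move=> mA; rewrite -(mu_inv g mA); congr (mu _).
apply/seteqP; split=> [x hx|_ [x hx <-]].
  by exists (g^-1 * x)%g => //; rewrite mulVKg.
by rewrite /preimage /ltrans /= mulKg.
Qed.

(** This is unimodularity. For large [n] the element [g] normalizes [Un n], so right translation
    permutes the left cosets of [Un n], all of the same measure; and these cosets determine the
    measure. *)
Lemma rtrans_mu g A : measurable A -> mu (rtrans g @^-1` A) = mu A.
Proof.
move=> mA; have [m Om] := act_ex g; apply/esym.
pose nu : {measure set (borel G) -> \bar R} :=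
  measure_function_pushforward__canonical__measure_function_Measure mu (rtrans_meas g).
apply: (@coset_measure_unique m nu) => // [h n mn|h]; last by rewrite haar_coset; exact: haar_U_fin.
by rewrite /nu /= /pushforward (rtrans_coset _ Om mn) !haar_coset.
Qed.

Local Notation lam := (@left_regular R G mu).
Definition rrep g : L2 mu -> L2 mu := koopman (mu := mu) (rtrans g).
Local Notation ind g n := (@l2ind_fun _ (borel G) R (coset g n)).
Definition xi n : L2 mu := l2class mu (ind 1%g n).

Lemma lam_koopman g : lam g = koopman (mu := mu) (ltrans g). Proof. by []. Qed.

Lemma lam_urep : @urep R G (L2 mu) lam.
Proof.
split=> [g|g x y||g h].
- exact: (koopman_lin (@ltrans_meas g) (@ltrans_mu g)).
- exact: (koopman_ip (@ltrans_meas g) (@ltrans_mu g)).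
- apply/funext => x; rewrite lam_koopman (_ : ltrans 1%g = id) ?koopman_id //.
  by apply/funext => y; rewrite /ltrans invg1 mul1g.
- apply/funext => x /=; rewrite !lam_koopman koopman_comp //; [|exact: ltrans_meas|exact: ltrans_mu|exact: ltrans_meas|exact: ltrans_mu].
  congr (koopman _ x); apply/funext => y; by rewrite /ltrans /= invgM mulgA.
Qed.

Lemma rrep_urep : @urep R G (L2 mu) rrep.
Proof.
split=> [g|g x y||g h].
- exact: (koopman_lin (@rtrans_meas g) (@rtrans_mu g)).
- exact: (koopman_ip (@rtrans_meas g) (@rtrans_mu g)).
- apply/funext => x; rewrite /rrep (_ : rtrans 1%g = id) ?koopman_id //.
  by apply/funext => y; rewrite /rtrans mulg1.
- apply/funext => x /=; rewrite /rrep koopman_comp //; [|exact: rtrans_meas|exact: rtrans_mu|exact: rtrans_meas|exact: rtrans_mu].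
  congr (koopman _ x); apply/funext => y; by rewrite /rtrans /= mulgA.
Qed.

Lemma lam_rrep g h (x : L2 mu) : lam g (rrep h x) = rrep h (lam g x).
Proof.
rewrite lam_koopman /rrep !koopman_comp //; [|exact: rtrans_meas|exact: rtrans_mu|exact: ltrans_meas|exact: ltrans_mu|exact: ltrans_meas|exact: ltrans_mu|exact: rtrans_meas|exact: rtrans_mu].
congr (koopman _ x); apply/funext => y; by rewrite /rtrans /ltrans /= mulgA.
Qed.

Lemma coset_l2 g n : l2fun mu (ind g n).
Proof.
apply: l2fun_indic; first exact: coset_measurable.
by rewrite haar_coset; exact: haar_U_fin.
Qed.

Lemma l2ind_comp (A : set (borel G)) (f : borel G -> borel G) :
  l2ind_fun R A \o f = l2ind_fun R (f @^-1` A).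
Proof.
by apply/funext => t; rewrite /l2ind_fun /= !indicE; congr (_%:R%:C%C); apply/idP/idP; rewrite !inE.
Qed.

Lemma lam_coset g h n : lam g (l2class mu (ind h n)) =
  l2class mu (ind (g * h)%g n).
Proof.
rewrite lam_koopman koopmanE; [|exact: ltrans_meas|exact: ltrans_mu|exact: coset_l2].
by rewrite l2ind_comp ltrans_coset.
Qed.

Lemma lam_xi g n : lam g (xi n) = l2class mu (ind g n).
Proof. by rewrite /xi lam_coset mulg1. Qed.

Lemma coset_ip g h n n' : hdot (L2 mu) (l2class mu (ind g n))
  (l2class mu (ind h n')) = (fine (mu (coset g n `&` coset h n')))%:C%C.
Proof. by apply: indic_ip; [exact: coset_measurable..| |]; rewrite haar_coset; exact: haar_U_fin. Qed.

Lemma xi_U n u : U n u -> lam u (xi n) = xi n.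
Proof.
move=> hu; rewrite lam_xi /xi -(@coset_eq 1%g n u) //.
by rewrite coset1.
Qed.

Lemma xi_O n g : O n g -> lam g (xi n) = rrep g^-1%g (xi n).
Proof.
move=> hg; rewrite lam_xi /xi /rrep koopmanE; [|exact: rtrans_meas|exact: rtrans_mu|exact: coset_l2].
by rewrite l2ind_comp (rtrans_coset _ (OV hg) (leqnn n)) invgK mul1g.
Qed.

Lemma xi_perp n g : ~ U n g -> hdot (L2 mu) (lam g (xi n)) (xi n) = 0.
Proof.
move=> ng; rewrite lam_xi /xi coset_ip (_ : _ `&` _ = set0) ?measure0 //.
apply/seteqP; split=> // x [h1]; rewrite coset1 => h2; apply: ng.
by have := UM h2 (UV h1); rewrite invgM invgK mulgA mulgV mul1g.
Qed.

Lemma xi_neq0 n : xi n <> 0.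
Proof.
move=> e; have : hdot (L2 mu) (xi n) (xi n) = 0 by rewrite e linear0l.
rewrite /xi coset_ip setIid coset1 => /(congr1 Re)/= h.
have := haar_U_gt0 n; have := haar_U_fin n; have := measure_ge0 mu (U n).
by case: (mu (U n)) h => //= r -> _ _; rewrite ltxx.
Qed.

Lemma xi_split m n : (m <= n)%N -> exists us : seq G,
  (forall u, u \in us -> U m u) /\ xi m = \sum_(u <- us) lam u (xi n).
Proof.
move=> mn; have [us [uu us0 usx usi]] := coset_reps mn; exists us; split=> //.
under eq_bigr do rewrite lam_xi.
rewrite L2_sum; last by move=> u; exact: coset_l2.
congr l2class; apply/funext => t; rewrite /l2ind_fun indicE coset1.
have [/set_mem ht|/negP ht] := boolP (t \in U m).
  have [u hu hut] := usx t ht; rewrite (bigD1_seq u) //= big_seq_cond big1 ?addr0 ?indicE ?mem_set //.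
  move=> v /andP[hv vu]; rewrite indicE; case: (boolP (t \in coset v n)) => // /set_mem h.
  by move/eqP: vu; case; apply: usi => //; have := coset_trans h (coset_sym hut).
rewrite big_seq big1 // => u /us0 hu; rewrite indicE; case: (boolP (t \in coset u n)) => // /set_mem h.
exfalso; apply: ht; apply/mem_set; have := UM hu (coset_sub mn h).
by rewrite mulVKg.
Qed.

(** The component of [x] orthogonal to [E] has integral 0 over every coset, and cosets form a
    pi-system generating the Borel sets. *)
Lemma xi_total E : closed_sub E -> (forall g n, E (lam g (xi n))) -> forall x : L2 mu, E x.
Proof.
move=> cE hE x; suff y0 : x - oproj E x = 0.
  by rewrite (subr0_eq y0); exact: projE.
have hy := @proj_orth _ _ _ cE x; move: (x - oproj E x) hy => y.
elim/l2ind: y => f hf hy; suff f0 : aeq mu f (fun=> 0).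
  by apply/(l2classP hf (l2fun0 mu)).
have mcl := borel_coset_class 0.
have int0 g n : l2ip mu f (ind g n) = 0.
  by rewrite -L2_ip; [rewrite -lam_xi hy|exact: hf|exact: coset_l2].
(* A square-integrable [f] is integrable on a coset of [U 0], which has finite measure, so the
   argument is made on each of these countably many cosets. The function [p] will be the real or the
   imaginary part. *)
have key (p : R[i] -> R) g : (forall z (b : bool), p (z * Num.conj (b%:R : R)%:C%C) = p z * b%:R) ->
    (forall h n, mu.-integrable setT (EFin \o (p \o (fun t => f t * Num.conj (ind h n t)))) /\
       (\int[mu]_t p (f t * Num.conj (ind h n t)) = 0)%R) ->
    {ae mu, forall t, coset g 0 t -> p (f t) = 0}.
  move=> pb hp; pose F t := p (f t * Num.conj (ind g 0 t)).
  have iF : mu.-integrable setT (EFin \o F) by case: (hp g 0%N).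
  have I0 h n : (\int[mu]_t (p (f t * Num.conj (ind h n t)))%:E = 0)%E.
    have [i0 r0] := hp h n; rewrite -[LHS]fineK ?integrable_fin_num //.
    by congr EFin; exact: r0.
  have : {ae mu, forall t, F t = 0}.
    apply: (pi_system_ae0 mcl (coset_classI (m := 0))) => //; first exact: I0.
    move=> A hA; have := coset_classI hA (or_intror (ex_intro _ g (ex_intro _ 0%N (conj (leqnn 0) erefl)))).
    rewrite integral_mkcond => hAg.
    have -> : (fun t => (F t)%:E) \_ A = fun t => (p (f t * Num.conj (@l2ind_fun _ (borel G) R (A `&` coset g 0) t)))%:E.
      apply/funext => t; rewrite /patch /F /l2ind_fun !indicE (@classical_sets.in_setI _ t A (coset g 0)).
      by case: (t \in A) => //=; rewrite (pb _ false) mulr0.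
    case: hAg => [->|[h [n [_ ->]]]]; last exact: I0.
    rewrite integral0_eq // => t _; rewrite /l2ind_fun indic0 (pb _ false) mulr0 //.
  apply: filterS => t; rewrite /F /l2ind_fun indicE pb => h ht.
  by move: h; rewrite mem_set // mulr1.
have lin h n : l2fun mu (ind h n) by exact: coset_l2.
have all0 (p : R[i] -> R) : (forall z (b : bool), p (z * Num.conj (b%:R : R)%:C%C) = p z * b%:R) ->
    (forall h n, mu.-integrable setT (EFin \o (p \o (fun t => f t * Num.conj (ind h n t)))) /\
       (\int[mu]_t p (f t * Num.conj (ind h n t)) = 0)%R) ->
    {ae mu, forall t, p (f t) = 0}.
  move=> pb hp; have /ae_foralln : forall j, {ae mu, forall t, nth_coset 0 j t -> p (f t) = 0}.
    move=> j; have [->|[g ->]] := nth_cosetE 0 j; first by apply: nearW.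
    exact: key.
  by apply: filterS => t /(_ (coset_code 0 t)); apply.
have r0 : {ae mu, forall t, Re (f t) = 0}.
  apply: (all0 Re) => [z b|h n]; first by rewrite realC_conj Defs.ReM /= mulr0 subr0.
  have [i1 _] := l2mul_integrable hf (lin h n); split=> //.
  by have := congr1 Re (int0 h n).
have i0 : {ae mu, forall t, Im (f t) = 0}.
  apply: (all0 Im) => [z b|h n]; first by rewrite realC_conj Defs.ImM /= mulr0 add0r.
  have [_ i1] := l2mul_integrable hf (lin h n); split=> //.
  by have := congr1 Im (int0 h n).
by apply: filterS2 r0 i0 => t; case: (f t) => a b /= -> ->.
Qed.

Theorem haar_typeII : typeII (group_vna mu) id.
Proof.
exact: (LG_typeII act1 actM act_inj act_ex act_onto hd hk lam_urep rrep_urep lam_rrep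
  xi_U xi_O xi_perp xi_neq0 xi_split xi_total).
Qed.

Theorem haar_not_typeI : ~ typeI (group_vna mu).
Proof.
exact: (LG_not_typeI act1 actM act_inj act_ex act_onto hd hk lam_urep rrep_urep lam_rrep
  xi_U xi_O xi_perp xi_neq0 xi_split xi_total).
Qed.

(** Strong continuity holds because the vectors in [P], whose orbit maps are locally constant, are
    dense: they include all translates of the [xi n]. *)
Lemma lam_unitary : unitary_rep lam.
Proof.
have [l1 l2 l3 l4] := lam_urep; split=> // x g e e0.
pose P := [set y : L2 mu | forall h, exists n, forall h', coset h n h' -> lam h' y = lam h y].
have P0 : P 0 by move=> h; exists 0%N => h' _; rewrite !(lin0 (l1 _)).
have Plc (a : R[i]) (y z : L2 mu) : P y -> P z -> P (a *: y + z).
  move=> hy hz h; have [n hn] := hy h; have [n' hn'] := hz h; exists (maxn n n') => h' hh.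
  rewrite !l1 hn ?hn' //.
    by apply: coset_sub hh; exact: leq_maxr.
  by apply: coset_sub hh; exact: leq_maxl.
have cP := adherent_closed P0 Plc.
have hP : adherent P x.
  apply: (xi_total cP) => k0 n; apply: sub_adherent => h.
  have [m hm] := act_ex k0; exists (maxn n m) => h' hh.
  have om : O (maxn n m) k0 by apply: (On_mono act1 actM) hm; exact: leq_maxr.
  have hu := Un_norm act1 actM (OV om) hh; rewrite invgK in hu.
  have := xi_U (Un_anti act1 actM (leq_maxl n m) hu) => {2}<-.
  rewrite -!(uM lam_urep); congr (lam _ _).
  by rewrite !mulgA mulgK mulgV mul1g.
have [|y Py xy] := hP (e ^+ 2 / 4); first by rewrite divr_gt0 // exprn_gt0.
have [n hn] := Py g.
have : nbhs g (coset g n) by apply: open_nbhs_nbhs; split; [exact: coset_open|exact: coset_self].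
apply: filterS => h hh; rewrite hnorm_lt //.
have -> : lam h x - lam g x = lam h (x - y) - lam g (x - y).
  by rewrite (linB (l1 h)) (linB (l1 g)) hn // opprB addrA subrK.
apply: le_lt_trans (nsqB_le _ _) _; rewrite !(unsq lam_urep).
by move: xy; rewrite ltr_pdivlMr //; lra.
Qed.
End Haar.

(** * Existence of Haar measure *)

Section HaarExistence.
Variable R : realType.

Definition reps n : seq G := xget [::] [set us : seq G | [/\ uniq us,
  forall u, u \in us -> U n u,
  forall x, U n x -> exists2 u, u \in us & U n.+1 (u^-1 * x)%g
  & forall u u', u \in us -> u' \in us -> U n.+1 (u^-1 * u')%g -> u = u']].

Lemma repsP n : [/\ uniq (reps n), forall u, u \in reps n -> U n u,
  forall x, U n x -> exists2 u, u \in reps n & U n.+1 (u^-1 * x)%g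
  & forall u u', u \in reps n -> u' \in reps n -> U n.+1 (u^-1 * u')%g -> u = u'].
Proof. exact: (xgetPex [::] (coset_reps (leqnSn n))). Qed.

(** The position of the coset of [U n.+1] containing [g] among those that make up its coset of
    [U n], counted from the chosen representative of the latter. *)
Definition idx n g : nat := find (fun u => `[< U n.+1 (u^-1 * ((coset_rep n g)^-1 * g))%g >]) (reps n).

Lemma idx_lt n g : (idx n g < size (reps n))%N.
Proof.
rewrite -has_find; have [_ _ h _] := repsP n; have [u hu hg] := h _ (coset_sym (coset_repP n g)).
by apply/hasP; exists u => //; apply/asboolP.
Qed.

Lemma idx_nth n g : U n.+1 ((nth 1%g (reps n) (idx n g))^-1 * ((coset_rep n g)^-1 * g))%g.
Proof.
have := idx_lt n g; rewrite -has_find => /(nth_find 1%g) /asboolP.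
exact.
Qed.

Lemma coset_rep_eq n g h : coset g n h -> coset_rep n g = coset_rep n h.
Proof. by move=> /coset_eq e; rewrite /coset_rep e. Qed.

Lemma idx_eq n g h : coset g n h -> idx n g = idx n h <-> coset g n.+1 h.
Proof.
move=> gh; have e := coset_rep_eq gh; split=> [ei|hh].
  have := idx_nth n g; have := idx_nth n h; rewrite ei -e => h1 /UV h2.
  have := UM h2 h1; rewrite !invgM !invgK !mulgA.
  by rewrite -(mulgA _ _ (nth _ _ _)^-1%g) mulgV mulg1 -(mulgA g^-1%g) mulgV mulg1.
rewrite /idx -e; apply: eq_find => u; apply/asboolP/asboolP => hu.
  by have := UM hu hh; rewrite !mulgA mulgK.
by have := UM hu (UV hh); rewrite invgM invgK !mulgA mulgK.
Qed.

Lemma idx_onto n g i : (i < size (reps n))%N -> exists2 h, coset g n h & idx n h = i.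
Proof.
move=> hi; have [us uu _ ud] := repsP n; set u := nth 1%g (reps n) i.
have hu : u \in reps n by exact: mem_nth.
have ch : coset g n (coset_rep n g * u)%g.
  by apply: coset_trans (coset_repP n g) _; rewrite /coset /= mulKg; exact: uu.
exists (coset_rep n g * u)%g => //.
have := idx_nth n (coset_rep n g * u)%g; rewrite -(coset_rep_eq ch) mulKg => h.
have {h}/eqP := ud _ _ (mem_nth 1%g (idx_lt n _)) hu h.
by rewrite nth_uniq // ?idx_lt // => /eqP.
Qed.

(** The inverse of the index of [U n] in [U 0], so that [U 0] gets measure 1. *)
Fixpoint ell n : R := if n is m.+1 then ell m / (size (reps m))%:R else 1.
Fixpoint left_end n g : R :=
  if n is m.+1 then left_end m g + (idx m g)%:R * ell n else (coset_code 0 g)%:R.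

Lemma reps_gt0 n : (0 < size (reps n))%N.
Proof. exact: leq_ltn_trans (leq0n _) (idx_lt n 1%g). Qed.
Lemma ell_gt0 n : 0 < ell n.
Proof. by elim: n => //= n IHn; rewrite divr_gt0 // ltr0n reps_gt0. Qed.
Lemma ellS n : ell n = (size (reps n))%:R * ell n.+1.
Proof. by rewrite /= mulrCA divff ?mulr1 // pnatr_eq0 -lt0n reps_gt0. Qed.

(* Each coset of [U n] is assigned an interval of length [ell n] of the real line, in such a
   way that the intervals of the cosets of [U n.+1] subdivide those of the cosets of [U n];
   Haar measure is the image of Lebesgue measure. *)
Definition coset_itv n g : set R := `[left_end n g, left_end n g + ell n[.

Lemma coset_itvP n g t : coset_itv n g t <-> left_end n g <= t < left_end n g + ell n.
Proof. by rewrite /coset_itv /= in_itv. Qed.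

Lemma left_end_eq n g h : coset g n h -> left_end n g = left_end n h.
Proof.
elim: n g h => [|n IHn] g h hh /=; first by congr (_%:R); apply/coset_codeP.
rewrite (IHn g h); last exact: coset_sub hh.
by congr (_ + _%:R * _); apply/idx_eq => //; exact: coset_sub hh.
Qed.

Lemma coset_itv_sub n g : coset_itv n.+1 g `<=` coset_itv n g.
Proof.
move=> t /coset_itvP; rewrite [left_end n.+1 g]/= => /andP[h1 h2]; apply/coset_itvP.
have e0 := ell_gt0 n.+1; have i0 : 0 <= (idx n g)%:R * ell n.+1 by rewrite mulr_ge0 // ltW.
have i1 : (idx n g)%:R * ell n.+1 + ell n.+1 <= ell n.
  have -> : (idx n g)%:R * ell n.+1 + ell n.+1 = (idx n g).+1%:R * ell n.+1.
    by rewrite -natr1 mulrDl mul1r.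
  by rewrite [leRHS]ellS ler_pM2r // ler_nat idx_lt.
apply/andP; split; first by apply: le_trans h1; rewrite lerDl.
by apply: lt_le_trans h2 _; rewrite -addrA lerD2l.
Qed.

Lemma floor_step (a l t : R) (q : nat) : 0 < l -> a <= t < a + q%:R * l ->
  exists2 i, (i < q)%N & a + i%:R * l <= t < a + i%:R * l + l.
Proof.
move=> l0; elim: q => [|q IHq]; first by rewrite mul0r addr0 => /andP[h1 /(le_lt_trans h1)]; rewrite ltxx.
move=> /andP[h1 h2]; have [h|h] := ltP t (a + q%:R * l).
  by have [|i iq hi] := IHq; [rewrite h1|exists i => //; exact: ltnW].
by exists q => //; rewrite h /=; move: h2; rewrite -natr1 mulrDl mul1r addrA.
Qed.

Lemma coset_itv_step n g t : coset_itv n g t -> exists2 h, coset g n h & coset_itv n.+1 h t.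
Proof.
move=> /coset_itvP; rewrite ellS => /(floor_step (ell_gt0 n.+1))[i iq hi].
have [h gh hh] := idx_onto g iq; exists h => //; apply/coset_itvP.
by rewrite [left_end n.+1 h]/= -/(ell n.+1) hh -(left_end_eq gh).
Qed.

Lemma coset_itv_inj n g h t : coset_itv n g t -> coset_itv n h t -> coset g n h.
Proof.
have key (l : R) i j a : 0 < l -> a + i%:R * l <= t < a + i%:R * l + l ->
    a + j%:R * l <= t < a + j%:R * l + l -> i = j.
  move=> l0; wlog ij : i j / (i <= j)%N => [H|] h1 h2.
    by have [ij|/ltnW ji] := leqP i j; [exact: H|apply/esym/H].
  apply/eqP; rewrite eqn_leq ij leqNgt; apply/negP => lt_ij.
  have : a + i%:R * l + l <= a + j%:R * l.
    rewrite -addrA lerD2l; have -> : i%:R * l + l = i.+1%:R * l by rewrite -natr1 mulrDl mul1r.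
    by rewrite ler_pM2r // ler_nat.
  by move: h1 h2 => /andP[_ h1] /andP[h2 _]; lra.
elim: n => [|n IHn] hg hh.
  move: hg hh => /coset_itvP/= hg /coset_itvP/= hh; apply/coset_codeP.
  by apply: (key 1 _ _ 0) => //; rewrite add0r mulr1.
have gh := IHn (coset_itv_sub hg) (coset_itv_sub hh); apply/(idx_eq gh).
move: hg hh => /coset_itvP hg /coset_itvP; rewrite [left_end n.+1 h]/= -/(ell n.+1) -(left_end_eq gh) => hh.
exact: (key _ _ _ _ (ell_gt0 n.+1) hg hh).
Qed.

(** Only unit intervals whose number is the code of a coset of [U 0] are kept: the others correspond
    to no element of the group. *)
Definition haar_dom : set R := \bigcup_j (if `[< nth_coset 0 j !=set0 >] then `[j%:R, j%:R + 1[%classic else set0).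

Lemma haar_domP t : haar_dom t <-> exists g, coset_itv 0 g t.
Proof.
split=> [[j _]|[g hg]].
  by case: asboolP => // -[g <-] ht; exists g.
exists (coset_code 0 g) => //; rewrite asboolT //; by exists g.
Qed.

Lemma haar_dom_meas : measurable haar_dom.
Proof. by apply: bigcupT_measurable => j; case: asboolP => _ //; exact: measurable_itv. Qed.

(** Following the subintervals that contain [t] gives nested cosets, which have a common point by
    [nested_cosets]. *)
Lemma coset_itv_limit t : haar_dom t -> exists g, forall n, coset_itv n g t.
Proof.
move=> /haar_domP[g0 h0].
have /choice[f hf] (p : nat * G) : exists h, coset_itv p.1 p.2 t -> coset p.2 p.1 h /\ coset_itv p.1.+1 h t.
  have [ht|nt] := pselect (coset_itv p.1 p.2 t); last by exists 1%g.
  by have [h h1 h2] := coset_itv_step ht; exists h.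
pose c := fix c n := if n is m.+1 then f (m, c m) else g0.
have hc n : coset_itv n (c n) t by elim: n => //= n IHn; have [] := hf (n, c n) IHn.
have [g hg] := @nested_cosets c (fun n => (hf (n, c n) (hc n)).1).
by exists g => n; rewrite /coset_itv -(left_end_eq (hg n)); exact: hc.
Qed.

Definition haar_map (t : R) : borel G := xget 1%g [set g | forall n, coset_itv n g t].

Lemma haar_mapP t n g : haar_dom t -> coset g n (haar_map t) <-> coset_itv n g t.
Proof.
move=> ht; have h : forall n, coset_itv n (haar_map t) t := xgetPex 1%g (coset_itv_limit ht).
split=> [e|hg]; first by rewrite /coset_itv (left_end_eq e); exact: h.
exact: coset_itv_inj hg (h n).
Qed.

Lemma coset_itv_dom n g : coset_itv n g `<=` haar_dom.
Proof.
move=> t; elim: n => [|n IHn]; first by move=> h; apply/haar_domP; exists g.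
by move=> /coset_itv_sub.
Qed.

Lemma haar_map_meas : measurable_fun setT haar_map.
Proof.
apply: (@coset_measurable_fun _ _ 0) => g n _.
have -> : haar_map @^-1` coset g n = coset_itv n g `|` (haar_map @^-1` coset g n `&` ~` haar_dom).
  apply/seteqP; split=> [t ht|t [ht|[]//]].
    by have [hd'|nd] := pselect (haar_dom t); [left; exact/(haar_mapP _ _ hd')|right].
  by apply/(haar_mapP n g (coset_itv_dom ht)).
apply: measurableU; first exact: measurable_itv.
(* Off [haar_dom] the map takes its default value 1, so this part of the preimage is empty or the
   whole complement, according to whether the coset contains 1. *)
have out t : ~ haar_dom t -> haar_map t = 1%g.
  move=> nt; rewrite /haar_map; case: xgetP => // h _ hh; exfalso; apply: nt.
  by apply/haar_domP; exists h; exact: (hh 0%N).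
have [h1|h1] := pselect (coset g n 1%g).
  rewrite (_ : _ `&` _ = ~` haar_dom); first by apply: measurableC; exact: haar_dom_meas.
  by apply/seteqP; split=> [t []//|t ht]; split=> //; rewrite /preimage /= out.
rewrite (_ : _ `&` _ = set0) //; apply/seteqP; split=> // t [h2 ht]; apply: h1.
by move: h2; rewrite /preimage /= out.
Qed.

Definition haar_measure : {measure set (borel G) -> \bar R} :=
  measure_function_pushforward__canonical__measure_function_Measure
    (mrestr lebesgue_measure haar_dom_meas) haar_map_meas.

Lemma haar_measure_coset g n : haar_measure (coset g n) = (ell n)%:E.
Proof.
rewrite /haar_measure /= /pushforward /mrestr (_ : _ `&` _ = coset_itv n g).
  by rewrite lebesgue_measure_itv /= lte_fin ltrDl ell_gt0 -EFinD addrAC subrr add0r.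
apply/seteqP; split=> [t [ht hd']|t ht]; first exact/(haar_mapP _ _ hd').
have hd' := coset_itv_dom ht; split=> //; exact/(haar_mapP _ _ hd').
Qed.

Lemma haar_measure_fin : (haar_measure (U 0) < +oo)%E.
Proof. by rewrite -coset1 haar_measure_coset ltry. Qed.

Lemma haar_measure_neq0 : haar_measure [set: borel G] != 0%E.
Proof.
rewrite gt_eqF //; apply: (@lt_le_trans _ _ (haar_measure (coset 1%g 0))).
  by rewrite haar_measure_coset lte_fin.
by apply: le_measure; rewrite ?inE //; exact: coset_measurable.
Qed.

(** The measure of a coset depends on its level only, left translation permutes the cosets of each
    level, and their measures determine the measure. *)
Lemma haar_measure_inv g (A : set (borel G)) : measurable A ->
  haar_measure [set (g * x : G)%g | x in A] = haar_measure A.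
Proof.
move=> mA; pose nu : {measure set (borel G) -> \bar R} :=
  measure_function_pushforward__canonical__measure_function_Measure haar_measure (ltrans_meas g).
transitivity (nu A).
  rewrite /nu /= {2}/pushforward; congr (haar_measure _).
  apply/seteqP; split=> [_ [x hx <-]|x hx]; first by rewrite /preimage /ltrans /= mulKg.
  by exists (g^-1 * x)%g => //; rewrite mulVKg.
apply/esym/(@coset_measure_unique R haar_measure 0 nu) => // [h n _|h].
  rewrite haar_measure_coset /nu /= {1}/pushforward ltrans_coset.
  by have := haar_measure_coset (g * h)%g n => /= ->.
by rewrite haar_measure_coset ltry.
Qed.

Theorem not_typeI_group : ~ typeI_group R G.
Proof.
move=> /(_ _ _ (lam_unitary haar_measure_fin haar_measure_inv)).
exact: (haar_not_typeI haar_measure_neq0 haar_measure_fin haar_measure_inv).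
Qed.
End HaarExistence.

Theorem left_haar_typeII (R : realType) (mu : {measure set (borel G) -> \bar R}) :
  left_haar mu -> typeII (group_vna mu) id.
Proof.
move=> [h1 h2 h3]; apply: haar_typeII => //; exact: h2 U0_compact.
Qed.
End Cosets.

Theorem theorem1 (R : realType) (d k : nat) (hd : (2 <= d)%N) (hk : (2 <= k)%N) :
  (forall mu : {measure set (borel (neretinO d k)) -> \bar R},
     left_haar mu -> typeII (group_vna mu) id)
  /\ ~ typeI_group R (neretinO d k).
Proof.
have hk0 : (0 < k)%N by exact: ltnW.
split=> [mu|].
  exact: (left_haar_typeII (@act1 d k hd) (@actM d k hd) (@act_inj d k hd)
    (@act_ex d k hd) (@act_onto d k hd) hd hk0 (@coset_open d k hd) (@open_coset d k hd)).
exact: (not_typeI_group (@act1 d k hd) (@actM d k hd) (@act_inj d k hd)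
  (@act_ex d k hd) (@act_onto d k hd) hd hk0 (@coset_open d k hd) (@open_coset d k hd)).
Qed.
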